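(* For each fixed integer $(r,s)\times t$ bimatrix $A$, there is an algorithm that, given a positive integer $n$, bounds $l,u\in\mathbb{Z}_\infty^{nt}$, $b\in\mathbb{Z}^{r+ns}$, and $w\in\mathbb{Z}^{nt}$, solves, in time which is polynomial in $n$ and in the binary-encoding length $\langle l,u,b,w\rangle$ of the rest of the data, the linear $n$-fold integer programming problem $$\min\left\{wx\ :\ x\in\mathbb{Z}^{nt},\ A^{(n)}x=b,\ l\le x\le u\right\}.$$
   Context: $\mathbb{Z}_\infty:=\mathbb{Z}\uplus\{\pm\infty\}$. An integer $(r,s)\times t$ bimatrix is an integer matrix $A$ with two blocks $A_1,A_2$: $A_1$ is the $r\times t$ submatrix consisting of its first $r$ rows and $A_2$ is the $s\times t$ submatrix consisting of its last $s$ rows (a block may be empty). The $n$-fold product of $A$ is the $(r+ns)\times nt$ matrix $$A^{(n)}:=\begin{pmatrix} A_1 & A_1 & \cdots & A_1 \\ A_2 & 0 & \cdots & 0 \\ 0 & A_2 & \cdots & 0 \\ \vdots & \vdots & \ddots & \vdots \\ 0 & 0 & \cdots & A_2 \end{pmatrix}.$$ $\langle\cdot\rangle$ denotes binary-encoding length, and $wx$ is the standard inner product. Convention: an algorithm solves an integer programming problem if it either finds an optimal solution $x$ or concludes that the feasible set is infinite or empty. *)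

(* Defs.v *)
From mathcomp Require Import all_boot all_order all_algebra.
From mathcomp Require Import classical_sets cardinality constructive_ereal.
From mathcomp Require Import mxtens.

Set Implicit Arguments.
Unset Strict Implicit.
Unset Printing Implicit Defensive.

Import Order.TTheory GRing.Theory Num.Theory.

Local Open Scope classical_set_scope.
Local Open Scope ring_scope.

(* Binary-encoding length: one sign bit plus ceil (log2 (|z| + 1)). *)
Definition bits (z : int) : nat := (1 + up_log 2 `|z|.+1)%N.

(* The set Z_oo of integers extended with +-oo is [\bar int]. *)
Definition ebits (z : \bar int) : nat :=
  match z with EFin a => bits a | +oo%E | -oo%E => 1%N end.

(* Model of computation: while-programs over a random access memory of      *)
(* integer cells, with indirect addressing, under the logarithmic cost      *)
(* criterion (every operation costs the total bit length of its operands,   *)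
(* addresses included). Cells are addressed by arbitrary integers.          *)
Definition memory := int -> int.

Definition update (m : memory) (a v : int) : memory :=
  fun a' => if a' == a then v else m a'.

Variant binop := Add | Sub | Mul | Div.

(* [Div] is Euclidean division, with quotient 0 when the divisor is 0. *)
Definition binop_eval (o : binop) (x y : int) : int :=
  match o with
  | Add => x + y
  | Sub => x - y
  | Mul => x * y
  | Div => (x %/ y)%Z
  end.

Inductive expr :=
  | Const of int
  | Read of expr
  | Binop of binop & expr & expr.

Fixpoint eval (m : memory) (e : expr) : int :=
  match e with
  | Const z => z
  | Read a => m (eval m a)
  | Binop o e1 e2 => binop_eval o (eval m e1) (eval m e2)
  end.

Fixpoint eval_cost (m : memory) (e : expr) : nat :=
  match e with
  | Const z => bits z
  | Read a => (eval_cost m a + bits (eval m a) + bits (m (eval m a)))%N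
  | Binop _ e1 e2 =>
      (eval_cost m e1 + eval_cost m e2 + bits (eval m e1) + bits (eval m e2))%N
  end.

Inductive program :=
  | Skip
  | Write of expr & expr
  | Seq of program & program
  | If of expr & program & program
  | While of expr & program.

Definition test_cost (m : memory) (e : expr) : nat :=
  (eval_cost m e + bits (eval m e))%N.

(* [exec p m m' k]: started in memory [m], the program [p] halts in memory   *)
(* [m'] after time [k]. A guard succeeds when its value is positive.         *)
Inductive exec : program -> memory -> memory -> nat -> Prop :=
  | ExecSkip m : exec Skip m m 1%N
  | ExecWrite a e m :
      exec (Write a e) m (update m (eval m a) (eval m e))
           (eval_cost m a + eval_cost m e + bits (eval m a) + bits (eval m e))%N
  | ExecSeq p1 p2 m m1 m2 k1 k2 :
      exec p1 m m1 k1 -> exec p2 m1 m2 k2 -> exec (Seq p1 p2) m m2 (k1 + k2)%N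
  | ExecIfTrue e p1 p2 m m' k :
      0 < eval m e -> exec p1 m m' k ->
      exec (If e p1 p2) m m' (test_cost m e + k)%N
  | ExecIfFalse e p1 p2 m m' k :
      eval m e <= 0 -> exec p2 m m' k ->
      exec (If e p1 p2) m m' (test_cost m e + k)%N
  | ExecWhileTrue e p m m1 m2 k1 k2 :
      0 < eval m e -> exec p m m1 k1 -> exec (While e p) m1 m2 k2 ->
      exec (While e p) m m2 (test_cost m e + k1 + k2)%N
  | ExecWhileFalse e p m :
      eval m e <= 0 -> exec (While e p) m m (test_cost m e).

(* The input occupies the cells 0, 1, 2, ...; all other cells hold 0. *)
Definition init_memory (s : seq int) : memory :=
  fun a => match a with Posz i => s`_i | Negz _ => 0 end.

Definition col_seq (T : Type) (N : nat) (v : 'cV[T]_N) : seq T :=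
  [seq v i 0 | i <- enum 'I_N].

(* Each extended integer takes two cells: a tag (0 for finite, 1 for +oo,   *)
(* -1 for -oo) and a value.                                                 *)
Definition encode_ext (z : \bar int) : seq int :=
  match z with
  | EFin a => [:: 0; a]
  | +oo%E => [:: 1; 0]
  | -oo%E => [:: -1; 0]
  end.

Definition encode_input (n N M : nat) (l u : 'cV[\bar int]_N)
    (b : 'cV[int]_M) (w : 'cV[int]_N) : seq int :=
  n%:Z :: flatten (map encode_ext (col_seq l)) ++
          flatten (map encode_ext (col_seq u)) ++ col_seq b ++ col_seq w.

Definition input_length (N M : nat) (l u : 'cV[\bar int]_N)
    (b : 'cV[int]_M) (w : 'cV[int]_N) : nat :=
  (\sum_(i < N) ebits (l i ord0) + \sum_(i < N) ebits (u i ord0) +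
   \sum_(i < M) bits (b i ord0) + \sum_(i < N) bits (w i ord0))%N.

Variant answer (N : nat) :=
  | Optimal of 'cV[int]_N
  | InfiniteSet
  | EmptySet.
Arguments InfiniteSet {N}.
Arguments EmptySet {N}.

(* Cell 0 holds the verdict and, if it is 0, the cells 1, ..., N hold the    *)
(* solution.                                                                 *)
Definition decode_answer (N : nat) (m : memory) : answer N :=
  if m 0 == 0 then Optimal (\col_(i < N) m (i.+1%:Z))
  else if m 0 == 1 then InfiniteSet else EmptySet.

Definition inner (N : nat) (w x : 'cV[int]_N) : int :=
  \sum_(i < N) w i 0 * x i 0.

Definition feasible_set (M N : nat) (B : 'M[int]_(M, N)) (b : 'cV[int]_M)
    (l u : 'cV[\bar int]_N) : set 'cV[int]_N :=
  [set x | B *m x = b /\ forall i, (l i ord0 <= (x i ord0)%:E <= u i ord0)%E].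

(* To solve min {w x : x in S} is to return an optimal point or to conclude,  *)
(* rightly, that S is infinite or that S is empty.                           *)
Definition solves_min (N : nat) (w : 'cV[int]_N) (S : set 'cV[int]_N)
    (a : answer N) : Prop :=
  match a with
  | Optimal x => S x /\ forall y, S y -> inner w x <= inner w y
  | InfiniteSet => infinite_set S
  | EmptySet => S = set0
  end.

(* [mxtens_unindex j] is (j %/ t, j %% t), and the lower block is the        *)
(* Kronecker product of the n x n identity with A_2, i.e. diag(A_2,...,A_2). *)
Definition nfold (r s t : nat) (A : 'M[int]_(r + s, t)) (n : nat)
    : 'M[int]_(r + n * s, n * t) :=
  col_mx (\matrix_(i < r, j < n * t) usubmx A i (mxtens_unindex j).2)
         (tensmx (1%:M : 'M[int]_n) (dsubmx A)).

(* Main.v *)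
Require Import Defs.
From mathcomp Require Import all_boot all_order all_algebra.
From mathcomp Require Import classical_sets cardinality constructive_ereal.
From mathcomp Require Import boolp mxtens zify.

Set Implicit Arguments.
Unset Strict Implicit.
Unset Printing Implicit Defensive.

Import Order.TTheory GRing.Theory Num.Theory.

(** A point [x] of the n-fold program is cut into [n] bricks, the columns of a [t x n] matrix
    [X]. The equations say that [A_2 X] is prescribed and that [A_1] has a prescribed value at
    the sum of the bricks, so the difference of two solutions is a matrix of the kernel, with
    all columns in the kernel of [A_2] and a sum of columns in the kernel of [A_1].

    Kernel. Say that [u] conforms to [v] if each entry of [u] lies between 0 and the entry of
    [v]. By Dickson's lemma the kernel of [A_2] has finitely many conformally minimal nonzero
    vectors [H_i]. Each brick of a kernel matrix is a conformal sum of them; the numbers of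
    times that they are used in total form a nonnegative solution of [sum_i y_i A_1 H_i = 0],
    and a second use of Dickson's lemma bounds the minimal solutions by a constant [C]. Hence
    ([small_kernel_element]) every nonzero kernel matrix has a nonzero conforming matrix
    obtained by putting the [C] columns of one of finitely many patterns into [C] bricks. For
    fixed [A] there are only [O(n^C)] such moves, and every kernel matrix is a conformal sum of
    multiples of moves ([decomposition]).

    Optimization in a box. From a feasible [x] to an optimal [y], the difference is a
    conformal sum of multiples of moves, so all the points on the way stay in the box. If no
    step by a power of 2 times a move gains [d], then the gap to the optimum is at most [2 d]
    times the number of moves, and it is 0 for [d = 1] ([optimality_gap]). The program halves
    [d] from the size of the objective down to 1, and at each level tries all steps a number
    of times proportional to the number of moves ([hoare_optimize]).

    Infinite bounds and the first feasible point. Slack variables in all equations give a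
    trivial starting point: lower bounds for [x], residues for the slacks. Each slack may move
    between its residue and 0, at a cost that exceeds anything that [x] can gain. Infinite
    bounds are replaced by [O] or [- O]. If no move is an improving ray, a feasible point can
    be replaced by one which is as good and lies within [O] ([proximity]): only the steps
    along a move that are bounded by a slack or by a finite bound are kept, and they are few.
    So the optimum of the box has a nonzero slack only if the program is infeasible; when the
    slacks vanish, a last search for improving moves in a slightly larger box succeeds only if
    there is an improving ray, in which case the feasible set is infinite, and otherwise the
    optimum of the box is a true optimum ([box_sound]).

    Cost. All numbers in memory are at most a fixed power of the sum [R] of a constant and of
    the squares of the entries of the input, so their bit length is linear in that of the input
    ([bit_bound_linear]). Loops run at most a number of times polynomial in [n] and in this
    bound, whence the polynomial running time ([polynomial_main]). The program is analysed with
    a Hoare logic for total correctness with time bounds ([hoare]). *)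

(** * Small elements of the kernel *)

Section Dickson.

(** Dickson's lemma, for vectors of which the first [k] entries count. By induction on [k]: the
    elements that exceed, in the last entry, all representatives found for the other entries
    are covered by these, and the rest have one of finitely many last entries. *)
Lemma dickson (k : nat) (P : (nat -> nat) -> Prop) :
  exists Y : seq (nat -> nat),
    (forall y, List.In y Y -> P y) /\
    (forall y, P y -> exists2 y', List.In y' Y & forall i, i < k -> y' i <= y i).
Proof.
elim: k P => [|k IHk] P.
  have [[y0 Py0]|noP] := pselect (exists y, P y).
    exists [:: y0]; split=> [y [<- //|[]]|y _].
    by exists y0 => //; left.
  by exists [::]; split=> // y Py; case: noP; exists y.
have [Y [YP Ydom]] := IHk P.
pose c := \max_(y <- Y) y k.
have Yle y : List.In y Y -> y k <= c.
  rewrite /c; elim: (Y) => //= a Y' IH [->|/IH]; rewrite big_cons ?leq_maxl //.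
  by move/leq_trans; apply; rewrite leq_maxr.
(* Below the threshold the last coordinate takes finitely many values, and
   each value is a problem in one dimension less *)
have [Z [ZP Zdom]] : exists Z : seq (nat -> nat),
    (forall y, List.In y Z -> P y) /\
    (forall y, P y -> y k < c ->
       exists2 y', List.In y' Z & forall i, i < k.+1 -> y' i <= y i).
  elim: (c) => [|d [Z [ZP Zdom]]]; first by exists [::].
  have [Y' [Y'P Y'dom]] := IHk (fun y => P y /\ y k = d).
  exists (Y' ++ Z); split=> [y|y Py].
    by move/(@List.in_app_or _ _ _ _) => [/Y'P[]|/ZP].
  rewrite ltnS leq_eqVlt => /orP[/eqP yd|ltyd].
    have [y' y'Y le] := Y'dom y (conj Py yd).
    exists y'; first by apply: List.in_or_app; left.
    move=> i; rewrite ltnS leq_eqVlt => /orP[/eqP->|/le//].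
    by have [_ ->] := Y'P _ y'Y; rewrite yd.
  have [y' y'Z le] := Zdom y Py ltyd.
  by exists y' => //; apply: List.in_or_app; right.
exists (Y ++ Z); split=> [y|y Py].
  by move/(@List.in_app_or _ _ _ _) => [/YP|/ZP].
have [ltyc|leyc] := ltnP (y k) c.
  have [y' y'Z le] := Zdom y Py ltyc.
  by exists y' => //; apply: List.in_or_app; right.
have [y' y'Y le] := Ydom y Py.
exists y'; first by apply: List.in_or_app; left.
move=> i; rewrite ltnS leq_eqVlt => /orP[/eqP->|/le//].
exact: leq_trans (Yle _ y'Y) leyc.
Qed.

End Dickson.

Section Conformal.
Local Open Scope ring_scope.

Definition conformal1 (a b : int) : bool := (0 <= a <= b) || (b <= a <= 0).

Definition conformal (m n : nat) (u v : 'M[int]_(m, n)) : Prop :=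
  forall i j, conformal1 (u i j) (v i j).

Definition norm1 (m n : nat) (u : 'M[int]_(m, n)) : nat :=
  \sum_i \sum_j `|u i j|%N.

Lemma norm1_eq0 m n (u : 'M[int]_(m, n)) : norm1 u = 0%N -> u = 0.
Proof.
move=> /eqP; rewrite sum_nat_eq0 => /forallP u0; apply/matrixP=> i j; rewrite mxE.
by have := u0 i; rewrite sum_nat_eq0 => /forallP /(_ j) /=; rewrite absz_eq0 => /eqP.
Qed.

Lemma norm1_gt0 m n (u : 'M[int]_(m, n)) : u != 0 -> (0 < norm1 u)%N.
Proof. by rewrite lt0n; apply: contra => /eqP/norm1_eq0 ->. Qed.

(** Conformal vectors do not cancel, so the norm decreases when a conforming part is
    subtracted: this is the measure of the inductions on kernel matrices. *)
Lemma norm1B m n (u v : 'M[int]_(m, n)) :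
  conformal u v -> norm1 v = (norm1 u + norm1 (v - u))%N.
Proof.
move=> uv; rewrite /norm1 -big_split; apply: eq_bigr => i _ /=.
rewrite -big_split; apply: eq_bigr => j _ /=; rewrite !mxE.
by have := uv i j; rewrite /conformal1; move: (u i j) (v i j) => a b; lia.
Qed.

Lemma conformal0 m n (v : 'M[int]_(m, n)) : conformal 0 v.
Proof. by move=> i j; rewrite mxE /conformal1; lia. Qed.

Lemma conformal_sub m n (u a v : 'M[int]_(m, n)) :
  conformal u v -> conformal a (v - u) -> conformal a v.
Proof.
by move=> uv av i j; have := uv i j; have := av i j; rewrite !mxE /conformal1;
   move: (u i j) (v i j) (a i j) => ? ? ?; lia.
Qed.

Lemma conformal_subD m n (u a v : 'M[int]_(m, n)) :
  conformal u v -> conformal a (v - u) -> conformal (u + a) v.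
Proof.
by move=> uv av i j; have := uv i j; have := av i j; rewrite !mxE /conformal1;
   move: (u i j) (v i j) (a i j) => ? ? ?; lia.
Qed.

(** The order [conformal1] on integers is that of the pair (positive part, negative
    part), which turns a set of integer vectors into a set of vectors of
    naturals of twice the length. *)
Definition split_signs (t : nat) (v : 'cV[int]_t) (i : nat) : nat :=
  if (insub i./2 : option 'I_t) is Some j then
    if odd i then absz (Num.min (v j ord0) 0) else absz (Num.max (v j ord0) 0)
  else 0%N.

Lemma split_signs_conformal t (u v : 'cV[int]_t) :
  (forall i, (i < t.*2)%N -> (split_signs u i <= split_signs v i)%N) ->
  conformal u v.
Proof.
move=> le i j; rewrite (ord1 j) /conformal1.
have := le i.*2; have := le i.*2.+1; rewrite /split_signs /= !doubleK uphalf_double !odd_double /=.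
rewrite ltn_Sdouble ltn_double ltn_ord => /(_ isT) + /(_ isT).
rewrite valK; move: (u i 0) (v i 0) => a b; lia.
Qed.

(** Finiteness of the Graver basis of [A2]. *)
Lemma kernel_minimal (s t : nat) (A2 : 'M[int]_(s, t)) :
  exists (p : nat) (H : 'I_p -> 'cV[int]_t),
    (forall i, A2 *m H i = 0 /\ H i != 0) /\
    (forall v, A2 *m v = 0 -> v != 0 -> exists i, conformal (H i) v).
Proof.
have [Y [YP Ydom]] := dickson t.*2 (fun y =>
  exists v : 'cV[int]_t, [/\ A2 *m v = 0, v != 0 & y = split_signs v]).
have [L [LP Ldom]] : exists L : seq 'cV[int]_t,
    (forall v, v \in L -> A2 *m v = 0 /\ v != 0) /\
    (forall y, List.In y Y -> exists2 v, v \in L & y = split_signs v).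
  elim: (Y) YP => [|y Y' IH] YP; first by exists [::].
  have [v [A2v v0 yv]] := YP y (or_introl erefl).
  have [|L [LP Ldom]] := IH; first by move=> y' y'Y; apply: YP; right.
  exists (v :: L); split=> [u|y' /= [<-|/Ldom[u uL ->]]].
  - by rewrite inE => /predU1P[->|/LP].
  - by exists v => //; rewrite mem_head.
  - by exists u => //; rewrite inE uL orbT.
exists (size L), (tnth (in_tuple L)); split=> [i|v A2v v0].
  exact/LP/mem_tnth.
have [|y /Ldom[u uL ->] le] := Ydom (split_signs v); first by exists v.
have /tnthP[i uE] : u \in in_tuple L by [].
by exists i; rewrite -uE; apply: split_signs_conformal.
Qed.

End Conformal.

Section Moves.
Local Open Scope ring_scope.

(** Used to pass from a vector of multiplicities below that of a decomposition to a part of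
    the decomposition. *)
Lemma subseq_counts (p : nat) (T : eqType) (E : seq ('I_p * T)) (y : 'I_p -> nat) :
  (forall i, y i <= count (fun e => e.1 == i) E)%N ->
  exists2 E', subseq E' E & forall i, count (fun e => e.1 == i) E' = y i.
Proof.
elim: E y => [|[i0 q] E IH] y le /=.
  by exists [::] => // i /=; have := le i; rewrite /= leqn0 => /eqP.
have [y0|y_gt0] := posnP (y i0).
  have [i|E' sub cnt] := IH y.
    by have := le i => /=; case: eqVneq => [<-|//]; rewrite y0.
  by exists E' => //; apply: subseq_trans sub (subseq_cons _ _).
have [i|E' sub cnt] := IH (fun i => y i - (i0 == i))%N.
  by have := le i => /=; lia.
exists ((i0, q) :: E') => [|i]; first by rewrite eqxx.
by rewrite /= cnt; case: eqVneq => [<-|_]; lia.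
Qed.

Lemma sum_counts (p : nat) (T : eqType) (V : zmodType) (E : seq ('I_p * T))
    (F : 'I_p -> V) :
  \sum_(e <- E) F e.1 = \sum_i F i *+ count (fun e => e.1 == i) E.
Proof.
elim: E => [|e E IH]; first by rewrite big_nil big1.
rewrite big_cons IH /= [in RHS](eq_bigr _ (fun i _ => mulrnDr _ _ _)) big_split /=.
congr (_ + _); rewrite (bigD1 e.1) //= eqxx big1 ?addr0 // => i.
by rewrite eq_sym => /negPf->.
Qed.

Variables (r s t : nat) (A1 : 'M[int]_(r, t)) (A2 : 'M[int]_(s, t)).

(** Columns are bricks: the equations of the n-fold product say that every
    brick is in the kernel of A_2 and that A_1 kills the sum of the bricks. *)
Definition in_kernel (n : nat) (h : 'M[int]_(t, n)) : Prop :=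
  A2 *m h = 0 /\ A1 *m (h *m const_mx 1) = 0 :> 'cV_r.

Definition in_brick (n : nat) (v : 'cV[int]_t) (q : 'I_n) : 'M[int]_(t, n) :=
  v *m delta_mx 0 q.

Lemma in_brickE n v (q : 'I_n) j k : in_brick v q j k = v j 0 *+ (k == q).
Proof. by rewrite mxE big_ord1 mxE !eqxx /= mulr_natr. Qed.

Lemma in_kernelB n (h1 h2 : 'M[int]_(t, n)) :
  in_kernel h1 -> in_kernel h2 -> in_kernel (h1 - h2).
Proof.
by move=> [a b] [c d]; split; rewrite ?mulmxBl !mulmxBr ?a ?b ?c ?d subr0.
Qed.

Lemma in_kernelD n (h1 h2 : 'M[int]_(t, n)) :
  in_kernel h1 -> in_kernel h2 -> in_kernel (h1 + h2).
Proof.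
by move=> [a b] [c d]; split; rewrite ?mulmxDl !mulmxDr ?a ?b ?c ?d addr0.
Qed.

Lemma in_kernel0 n : in_kernel (0 : 'M[int]_(t, n)).
Proof. by split; rewrite ?mul0mx !mulmx0. Qed.

Lemma in_kernelMn n (h : 'M[int]_(t, n)) k : in_kernel h -> in_kernel (h *+ k).
Proof.
move=> hK; elim: k => [|k IH]; first exact: in_kernel0.
by rewrite mulrS; apply: in_kernelD.
Qed.

Lemma in_kernel_sum n I (l : seq I) (F : I -> 'M[int]_(t, n)) :
  (forall i, in_kernel (F i)) -> in_kernel (\sum_(i <- l) F i).
Proof.
by move=> FK; apply: big_ind => //; [exact: in_kernel0|exact: in_kernelD].
Qed.

Lemma brick_sum n (v : 'cV[int]_t) (q : 'I_n) : in_brick v q *m const_mx 1 = v.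
Proof.
apply/matrixP=> i j; rewrite mxE (bigD1 q) //= big1 => [|k kq].
  by rewrite in_brickE eqxx mxE mulr1 addr0 (ord1 j).
by rewrite in_brickE (negPf kq) mul0r.
Qed.

Section Elements.
Variables (p : nat) (H : 'I_p -> 'cV[int]_t).
Hypothesis HK : forall i, A2 *m H i = 0 /\ H i != 0.
Hypothesis Hmin : forall v, A2 *m v = 0 -> v != 0 -> exists i, conformal (H i) v.

(** The bricks are decomposed one term at a time, and since the terms conform to what
    remains, the partial sums conform to [h]. *)
Lemma brick_decomposition n (h : 'M[int]_(t, n)) : A2 *m h = 0 ->
  exists2 E : seq ('I_p * 'I_n), h = \sum_(e <- E) in_brick (H e.1) e.2 &
    forall E', subseq E' E -> conformal (\sum_(e <- E') in_brick (H e.1) e.2) h.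
Proof.
have [m] := ubnP (norm1 h); elim: m h => // m IH h; rewrite ltnS => hm A2h.
have [->|h0] := eqVneq h 0.
  exists [::] => [|E']; first by rewrite big_nil.
  by rewrite subseq0 => /eqP->; rewrite big_nil; exact: conformal0.
have [q hq0] : exists q, col q h != 0.
  apply/existsP; apply: contraNT h0; rewrite negb_exists => /forallP all0.
  by apply/eqP/matrixP=> i j; have /eqP/colP/(_ i) := negbNE (all0 j); rewrite !mxE.
have [|//|i Hi] := Hmin (v := col q h); first by rewrite colE mulmxA A2h mul0mx.
pose u := in_brick (H i) q.
have uh : conformal u h.
  move=> j k; rewrite in_brickE; case: eqVneq => [->|_].
    by have := Hi j 0; rewrite mxE mulr1n.
  by rewrite mulr0n /conformal1; lia.
have u0 : (0 < norm1 u)%N.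
  apply: norm1_gt0; apply: contraNneq (HK i).2 => uz.
  by rewrite -(brick_sum (H i) q) -/u uz mul0mx.
have [||E hE Econf] := IH (h - u).
- by have := norm1B uh; lia.
- by rewrite mulmxBr A2h mulmxA (HK i).1 mul0mx subr0.
exists ((i, q) :: E) => [|E']; first by rewrite big_cons -hE addrC subrK.
case: E' => [|e E'] /=; first by rewrite big_nil => _; exact: conformal0.
case: eqVneq => [->|_] /Econf; last exact: conformal_sub.
by rewrite big_cons; exact: conformal_subD.
Qed.

End Elements.

Definition move (n C : nat) (pat : 'I_C -> 'cV[int]_t) (b : 'I_C -> 'I_n) :=
  \sum_k in_brick (pat k) (b k).

(** The bound [C] does not depend on [n] because the second block is treated by itself, brick
    by brick, and the sum over the bricks only sees how often each minimal vector occurs. A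
    pattern is padded with zero columns to have exactly [C] of them. *)
Lemma small_kernel_element :
  exists (C : nat) (T : finType) (pat : T -> 'I_C -> 'cV[int]_t),
    (forall tau n (b : 'I_C -> 'I_n), in_kernel (move (pat tau) b)) /\
    (forall n (h : 'M[int]_(t, n)), in_kernel h -> h != 0 ->
       exists tau (b : {ffun 'I_C -> 'I_n}),
         move (pat tau) b != 0 /\ conformal (move (pat tau) b) h).
Proof.
have [p [H [HK Hmin]]] := kernel_minimal A2.
have [Y [YP Ydom]] := dickson p (fun y =>
  (exists i : 'I_p, (0 < y i)%N) /\ \sum_(i < p) (A1 *m H i) *+ y i = 0).
pose C := \max_(y <- Y) \sum_(i < p) y i.
have YC y : List.In y Y -> (\sum_(i < p) y i <= C)%N.
  rewrite /C; elim: (Y) => //= a Y' IH [->|/IH]; rewrite big_cons ?leq_maxl //.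
  by move/leq_trans; apply; rewrite leq_maxr.
pose oH (o : option 'I_p) := if o is Some i then H i else 0.
pose T := {f : {ffun 'I_C -> option 'I_p} | \sum_k A1 *m oH (f k) == 0}.
have A2oH o : A2 *m oH o = 0 by case: o => [i|] /=; rewrite ?mulmx0 //; case: (HK i).
exists C, T, (fun (f : T) k => oH (sval f k)); split=> [f n b|n h [A2h A1h] h0].
  split; rewrite /move.
    by rewrite mulmx_sumr big1 // => k _; rewrite /in_brick mulmxA A2oH mul0mx.
  rewrite mulmx_suml mulmx_sumr.
  under eq_bigr do rewrite brick_sum.
  exact/eqP/(valP f).
have [E hE Econf] := brick_decomposition HK Hmin A2h.
pose cnt (E : seq ('I_p * 'I_n)) i := count (fun e => e.1 == i) E.
pose y (i : nat) := if insub i is Some i' then cnt E i' else 0%N.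
have yE (i : 'I_p) : y i = cnt E i by rewrite /y valK.
have [|y' y'Y y'le] := Ydom y.
  split.
    case: E hE @cnt @y yE {Econf} => [|e E] hE cnt y yE.
      by rewrite hE big_nil eqxx in h0.
    by exists e.1; rewrite yE /cnt /= eqxx.
  rewrite -[RHS]A1h hE mulmx_suml mulmx_sumr.
  under [in RHS]eq_bigr do rewrite brick_sum.
  rewrite (sum_counts E (fun i => A1 *m H i)).
  by apply: eq_bigr => i _; rewrite yE.
have [i0|E' sub cntE'] := @subseq_counts _ _ E (fun i : 'I_p => y' i).
  by rewrite -[count _ _]/(cnt E i0) -yE; exact: y'le.
have [[i1 y'i1] y'0] := YP _ y'Y.
have E'C : (size E' <= C)%N.
  apply: leq_trans (YC _ y'Y); rewrite -(ler_nat int) -sum1_size !natr_sum.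
  rewrite (@sum_counts p _ int E' (fun=> 1)) ler_sum // => i _.
  by rewrite cntE'.
case: E' sub cntE' E'C => [|e0 E'] sub cntE' E'C.
  by move: y'i1; rewrite -cntE'.
set E1 := e0 :: E' in sub cntE' E'C.
pose f := [ffun k : 'I_C => if (k < size E1)%N then Some (nth e0 E1 k).1 else None].
have padE (U : zmodType) (F : option 'I_p -> 'I_n -> U) :
    (forall q, F None q = 0) ->
  \sum_(k < C) F (f k) (nth e0 E1 k).2 = \sum_(e <- E1) F (Some e.1) e.2.
  move=> F0; rewrite (big_nth e0) big_mkord (big_ord_widen _ (fun k =>
    F (Some (nth e0 E1 k).1) (nth e0 E1 k).2) E'C).
  rewrite [in RHS]big_mkcond /=.
  by apply: eq_bigr => k _; rewrite ffunE; case: ifP.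
have fT : \sum_k A1 *m oH (f k) == 0.
  rewrite (padE _ (fun o _ => A1 *m oH o)); last by rewrite mulmx0.
  rewrite (sum_counts E1 (fun i => A1 *m H i)) -[X in _ == X]y'0.
  by apply/eqP/eq_bigr => i _; rewrite cntE'.
exists (exist _ f fT : T), [ffun k : 'I_C => (nth e0 E1 k).2].
have -> : move (fun k => oH (sval (exist _ f fT : T) k)) [ffun k : 'I_C => (nth e0 E1 k).2]
    = \sum_(e <- E1) in_brick (H e.1) e.2.
  rewrite /move -(padE _ (fun o q => in_brick (oH o) q)).
    by apply: eq_bigr => k _; rewrite [X in in_brick _ X]ffunE.
  by move=> q; rewrite /in_brick mul0mx.
split; last exact: Econf.
(* conformal terms cannot cancel *)
have sub0 : subseq [:: e0] E1 by rewrite sub1seq mem_head.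
have c1 := Econf _ (subseq_trans sub0 sub).
have c2 := Econf _ (subseq_trans (subseq_cons E' e0) sub).
apply: contraNneq (HK e0.1).2 => sum0.
rewrite -(brick_sum (H e0.1) e0.2).
suff -> : in_brick (H e0.1) e0.2 = 0 by rewrite mul0mx.
apply/matrixP=> j q; rewrite [RHS]mxE.
have := c1 j q; rewrite big_seq1; have := c2 j q.
have /matrixP/(_ j q) := sum0; rewrite big_cons mxE [X in _ = X]mxE /conformal1.
move: (in_brick _ _ j q) (h j q) ((\sum_(_ <- E') _ : 'M[int]_(t, n)) j q) => a b c; lia.
Qed.

End Moves.

(** * Optimality and proximity *)

Section Optimization.
Local Open Scope ring_scope.

Lemma mulrn_intE (x : int) k : x *+ k = x * k%:Z.
Proof. by rewrite -mulr_natr natz. Qed.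

Definition dot (m n : nat) (c x : 'M[int]_(m, n)) : int :=
  \sum_j \sum_q c j q * x j q.

Lemma dot0 m n (c : 'M[int]_(m, n)) : dot c 0 = 0.
Proof. by rewrite /dot big1 // => j _; rewrite big1 // => q _; rewrite mxE mulr0. Qed.

Lemma dotD m n (c x y : 'M[int]_(m, n)) : dot c (x + y) = dot c x + dot c y.
Proof.
rewrite /dot -big_split; apply: eq_bigr => j _ /=; rewrite -big_split.
by apply: eq_bigr => q _ /=; rewrite mxE mulrDr.
Qed.

Lemma dotN m n (c x : 'M[int]_(m, n)) : dot c (- x) = - dot c x.
Proof. by apply/eqP; rewrite -addr_eq0 -dotD addNr dot0. Qed.

Lemma dotMn m n (c x : 'M[int]_(m, n)) k : dot c (x *+ k) = dot c x *+ k.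
Proof. by elim: k => [|k IH]; rewrite ?dot0 // !mulrS dotD IH. Qed.

Lemma dot_sum m n (c : 'M[int]_(m, n)) I (s : seq I) (F : I -> 'M[int]_(m, n)) :
  dot c (\sum_(i <- s) F i) = \sum_(i <- s) dot c (F i).
Proof. by elim: s => [|i s IH]; rewrite ?big_nil ?dot0 // !big_cons dotD IH. Qed.

Lemma mulrn_mxE m n (x : 'M[int]_(m, n)) k j q : (x *+ k) j q = x j q *+ k.
Proof. by elim: k => [|k IH]; rewrite ?mxE // !mulrS mxE IH. Qed.

Lemma conformalMn_le m n (u v : 'M[int]_(m, n)) k j q :
  conformal (u *+ k) v -> u j q != 0 -> (k%:Z <= `|v j q|).
Proof.
move=> /(_ j q); rewrite mulrn_mxE /conformal1 mulrn_intE.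
move: (u j q) (v j q) => a b; nia.
Qed.

Definition in_box (m n : nat) (lo hi x : 'M[int]_(m, n)) : bool :=
  [forall j, forall q, lo j q <= x j q <= hi j q].

Lemma in_boxP m n (lo hi x : 'M[int]_(m, n)) :
  reflect (forall j q, lo j q <= x j q <= hi j q) (in_box lo hi x).
Proof.
apply: (iffP forallP) => [b j q|b j]; first by have /forallP := b j.
by apply/forallP.
Qed.

Lemma in_box_conformal m n (lo hi x y u : 'M[int]_(m, n)) :
  in_box lo hi x -> in_box lo hi y -> conformal u (y - x) -> in_box lo hi (x + u).
Proof.
move=> /in_boxP bx /in_boxP byy c; apply/in_boxP=> j q.
have := bx j q; have := byy j q; have := c j q; rewrite !mxE /conformal1.
by move: (lo j q) (x j q) (y j q) (u j q) (hi j q) => a b d e f; lia.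
Qed.

Variables (r s t : nat) (A1 : 'M[int]_(r, t)) (A2 : 'M[int]_(s, t)).
Variables (C : nat) (T : finType) (pat : T -> 'I_C -> 'cV[int]_t).
Hypothesis patK : forall tau n (b : 'I_C -> 'I_n), in_kernel A1 A2 (move (pat tau) b).
Hypothesis pat_small : forall n (h : 'M[int]_(t, n)), in_kernel A1 A2 h -> h != 0 ->
  exists tau (b : {ffun 'I_C -> 'I_n}),
    move (pat tau) b != 0 /\ conformal (move (pat tau) b) h.

Section FixedN.
Variable n : nat.

Let I := (T * {ffun 'I_C -> 'I_n})%type.
Definition mv (i : I) : 'M[int]_(t, n) := move (pat i.1) i.2.

(** By induction on the norm. That all the partial sums conform to [h] is what keeps partial
    steps from [x] towards [x + h] inside any box that contains both. *)
Lemma decomposition (h : 'M[int]_(t, n)) : in_kernel A1 A2 h ->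
  exists2 lam : I -> nat, h = \sum_i mv i *+ lam i &
    forall mu : I -> nat, (forall i, mu i <= lam i)%N ->
      conformal (\sum_i mv i *+ mu i) h.
Proof.
have [m] := ubnP (norm1 h); elim: m h => // m IH h; rewrite ltnS => hm hK.
have [->|h0] := eqVneq h 0.
  exists (fun=> 0%N) => [|mu mu0]; first by rewrite big1.
  rewrite big1; first exact: conformal0.
  by move=> i _; have := mu0 i; rewrite leqn0 => /eqP->.
have [tau [b [u0 uh]]] := pat_small hK h0.
set u := move _ _ in u0 uh.
have [||lam hE lamP] := IH (h - u).
- by have := norm1B uh; have := norm1_gt0 u0; lia.
- by apply: in_kernelB => //; exact: patK.
pose i0 : I := (tau, b).
have mvE (mu : I -> nat) :
    \sum_i mv i *+ (mu i + (i == i0)) = u + \sum_i mv i *+ mu i.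
  under eq_bigr do rewrite mulrnDr.
  rewrite big_split addrC; congr (_ + _); rewrite (bigD1 i0) //= eqxx big1 ?addr0 // => i /negPf->.
  by [].
exists (fun i => lam i + (i == i0))%N => [|mu mule].
  by rewrite mvE -hE addrC subrK.
have [mu0|mu_gt0] := posnP (mu i0).
  apply: conformal_sub uh (lamP mu _) => i; have := mule i.
  by case: eqVneq => [->|_]; rewrite ?mu0 ?addn0.
have -> : \sum_i mv i *+ mu i = u + \sum_i mv i *+ (mu i - (i == i0)).
  rewrite -mvE; apply: eq_bigr => i _; congr (_ *+ _).
  by case: eqVneq => [->|_] /=; lia.
by apply: conformal_subD uh (lamP _ _) => i; rewrite leq_subLR addnC; exact: mule.
Qed.

Lemma decomposition1 (lam : I -> nat) i0 k : (k <= lam i0)%N ->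
  exists2 mu : I -> nat, (forall i, mu i <= lam i)%N &
    \sum_i mv i *+ mu i = mv i0 *+ k.
Proof.
move=> le; exists (fun i => if i == i0 then k else 0%N) => [i|].
  by case: eqVneq => // ->.
by rewrite (bigD1 i0) //= eqxx big1 ?addr0 // => i /negPf->.
Qed.

(** In the decomposition of [y - x], a term with multiplicity [k] has a power of 2 in
    [(k / 2, k]], and the step by this power stays in the box. As it gains less than [d], the
    whole term gains less than [2 d]; for [d = 1], it gains nothing. *)
Lemma optimality_gap (lo hi c x y : 'M[int]_(t, n)) (L d : int) :
  in_kernel A1 A2 (y - x) -> in_box lo hi x -> in_box lo hi y ->
  (forall j q, hi j q - lo j q <= L) -> 0 < d ->
  (forall i k, (2 ^ k)%:Z <= L -> in_box lo hi (x + mv i *+ 2 ^ k) ->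
     - dot c (mv i *+ 2 ^ k) < d) ->
  dot c x - dot c y <= (2 * #|{: I}|)%:Z * d /\ (d = 1 -> dot c x <= dot c y).
Proof.
move=> yxK bx byy hL d0 stuck.
have [lam hE lamP] := decomposition yxK.
have xy : dot c x - dot c y = \sum_i - (dot c (mv i) *+ lam i).
  rewrite -opprB -dotN -dotD hE dot_sum sumrN; congr (- _).
  by apply: eq_bigr => i _; rewrite dotMn.
have term i : - (dot c (mv i) *+ lam i) <= d *+ 2 /\ (d = 1 -> - (dot c (mv i) *+ lam i) <= 0).
  have [le0|gt0] := lerP 0 (dot c (mv i)).
    have : 0 <= dot c (mv i) *+ lam i by rewrite mulrn_wge0.
    by move: (dot _ _ *+ _) => a; split; lia.
  have [->|lam_gt0] := posnP (lam i); first by split; lia.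
  have confk k : (k <= lam i)%N -> conformal (mv i *+ k) (y - x).
    by case/decomposition1 => mu mule <-; exact: lamP.
  have [j [q mvjq]] : exists j q, mv i j q != 0.
    apply: contrapT => no; move: gt0; suff -> : mv i = 0 by rewrite dot0.
    apply/matrixP=> j q; rewrite [RHS]mxE; apply/eqP; apply/negPn/negP => nz.
    by apply: no; exists j, q.
  have lamL : (lam i)%:Z <= L.
    have := conformalMn_le (confk _ (leqnn _)) mvjq.
    move/in_boxP/(_ j q): bx; move/in_boxP/(_ j q): byy; have := hL j q; rewrite !mxE.
    by move: (lo j q) (hi j q) (x j q) (y j q) => ? ? ? ?; lia.
  have /andP[le1 lt2] := trunc_log_bounds (isT : (1 < 2)%N) lam_gt0.
  set k := trunc_log 2 (lam i) in le1 lt2.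
  have := stuck i k _ (in_box_conformal bx byy (confk _ le1)).
  rewrite dotMn; rewrite expnS in lt2.
  move: (2 ^ k)%N le1 lt2 gt0 => e le1 lt2 gt0 /(_ _)/wrap[|gain]; first by lia.
  move: (dot c (mv i)) gt0 gain => g gt0 gain; rewrite mulrn_intE in gain.
  by split=> [|d1]; nia.
rewrite xy; split=> [|d1].
  apply: le_trans (ler_sum _ (fun i _ => (term i).1)) _.
  rewrite sumr_const !mulrn_intE PoszM.
  by move: (Posz #|_|) => N; lia.
rewrite -subr_le0 xy; apply: sumr_le0 => i _; exact: (term i).2.
Qed.

(** The directions along which the bounds [l], [u] allow unlimited steps while the entries
    of [sl], the slacks, do not change. *)
Definition recession (sl : pred 'I_t) (l u : 'I_t -> 'I_n -> \bar int)
    (g : 'M[int]_(t, n)) : Prop :=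
  forall j q, if sl j then g j q = 0 else
    (0 < g j q -> u j q = +oo%E) /\ (g j q < 0 -> l j q = -oo%E).

(** The point [y'] is obtained from [z0] by the terms of the decomposition of [y - z0] that
    improve the objective or change a slack. Dropping the other terms does not increase the objective. A term that
    is kept changes a slack or is not a direction of recession, so some entry where [z0] is
    close to a bound limits its multiplicity by [M]. *)
Lemma proximity (sl : pred 'I_t) (l u : 'I_t -> 'I_n -> \bar int)
    (w z0 y : 'M[int]_(t, n)) (M D : int) :
  0 <= M -> (forall i j q, `|mv i j q| <= D) ->
  (forall j q, if sl j then is_true (`|z0 j q| <= M) else
     [/\ (l j q <= (z0 j q)%:E <= u j q)%E,
         forall a, u j q = a%:E -> a - z0 j q <= M &
         forall a, l j q = a%:E -> z0 j q - a <= M]) ->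
  (forall i, recession sl l u (mv i) -> 0 <= dot w (mv i)) ->
  in_kernel A1 A2 (y - z0) ->
  (forall j q, if sl j then y j q = 0 else is_true (l j q <= (y j q)%:E <= u j q)%E) ->
  exists y', [/\ in_kernel A1 A2 (y' - z0), dot w y' <= dot w y,
    forall j q, if sl j then y' j q = 0 else is_true (l j q <= (y' j q)%:E <= u j q)%E &
    forall j q, `|y' j q - z0 j q| <= #|{: I}|%:Z * M * D].
Proof.
move=> M0 mvD z0P norec yK yP.
have [lam hE lamP] := decomposition yK.
have confk i k : (k <= lam i)%N -> conformal (mv i *+ k) (y - z0).
  by case/decomposition1 => mu mule <-; exact: lamP.
pose keep i := [exists j, [exists q, sl j && (mv i j q != 0)]] || (dot w (mv i) < 0).
pose mu i := if keep i then lam i else 0%N.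
have mule i : (mu i <= lam i)%N by rewrite /mu; case: ifP.
pose g := \sum_i mv i *+ mu i.
have gc : conformal g (y - z0) by apply: lamP.
have gK : in_kernel A1 A2 g.
  by apply: in_kernel_sum => i; apply/in_kernelMn/patK.
have dropE : y - z0 = g + \sum_i mv i *+ (lam i - mu i).
  rewrite hE -big_split; apply: eq_bigr => i _ /=.
  by rewrite -mulrnDr subnKC.
exists (z0 + g); split.
- by rewrite addrC addKr.
- have -> : y = z0 + g + \sum_i mv i *+ (lam i - mu i).
    by rewrite -addrA -dropE addrC subrK.
  rewrite [leRHS]dotD lerDl dot_sum sumr_ge0 // => i _.
  rewrite dotMn /mu; case: ifP => [_|/negbT]; first by rewrite subnn.
  by rewrite negb_or -leNgt => /andP[_ ?]; rewrite mulrn_wge0.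
- move=> j q; have := yP j q; have := z0P j q; have := gc j q.
  case: ifPn => slj.
    move=> _ _ yj; rewrite mxE; have /matrixP/(_ j q) := dropE; rewrite mxE [RHS]mxE.
    rewrite [X in _ = _ + X]summxE [X in _ = _ + X]big1 ?addr0 => [|i _].
      by rewrite yj !mxE => <-; rewrite sub0r subrr.
    rewrite mulrn_mxE; case: (eqVneq (mv i j q) 0) => [->|nz].
      by rewrite mul0rn.
    suff ki : keep i by rewrite /mu ki subnn.
    by apply/orP; left; apply/existsP; exists j; apply/existsP; exists q; rewrite slj.
  rewrite !mxE => c [/andP[zl zu] _ _] /andP[yl yu]; move: c.
  case: (l j q) zl yl => [a||] //=; case: (u j q) zu yu => [b||] //=;
    rewrite ?lee_fin ?leey ?leNye ?andbT /=; rewrite /conformal1;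
    move: (z0 j q) (y j q) (g j q) => ? ? ?; lia.
- move=> j q; rewrite [(z0 + g) j q]mxE [z0 j q + _]addrC addrK summxE.
  apply: le_trans (ler_norm_sum _ _ _) _.
  suff term i : `|(mv i *+ mu i) j q| <= M * D.
    apply: le_trans (ler_sum _ (fun i _ => term i)) _.
    by rewrite sumr_const mulrn_intE mulrC mulrA.
  have D0 : 0 <= D by apply: le_trans (mvD i j q); rewrite normr_ge0.
  rewrite mulrn_mxE mulrn_intE normrM [`|_%:Z|]ger0_norm // mulrC.
  apply: ler_pM => //; rewrite /mu; case: ifP => [|_]; last by lia.
  have [-> _|lam_gt0] := posnP (lam i); first by lia.
  case/orP => [/existsP[j1 /existsP[q1 /andP[slj nz]]]|lt0].
    have := conformalMn_le (confk _ _ (leqnn _)) nz.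
    have := yP j1 q1; have := z0P j1 q1; rewrite slj !mxE.
    by move: (z0 j1 q1) (y j1 q1) => ? ?; lia.
  have /existsNP[j1 /existsNP[q1]] : ~ recession sl l u (mv i).
    by move=> /norec; rewrite leNgt lt0.
  have := z0P j1 q1; have := yP j1 q1; have := confk i _ (leqnn _) j1 q1.
  rewrite mulrn_mxE mulrn_intE.
  have := @conformalMn_le _ _ (mv i) (y - z0) (lam i) j1 q1 (confk i _ (leqnn _)).
  rewrite !mxE.
  case: ifPn => slj.
    move=> H c y0 z0M mv0; have /H : mv i j1 q1 != 0 by apply/eqP.
    by rewrite y0; move: (z0 j1 q1) z0M => a; lia.
  move=> H c /andP[yl yu] [_ hiM loM] notrec.
  have [gt0|le0] := ltrP 0 (mv i j1 q1).
    have uf : u j1 q1 <> +oo%E.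
      move=> uoo; apply: notrec; split=> // lt; have := lt_trans gt0 lt.
      by rewrite ltxx.
    case: (u j1 q1) hiM yu uf => [b /(_ b erefl) hiM| |] //=.
    rewrite lee_fin => yu _; move: (mv i j1 q1) (y j1 q1) (z0 j1 q1) gt0 c hiM yu.
    by move=> ? ? ?; rewrite /conformal1; nia.
  have [lt0'|ge0] := ltrP (mv i j1 q1) 0; last first.
    by case: notrec; split => lt; [have := lt_le_trans lt le0|have := le_lt_trans ge0 lt];
      rewrite ltxx.
  have lf : l j1 q1 <> -oo%E.
    by move=> loo; apply: notrec; split=> // gt; have := lt_le_trans gt le0; rewrite ltxx.
  case: (l j1 q1) loM yl lf => [b /(_ b erefl) loM| |] //=.
  rewrite lee_fin => yl _; move: (mv i j1 q1) (y j1 q1) (z0 j1 q1) lt0' c loM yl.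
  by move=> ? ? ?; rewrite /conformal1; nia.
Qed.
End FixedN.
End Optimization.

(** * Bit length and cost of programs *)

Section Bits.
Local Open Scope ring_scope.

Lemma bits_gt0 x : (0 < bits x)%N. Proof. by []. Qed.

Lemma bits_mono x y : (`|x| <= `|y|)%N -> (bits x <= bits y)%N.
Proof. by move=> le; rewrite /bits leq_add2l leq_up_log. Qed.

Lemma up_logM_le a b : (0 < a)%N -> (0 < b)%N ->
  (up_log 2 (a * b) <= up_log 2 a + up_log 2 b)%N.
Proof.
by move=> a0 b0; apply: up_log_min => //; rewrite expnD leq_mul // up_logP.
Qed.

(** Common to sums, differences and products: [1 + |z|] is at most the product of [1 + |x|]
    and [1 + |y|]. *)
Lemma bits_bilinear x y z : (`|z|.+1 <= `|x|.+1 * `|y|.+1)%N ->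
  (bits z <= bits x + bits y)%N.
Proof.
move=> le; rewrite /bits; have := leq_up_log 2 le.
have := @up_logM_le `|x|.+1 `|y|.+1 isT isT; lia.
Qed.

Lemma bitsD x y : (bits (x + y) <= bits x + bits y)%N.
Proof. by apply: bits_bilinear; nia. Qed.

Lemma bitsB x y : (bits (x - y) <= bits x + bits y)%N.
Proof. by apply: bits_bilinear; nia. Qed.

Lemma bitsM x y : (bits (x * y) <= bits x + bits y)%N.
Proof. by apply: bits_bilinear; rewrite abszM; nia. Qed.

Lemma bits_divz x y : (bits (x %/ y)%Z <= bits x)%N.
Proof.
apply: bits_mono; have [->|y0] := eqVneq y 0; first by rewrite divz0.
have e := divz_eq x y; have r0 := modz_ge0 x y0; have r1 := ltz_mod x y0.
move: (x %/ y)%Z (x %% y)%Z e r0 r1 => q r e r0 r1.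
have [y1|y1] : 1 <= y \/ y <= -1 by lia.
  have {}r1 : r < y by lia.
  have [q0|q0] : 0 <= q \/ q <= -1 by lia.
    have : q <= q * y by nia.
    lia.
  have : (q + 1) * y <= q + 1 by nia.
  by rewrite mulrDl; lia.
have {}r1 : r < - y by lia.
have [q0|q0] : 1 <= q \/ q <= 0 by lia.
  have : (q - 1) * y <= 1 - q by nia.
  by rewrite mulrBl; lia.
have : - q <= q * y by nia.
lia.
Qed.

Lemma bits_exp x k : (bits (x ^+ k) <= k * bits x + 2)%N.
Proof.
elim: k => [|k IH]; first by rewrite expr0.
by rewrite exprS; have := bitsM x (x ^+ k); lia.
Qed.

End Bits.

Section Cost.

Definition bounded (B : nat) (m : memory) : Prop := forall p, bits (m p) <= B.

(** In a memory whose numbers have at most [B] bits, the value of [e] has at most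
    [expr_size e * B] bits and its evaluation costs at most [expr_cost e * B]. *)
Fixpoint expr_size (e : expr) : nat :=
  match e with
  | Const z => bits z
  | Read _ => 1
  | Binop _ e1 e2 => expr_size e1 + expr_size e2
  end.

Fixpoint expr_cost (e : expr) : nat :=
  match e with
  | Const z => bits z
  | Read a => expr_cost a + expr_size a + 1
  | Binop _ e1 e2 => expr_cost e1 + expr_cost e2 + expr_size e1 + expr_size e2
  end.

Variable B : nat.

Lemma bounded_gt0 m : bounded B m -> 0 < B.
Proof. by move=> /(_ 0%R); apply: leq_trans. Qed.

Lemma bits_eval m e : bounded B m -> bits (eval m e) <= expr_size e * B.
Proof.
move=> bm; have B0 := bounded_gt0 bm.
elim: e => [z|a _|o e1 IH1 e2 IH2] /=; first by rewrite leq_pmulr.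
  by rewrite mul1n.
rewrite mulnDl; have := leq_add IH1 IH2; apply: leq_trans.
case: o => /=; first exact: bitsD.
- exact: bitsB.
- exact: bitsM.
- exact: leq_trans (bits_divz _ _) (leq_addr _ _).
Qed.

Lemma eval_cost_le m e : bounded B m -> eval_cost m e <= expr_cost e * B.
Proof.
move=> bm; have B0 := bounded_gt0 bm.
elim: e => [z|a IH|o e1 IH1 e2 IH2] /=; first by rewrite leq_pmulr.
  by rewrite !mulnDl mul1n !leq_add // bits_eval.
by rewrite !mulnDl !leq_add // bits_eval.
Qed.

Definition guard_cost (e : expr) : nat := expr_cost e + expr_size e.

Lemma test_cost_le m e : bounded B m -> test_cost m e <= guard_cost e * B.
Proof.
by move=> bm; rewrite mulnDl leq_add ?eval_cost_le ?bits_eval.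
Qed.

End Cost.

Section StraightLine.

Fixpoint writes (l : seq (expr * expr)) : program :=
  if l is (a, e) :: l' then Defs.Seq (Write a e) (writes l') else Skip.

Definition write1 (m : memory) (ae : expr * expr) : memory :=
  update m (eval m ae.1) (eval m ae.2).

Definition run (l : seq (expr * expr)) (m : memory) : memory := foldl write1 m l.

Lemma run_cat l1 l2 m : run (l1 ++ l2) m = run l2 (run l1 m).
Proof. exact: foldl_cat. Qed.

(** A write can multiply the size of the numbers in memory by a constant,
    which is harmless as long as the number of writes is constant. *)
Fixpoint writes_cost (l : seq (expr * expr)) : nat :=
  if l is (a, e) :: l' then
    guard_cost a + guard_cost e + (expr_size e).+1 * writes_cost l'
  else 1.

Lemma exec_writes B l m : bounded B m ->
  exists2 k, exec (writes l) m (run l m) k & k <= writes_cost l * B.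
Proof.
elim: l B m => [|[a e] l IH] B m bm /=.
  by exists 1; [constructor|rewrite mul1n (bounded_gt0 bm)].
have bm' : bounded ((expr_size e).+1 * B) (write1 m (a, e)).
  move=> p; rewrite /write1 /update; case: ifP => _ /=.
    by apply: leq_trans (bits_eval _ bm) _; rewrite mulSn leq_addl.
  by apply: leq_trans (bm p) _; rewrite mulSn leq_addr.
have [k ex kle] := IH _ _ bm'.
eexists; first by econstructor; [constructor|exact: ex].
have ea := eval_cost_le a bm; have ee := eval_cost_le e bm.
have ba := bits_eval a bm; have be := bits_eval e bm.
rewrite mulnDl; apply: leq_add; last by rewrite [X in (_ <= X * _)%N]mulnC -mulnA.
rewrite /guard_cost !mulnDl; lia.
Qed.

End StraightLine.

Section Hoare.
Local Open Scope ring_scope.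

(** Total correctness within time [k]. *)
Definition hoare (P : memory -> Prop) (p : program) (k : nat) (Q : memory -> Prop) :=
  forall m, P m -> exists m' k', [/\ exec p m m' k', (k' <= k)%N & Q m'].

Lemma hoare_seq P Q R p1 p2 k1 k2 :
  hoare P p1 k1 Q -> hoare Q p2 k2 R -> hoare P (Defs.Seq p1 p2) (k1 + k2) R.
Proof.
move=> h1 h2 m /h1[m1 [k1' [e1 l1 /h2[m2 [k2' [e2 l2 Rm]]]]]].
by exists m2, (k1' + k2')%N; split; [econstructor; eauto|exact: leq_add|].
Qed.

Lemma hoare_writes B (P Q : memory -> Prop) l :
  (forall m, P m -> bounded B m /\ Q (run l m)) ->
  hoare P (writes l) (writes_cost l * B) Q.
Proof.
move=> h m /h[bm Qm]; have [k ex kle] := exec_writes l bm.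
by exists (run l m), k.
Qed.

Lemma hoare_weaken (P P' Q Q' : memory -> Prop) p k k' :
  (forall m, P m -> P' m) -> (forall m, Q' m -> Q m) -> (k' <= k)%N ->
  hoare P' p k' Q' -> hoare P p k Q.
Proof.
move=> PP QQ kk h m /PP/h[m' [k'' [ex le /QQ Qm]]].
by exists m', k''; split=> //; apply: leq_trans kk.
Qed.

Lemma hoare_if B (P Q : memory -> Prop) e p1 p2 k :
  (forall m, P m -> bounded B m) ->
  hoare (fun m => P m /\ 0 < eval m e) p1 k Q ->
  hoare (fun m => P m /\ eval m e <= 0) p2 k Q ->
  hoare P (If e p1 p2) (guard_cost e * B + k) Q.
Proof.
move=> bP h1 h2 m Pm; have le := test_cost_le e (bP m Pm).
have [ge0|gt0] := lerP (eval m e) 0.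
  have [m' [k' [ex kk Qm]]] := h2 m (conj Pm ge0).
  by exists m', (test_cost m e + k')%N; split=> //; [apply: ExecIfFalse|exact: leq_add].
have [m' [k' [ex kk Qm]]] := h1 m (conj Pm gt0).
by exists m', (test_cost m e + k')%N; split=> //; [apply: ExecIfTrue|exact: leq_add].
Qed.

Definition loop_cost (B N : nat) (e : expr) (k : nat) : nat :=
  (N * (guard_cost e * B + k) + guard_cost e * B)%N.

(** [N] is the exact number of iterations, and [J i] the invariant after [i]
    of them. *)
Lemma hoare_while B N (J : nat -> memory -> Prop) e p k :
  (forall i m, J i m -> bounded B m) ->
  (forall i m, (i <= N)%N -> J i m -> (0 < eval m e) = (i < N)%N) ->
  (forall i, (i < N)%N -> hoare (J i) p k (J i.+1)) ->
  hoare (J 0%N) (While e p) (loop_cost B N e k) (J N).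
Proof.
move=> bJ guard body.
suff main j i : (i + j = N)%N -> hoare (J i) (While e p) (loop_cost B j e k) (J N).
  by apply: main; rewrite add0n.
elim: j i => [|j IH] i ij m Jm; have le := test_cost_le e (bJ i m Jm).
  rewrite addn0 in ij; subst i; exists m, (test_cost m e); split=> //.
    by apply: ExecWhileFalse; rewrite leNgt (guard N m) ?ltnn.
have iN : (i < N)%N by rewrite -ij addnS ltnS leq_addr.
have [m1 [k1 [ex1 le1 Jm1]]] := body i iN m Jm.
have [|m2 [k2 [ex2 le2 Jm2]]] := IH i.+1 _ m1 Jm1; first by rewrite addSnnS.
exists m2, (test_cost m e + k1 + k2)%N; split=> //.
  by apply: ExecWhileTrue ex1 ex2; rewrite (guard i m) // ltnW.
by apply: leq_trans (leq_add (leq_add le le1) le2) _; rewrite /loop_cost mulSn -!addnA.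
Qed.

End Hoare.

Section Layout.
Local Open Scope ring_scope.

(** The working arrays are interleaved in the cells of negative address, the
    entry [q] of the array number [a < K] being the cell [- 1 - (a + K q)]. *)
Variable K : nat.

Definition loc (a q : nat) : int := Negz (a + K * q).

Definition eloc (a : nat) (e : expr) : expr :=
  Binop Defs.Sub (Const (Negz a)) (Binop Mul (Const K%:Z) e).

Lemma eval_eloc m a e (q : nat) : eval m e = q%:Z -> eval m (eloc a e) = loc a q.
Proof. by move=> /= ->; rewrite /loc !NegzE; lia. Qed.

Lemma loc_eq a q a' q' : (a < K)%N -> (a' < K)%N ->
  (loc a q == loc a' q') = (a == a') && (q == q').
Proof.
move=> aK a'K; apply/eqP/andP => [[e]|[/eqP-> /eqP->]] //.
have := congr1 (fun x => x %% K)%N e; have := congr1 (fun x => x %/ K)%N e.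
rewrite ![(_ + K * _)%N]addnC ![(K * _)%N]mulnC.
rewrite !divnMDl ?(leq_ltn_trans _ aK) // !modnMDl !divn_small // !modn_small //.
by rewrite !addn0 => -> ->.
Qed.

(** Frame condition: [k %% K] and [k %/ K] recover the array and the entry from an address. *)
Definition keeps (f : nat -> nat -> bool) (m m' : memory) : Prop :=
  forall p, (if p is Negz k then ~~ f (k %% K)%N (k %/ K)%N else true) -> m' p = m p.

Lemma keeps_trans f m1 m2 m3 : keeps f m1 m2 -> keeps f m2 m3 -> keeps f m1 m3.
Proof. by move=> k12 k23 p pf; rewrite k23 // k12. Qed.

Lemma keeps_sub (f g : nat -> nat -> bool) m m' :
  (forall a q, f a q -> g a q) -> keeps f m m' -> keeps g m m'.
Proof.
move=> fg k p pg; apply: k; case: p pg => // i; apply: contra; exact: fg.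
Qed.

Lemma keeps_loc f m m' a q : keeps f m m' -> (a < K)%N -> ~~ f a q ->
  m' (loc a q) = m (loc a q).
Proof.
move=> k aK nf; apply: k; rewrite /loc addnC mulnC modnMDl modn_small //.
by rewrite divnMDl ?(leq_ltn_trans _ aK) // divn_small // addn0.
Qed.

Lemma keeps_Posz f m m' (i : nat) : keeps f m m' -> m' i = m i.
Proof. by move=> k; apply: k. Qed.

Lemma keeps_update (f : nat -> nat -> bool) m a q v : (a < K)%N -> f a q ->
  keeps f m (update m (loc a q) v).
Proof.
move=> aK faq p; rewrite /update; case: eqP => // ->.
rewrite /loc addnC mulnC modnMDl modn_small // divnMDl ?(leq_ltn_trans _ aK) //.
by rewrite divn_small // addn0 faq.
Qed.

Lemma keeps_bounded (f : nat -> nat -> bool) B m m' : keeps f m m' -> (0 < K)%N ->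
  bounded B m ->
  (forall a q, (a < K)%N -> f a q -> (bits (m' (loc a q)) <= B)%N) ->
  bounded B m'.
Proof.
move=> k K0 bm bf p; case: p => [i|i]; first by rewrite k.
case fi: (f (i %% K) (i %/ K))%N; last by rewrite k ?fi.
have := bf _ _ (ltn_pmod i K0) fi.
by rewrite /loc [(_ + _)%N]addnC mulnC -divn_eq.
Qed.

Lemma update_loc m a q v a' q' : (a < K)%N -> (a' < K)%N ->
  update m (loc a q) v (loc a' q') = if (a' == a) && (q' == q) then v else m (loc a' q').
Proof. by move=> aK a'K; rewrite /update loc_eq. Qed.

Lemma update_Posz m a q v (i : nat) : update m (loc a q) v i = m i.
Proof. by []. Qed.

End Layout.

(** * One augmentation step *)

Section Expressions.
Local Open Scope ring_scope.

Lemma Posz_exp (n k : nat) : n%:Z ^+ k = (n ^ k)%N%:Z.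
Proof. by elim: k => [|k IH] //; rewrite exprS expnS PoszM IH. Qed.

Fixpoint epow (e : expr) (k : nat) : expr :=
  if k is k'.+1 then Binop Mul e (epow e k') else Const 1.

Lemma eval_epow m e k : eval m (epow e k) = eval m e ^+ k.
Proof. by elim: k => [|k IH] //=; rewrite IH exprS. Qed.

Definition esum (l : seq expr) : expr := foldr (Binop Add) (Const 0) l.
Definition eprod (l : seq expr) : expr := foldr (Binop Mul) (Const 1) l.

Lemma eval_esum m l : eval m (esum l) = \sum_(e <- l) eval m e.
Proof. by elim: l => [|e l IH]; rewrite ?big_nil //= big_cons IH. Qed.

(** The indicator of nonnegativity: [e / (e^2 + 1)] is 0 or -1. *)
Definition enonneg (e : expr) : expr :=
  Binop Add (Const 1) (Binop Div e (Binop Add (Binop Mul e e) (Const 1))).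

Lemma divz_sqr1 (x : int) : (x %/ (x * x + 1))%Z = - (x < 0)%R%:Z.
Proof.
have [x0|x0] := ltrP x 0; last by rewrite divz_small //; apply/andP; split=> //; nia.
set y := x * x + 1; have y0 : y != 0 by rewrite /y; nia.
have xE : x = -1 * y + (y + x) by lia.
rewrite [X in (X %/ _)%Z]xE divzMDl // divz_small ?addr0 //.
by rewrite /y; nia.
Qed.

Lemma eval_enonneg m e : eval m (enonneg e) = (0 <= eval m e)%R%:Z.
Proof. by rewrite /= divz_sqr1 ltNge; case: (0 <= _). Qed.

Lemma eval_eprod_nonneg m l :
  eval m (eprod (map enonneg l)) = (all (fun e => 0 <= eval m e) l)%:Z.
Proof.
by elim: l => //= e l ->; rewrite divz_sqr1 ltNge; case: (0 <= _); case: all.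
Qed.

End Expressions.

(** Numbers of the arrays of the memory layout. The first 14 hold a scalar each: the constants
    [vR], [vO], [vW] and [vL] that are computed from the input (base, substitute for infinity,
    weight of the slacks, largest step); the state of the search, with the number [vZ] of the
    choice of bricks, the step length [vl], the gain [vd] asked for, the indicator [vF] of
    acceptability, the indicator [vS] of success in a sweep, the multiplier [vG] and the number
    [vT] of sweeps; the loop counter [vQ]; the number [vB] of empty intervals; the sum of
    squares [vU] of the slacks. Then come [t] arrays, one entry per brick, for each of the
    current point, its lower and upper bounds and the objective. *)
Notation vR := 0%N. Notation vO := 1%N. Notation vL := 2%N. Notation vZ := 3%N.
Notation vl := 4%N. Notation vd := 5%N. Notation vF := 6%N. Notation vS := 7%N.
Notation vG := 8%N. Notation vT := 9%N. Notation vQ := 10%N. Notation vB := 11%N.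
Notation vW := 12%N. Notation vU := 13%N.

Definition vX : nat := 14.

Section Augmentation.
Local Open Scope ring_scope.

Variables (t C : nat) (T : finType) (pat : T -> 'I_C -> 'cV[int]_t).

Definition vLO : nat := (14 + t)%N.
Definition vHI : nat := (14 + 2 * t)%N.
Definition vC : nat := (14 + 3 * t)%N.
Definition narrays : nat := (14 + 4 * t)%N.
Notation K := narrays.

Notation sc a := (loc K a 0).
Definition rd (a : nat) : expr := Read (Const (sc a)).
Definition assign (a : nat) (e : expr) : expr * expr := (Const (sc a), e).
Definition eN : expr := Read (Const 0).
Definition cell (b : nat) (j : nat) (e : expr) : expr := eloc K (b + j) e.

(** The brick numbers of a move are the digits in base n of the counter. *)
Definition edigit (k : nat) : expr :=
  let e := Binop Div (rd vZ) (epow eN k) in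
  Binop Defs.Sub e (Binop Mul eN (Binop Div e eN)).

Definition slots : seq ('I_C * 'I_t) := [seq (k, j) | k <- enum 'I_C, j <- enum 'I_t].

Definition add_move (tau : T) (l : seq ('I_C * 'I_t)) : seq (expr * expr) :=
  [seq let x := cell vX kj.2 (edigit kj.1) in
       (x, Binop Add (Read x) (Binop Mul (rd vG) (Const (pat tau kj.1 kj.2 0))))
     | kj : 'I_C * 'I_t <- l].

Definition emove_cost (tau : T) : expr :=
  esum [seq Binop Mul (Read (cell vC kj.2 (edigit kj.1))) (Const (pat tau kj.1 kj.2 0))
          | kj : 'I_C * 'I_t <- slots].

(** After the move has been added to the current point, the quantities that
    must be nonnegative for it to be accepted. *)
Definition checks (tau : T) : seq expr :=
  Binop Defs.Sub (Binop Mul (rd vl) (Binop Defs.Sub (Const 0) (emove_cost tau))) (rd vd) ::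
  [seq Binop Defs.Sub (Read (cell vX kj.2 (edigit kj.1)))
                 (Read (cell vLO kj.2 (edigit kj.1))) | kj : 'I_C * 'I_t <- slots] ++
  [seq Binop Defs.Sub (Read (cell vHI kj.2 (edigit kj.1)))
                 (Read (cell vX kj.2 (edigit kj.1))) | kj : 'I_C * 'I_t <- slots].

(** The move is first made, then taken back if it turns out to be unacceptable: multiplying
    by the indicator [vF] replaces a branching, and straight-line code suffices. *)
Definition try_move (tau : T) : seq (expr * expr) :=
  assign vG (rd vl) :: add_move tau slots ++
  assign vF (eprod (map enonneg (checks tau))) ::
  assign vG (Binop Mul (rd vl) (Binop Defs.Sub (rd vF) (Const 1))) ::
  add_move tau slots ++
  [:: assign vS (Binop Defs.Sub (Const 1)
       (Binop Mul (Binop Defs.Sub (Const 1) (rd vS)) (Binop Defs.Sub (Const 1) (rd vF))))].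

Definition try_all : seq (expr * expr) := flatten [seq try_move tau | tau <- enum T].

Section Semantics.
Variable n : nat.

Definition arr (b : nat) (m : memory) : 'M[int]_(t, n) :=
  \matrix_(j, q) m (loc K (b + j) q).

Definition selX (a q : nat) : bool := (vX <= a < vX + t)%N && (q < n)%N.

Definition selT (a q : nat) : bool :=
  selX a q || ((a \in [:: vF; vS; vG]) && (q == 0%N)).

Lemma arr_keeps f b m m' : keeps K f m m' -> (vX <= b)%N -> (b + t <= K)%N ->
  (forall a q, (b <= a < b + t)%N -> (q < n)%N -> ~~ f a q) -> arr b m' = arr b m.
Proof.
move=> kp bX bK nf; apply/matrixP=> j q; rewrite !mxE.
apply: (keeps_loc kp); first by apply: leq_trans bK; rewrite ltn_add2l.
by apply: nf => //; rewrite leq_addr ltn_add2l ltn_ord.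
Qed.

Lemma arr_scalar b m a v : (a < vX)%N -> (vX <= b)%N -> (b + t <= K)%N ->
  arr b (update m (sc a) v) = arr b m.
Proof.
move=> aX bX bK; apply: (arr_keeps (f := fun a' q => (a' == a) && (q == 0%N))) => //.
  by apply: keeps_update; rewrite ?eqxx // /K; move: aX; rewrite /vX; lia.
by move=> a' q /andP[ba _] _; rewrite negb_and; have /negPf-> // : a' != a; lia.
Qed.

Lemma scalar_lt_K a : (a < vX)%N -> (a < K)%N.
Proof. by rewrite /vX /K; lia. Qed.

Lemma selX_scalar a : (a < vX)%N -> ~~ selX a 0.
Proof. by rewrite /selX; lia. Qed.

Lemma sc_update m a b v : (a < vX)%N -> (b < vX)%N ->
  update m (sc a) v (sc b) = if b == a then v else m (sc b).
Proof. by move=> aX bX; rewrite update_loc ?scalar_lt_K // andbT. Qed.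

Hypothesis n_gt0 : (0 < n)%N.

Definition digits (z : nat) : {ffun 'I_C -> 'I_n} :=
  [ffun k : 'I_C => Ordinal (ltn_pmod (z %/ n ^ k) n_gt0)].

(** A single counter thus enumerates all ways to choose the bricks of a move. *)
Lemma digits_onto (b : {ffun 'I_C -> 'I_n}) : exists2 z, (z < n ^ C)%N & digits z = b.
Proof.
suff main (c : nat) (f : nat -> nat) : (forall k, (f k < n)%N) ->
    exists2 z, (z < n ^ c)%N & forall k, (k < c)%N -> ((z %/ n ^ k) %% n)%N = f k.
  have [|z zC zP] := main C (fun k => if insub k is Some k' then val (b k') else 0%N).
    by move=> k; case: insub => [k'|] //=; exact: ltn_ord.
  exists z => //; apply/ffunP=> k; apply/val_inj; rewrite ffunE /= zP ?ltn_ord //.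
  by rewrite valK.
elim: c f => [|c IH] f fn; first by exists 0%N.
have [z zc zP] := IH (fun k => f k.+1) (fun k => fn k.+1).
exists (z * n + f 0)%N.
  by rewrite expnSr; apply: leq_trans (_ : z * n + n <= _)%N; rewrite ?ltn_add2l // -mulSnr leq_mul2r zc orbT.
case=> [|k] kc; first by rewrite expn0 divn1 modnMDl modn_small.
by rewrite expnS divnMA divnMDl // [(f 0 %/ n)%N]divn_small ?fn // addn0 zP.
Qed.

Lemma eval_edigit m z (k : 'I_C) : m 0 = n%:Z -> m (sc vZ) = z%:Z ->
  eval m (edigit k) = (digits z k : nat)%:Z.
Proof.
move=> mn mz; rewrite /edigit /= eval_epow /= mn mz ffunE /=.
rewrite Posz_exp.
rewrite !divz_nat; move: (z %/ _)%N => y.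
have := divn_eq y n; move: (y %/ n)%N (y %% n)%N => a b; lia.
Qed.

(** Adding the entries one by one is correct even if two columns of the pattern fall into the
    same brick. *)
Lemma run_add_move m z tau (l : seq ('I_C * 'I_t)) :
  m 0 = n%:Z -> m (sc vZ) = z%:Z ->
  keeps K selX m (run (add_move tau l) m) /\
  arr vX (run (add_move tau l) m) =
    arr vX m + m (sc vG) *: \sum_(kj <- l) \matrix_(j, q)
      (pat tau kj.1 kj.2 0 *+ ((j == kj.2) && (q == digits z kj.1))).
Proof.
elim: l m => [|[k j] l IH] m mn mz.
  by split=> //; rewrite big_nil scaler0 addr0.
rewrite /=; set m1 := write1 m _.
have ev : eval m (cell vX j (edigit k)) = loc K (vX + j) (digits z k).
  by apply: eval_eloc; exact: eval_edigit.
have vE : eval m (Binop Add (Read (cell vX j (edigit k)))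
    (Binop Mul (rd vG) (Const (pat tau k j 0)))) =
    m (loc K (vX + j) (digits z k)) + m (sc vG) * pat tau k j 0 by rewrite -ev.
have jK : (vX + j < K)%N by have := ltn_ord j; rewrite /K /vX; lia.
have kp1 : keeps K selX m m1.
  rewrite /m1 /write1 ev; apply: keeps_update => //.
  by rewrite /selX ltn_ord leq_addr ltn_add2l ltn_ord.
have m1n : m1 0 = n%:Z by rewrite -mn; exact: (keeps_Posz 0 kp1).
have scK a : (a < vX)%N -> m1 (sc a) = m (sc a).
  by move=> aX; apply: (keeps_loc kp1); rewrite /selX /K /vX in aX *; lia.
have m1z : m1 (sc vZ) = z%:Z by rewrite scK.
have [kp arrE] := IH m1 m1n m1z; split; first exact: keeps_trans kp1 kp.
rewrite arrE big_cons scalerDr addrA scK //; congr (_ + _).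
apply/matrixP=> j' q; rewrite !mxE /m1 /write1 ev vE update_loc //; last first.
  by have := ltn_ord j'; rewrite /K /vX; lia.
rewrite eqn_add2l -!val_eqE; case: ifP => [/andP[/eqP jj /eqP qq]|_].
  by rewrite -jj -qq mulr1n.
by rewrite mulr0n mulr0 addr0.
Qed.

Lemma slots_move tau z : \sum_(kj <- slots) \matrix_(j, q)
      (pat tau kj.1 kj.2 0 *+ ((j == kj.2) && (q == digits z kj.1)))
   = move (pat tau) (digits z).
Proof.
rewrite /slots big_allpairs /move big_enum /=; apply: eq_bigr => k _.
rewrite big_enum /=; apply/matrixP=> j q; rewrite in_brickE summxE (bigD1 j) //= big1.
  by rewrite mxE eqxx addr0.
by move=> j' /negPf jj; rewrite mxE eq_sym jj.
Qed.

Lemma dot_move (c : 'M[int]_(t, n)) tau (b : 'I_C -> 'I_n) :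
  dot c (move (pat tau) b) = \sum_(kj <- slots) c kj.2 (b kj.1) * pat tau kj.1 kj.2 0.
Proof.
rewrite dot_sum /slots big_allpairs big_enum /=; apply: eq_bigr => k _.
rewrite big_enum /=; apply: eq_bigr => j _; rewrite (bigD1 (b k)) //= big1.
  by rewrite in_brickE eqxx addr0.
by move=> q /negPf qb; rewrite in_brickE qb mulr0.
Qed.

(** A move changes only the bricks that it chooses, so only these need a check: a number that
    does not depend on [n]. *)
Lemma in_box_touched (lo hi x : 'M[int]_(t, n)) tau (b : 'I_C -> 'I_n) (l : int) :
  in_box lo hi x ->
  let y := x + l *: move (pat tau) b in
  in_box lo hi y =
    all (fun kj : 'I_C * 'I_t => 0 <= y kj.2 (b kj.1) - lo kj.2 (b kj.1)) slots &&
    all (fun kj : 'I_C * 'I_t => 0 <= hi kj.2 (b kj.1) - y kj.2 (b kj.1)) slots.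
Proof.
move=> /in_boxP bx y; apply/in_boxP/andP => [byy|[/allP lo_y /allP hi_y] j q].
  by split; apply/allP=> kj _; have := byy kj.2 (b kj.1); rewrite !subr_ge0 => /andP[].
have [k /eqP <-|no] := pickP (fun k => b k == q).
  have kj : (k, j) \in slots by rewrite allpairs_f // mem_enum.
  by have := lo_y _ kj; have := hi_y _ kj; rewrite !subr_ge0 /= => -> ->.
suff -> : y j q = x j q by [].
rewrite !mxE summxE big1 ?mulr0 ?addr0 // => k _.
by rewrite in_brickE eq_sym no.
Qed.

Definition acceptable (lo hi c x : 'M[int]_(t, n)) (d l : int) (g : 'M[int]_(t, n)) : bool :=
  (d <= - dot c (l *: g)) && in_box lo hi (x + l *: g).

Lemma dotZ m' n' (c x : 'M[int]_(m', n')) (a : int) : dot c (a *: x) = a * dot c x.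
Proof.
rewrite /dot big_distrr; apply: eq_bigr => j _ /=; rewrite big_distrr.
by apply: eq_bigr => q _ /=; rewrite mxE mulrCA.
Qed.

Lemma eval_checks m z tau (x lo hi : 'M[int]_(t, n)) :
  m 0 = n%:Z -> m (sc vZ) = z%:Z -> lo = arr vLO m -> hi = arr vHI m ->
  in_box lo hi x ->
  arr vX m = x + m (sc vl) *: move (pat tau) (digits z) ->
  eval m (eprod (map enonneg (checks tau))) =
  (acceptable lo hi (arr vC m) x (m (sc vd)) (m (sc vl)) (move (pat tau) (digits z)))%:Z.
Proof.
move=> mn mz loE hiE bx xE; rewrite eval_eprod_nonneg; congr (nat_of_bool _)%:Z.
have ev b j (k : 'I_C) : eval m (Read (cell b j (edigit k))) = m (loc K (b + j) (digits z k)).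
  by rewrite -(@eval_eloc K m (b + j) (edigit k)) //; exact: eval_edigit.
rewrite /checks /= all_cat !all_map /acceptable in_box_touched //; congr (_ && (_ && _)).
- have -> : eval m (emove_cost tau) = dot (arr vC m) (move (pat tau) (digits z)).
    rewrite dot_move eval_esum big_map; apply: eq_bigr => -[k j] _.
    by rewrite -[LHS]/(eval m (Read (cell vC j (edigit k))) * pat tau k j 0) ev mxE.
  by rewrite dotZ sub0r mulrN subr_ge0.
- apply: eq_all => -[k j].
  rewrite -[LHS]/(0 <= eval m (Read (cell vX j (edigit k))) -
                     eval m (Read (cell vLO j (edigit k)))) !ev -xE loE.
  by rewrite ![arr _ _ _ _]mxE.
- apply: eq_all => -[k j].
  rewrite -[LHS]/(0 <= eval m (Read (cell vHI j (edigit k))) -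
                     eval m (Read (cell vX j (edigit k)))) !ev -xE hiE.
  by rewrite ![arr _ _ _ _]mxE.
Qed.

Lemma run_try_move m z tau :
  m 0 = n%:Z -> m (sc vZ) = z%:Z -> in_box (arr vLO m) (arr vHI m) (arr vX m) ->
  let g := move (pat tau) (digits z) in
  let a := acceptable (arr vLO m) (arr vHI m) (arr vC m) (arr vX m)
             (m (sc vd)) (m (sc vl)) g in
  let m' := run (try_move tau) m in
  [/\ keeps K selT m m',
      arr vX m' = if a then arr vX m + m (sc vl) *: g else arr vX m,
      m' (sc vS) = if a then 1 else m (sc vS),
      m' (sc vF) = a%:Z & m' (sc vG) = m (sc vl) * (a%:Z - 1)].
Proof.
move=> mn mz bx g a m'.
have XK : (vX + t <= K)%N by rewrite /vX /K; lia.
have LK : (vLO + t <= K)%N by rewrite /vLO /K; lia.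
have HK : (vHI + t <= K)%N by rewrite /vHI /K; lia.
have CK : (vC + t <= K)%N by rewrite /vC /K; lia.
have XL : (vX <= vLO)%N by []. have XH : (vX <= vHI)%N by []. have XC : (vX <= vC)%N by [].
have selL a' q : (vLO <= a' < vLO + t)%N -> (q < n)%N -> ~~ selX a' q.
  by rewrite /selX /vLO /vX; lia.
have selH a' q : (vHI <= a' < vHI + t)%N -> (q < n)%N -> ~~ selX a' q.
  by rewrite /selX /vHI /vX; lia.
have selC a' q : (vC <= a' < vC + t)%N -> (q < n)%N -> ~~ selX a' q.
  by rewrite /selX /vC /vX; lia.
have kupd (m1 : memory) a' v : a' \in [:: vF; vS; vG] ->
    keeps K selT m1 (update m1 (sc a') v).
  move=> a'in; apply: keeps_update; last by rewrite /selT a'in orbT.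
  by apply: scalar_lt_K; move: a'in; rewrite !inE => /or3P[]/eqP->.
have ksub m1 m2 : keeps K selX m1 m2 -> keeps K selT m1 m2.
  by apply: keeps_sub => a' q h; rewrite /selT h.
rewrite /m' /try_move /= !run_cat /= run_cat /=.
set m1 := write1 m _; set m2 := run _ m1; set m3 := write1 m2 _; set m4 := write1 m3 _.
set m5 := run _ m4; set m6 := write1 m5 _.
have m1E : m1 = update m (sc vG) (m (sc vl)) by [].
have m1n : m1 0 = n%:Z by rewrite m1E update_Posz.
have m1z : m1 (sc vZ) = z%:Z by rewrite m1E sc_update.
have [k12 x2] := run_add_move tau slots m1n m1z.
rewrite -/m2 slots_move -/g in k12 x2.
have x2' : arr vX m2 = arr vX m + m (sc vl) *: g.
  by rewrite x2 m1E arr_scalar // sc_update.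
have m2sc a' : (a' < vX)%N -> m2 (sc a') = if a' == vG then m (sc vl) else m (sc a').
  by move=> aX; rewrite (keeps_loc k12) ?scalar_lt_K ?selX_scalar // m1E sc_update.
have m2n : m2 0 = n%:Z by rewrite (keeps_Posz 0 k12).
have lo2 : arr vLO m2 = arr vLO m by rewrite (arr_keeps k12 _ _ selL) // m1E arr_scalar.
have hi2 : arr vHI m2 = arr vHI m by rewrite (arr_keeps k12 _ _ selH) // m1E arr_scalar.
have c2 : arr vC m2 = arr vC m by rewrite (arr_keeps k12 _ _ selC) // m1E arr_scalar.
have m3E : m3 = update m2 (sc vF) a%:Z.
  rewrite /m3 /write1 [eval m2 (assign _ _).2](@eval_checks _ z tau (arr vX m) (arr vLO m) (arr vHI m)) ?m2sc ?c2 ?lo2 ?hi2 //.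
have m4E : m4 = update m3 (sc vG) (m (sc vl) * (a%:Z - 1)).
  rewrite /m4 -[write1 _ _]/(update m3 (sc vG) (m3 (sc vl) * (m3 (sc vF) - 1))).
  by rewrite m3E !sc_update //= m2sc.
have m4n : m4 0 = n%:Z by rewrite m4E update_Posz m3E update_Posz.
have m4z : m4 (sc vZ) = z%:Z by rewrite m4E sc_update // m3E sc_update // m2sc.
have [k45 x5] := run_add_move tau slots m4n m4z.
rewrite -/m5 slots_move -/g m4E sc_update //= arr_scalar // m3E arr_scalar // x2' in k45 x5.
have m5sc a' : (a' < vX)%N -> m5 (sc a') = if a' == vG then m (sc vl) * (a%:Z - 1) else
    if a' == vF then a%:Z else m (sc a').
  move=> aX; rewrite (keeps_loc k45) ?scalar_lt_K ?selX_scalar //.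
  by rewrite !sc_update // m2sc //; case: eqP.
have m6E : m6 = update m5 (sc vS) (1 - (1 - m (sc vS)) * (1 - a%:Z)).
  rewrite /m6 -[write1 _ _]/(update m5 (sc vS) (1 - (1 - m5 (sc vS)) * (1 - m5 (sc vF)))).
  by rewrite !m5sc.
split.
- apply: keeps_trans (_ : keeps K selT m m1) _; first by rewrite m1E; exact: kupd.
  apply: keeps_trans (ksub _ _ k12) _.
  apply: keeps_trans (_ : keeps K selT m2 m3) _; first by rewrite m3E; exact: kupd.
  apply: keeps_trans (_ : keeps K selT m3 m4) _; first by rewrite m4E; exact: kupd.
  apply: keeps_trans (_ : keeps K selT m4 m5) _; first by rewrite m4E m3E; exact: ksub.
  by rewrite m6E; exact: kupd.
- rewrite m6E arr_scalar // x5 -addrA -scalerDl; case: (a) => /=.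
    by rewrite subrr mulr0 addr0.
  by rewrite sub0r mulrN1 subrr scale0r addr0.
- by rewrite m6E sc_update //=; case: (a); rewrite ?subrr ?mulr0 ?subr0 // mulr1 subKr.
- by rewrite m6E sc_update //= m5sc.
- by rewrite m6E sc_update //= m5sc.
Qed.

End Semantics.
End Augmentation.

(** * A sweep over the moves *)

Section Sweep.
Local Open Scope ring_scope.

Variables (r s t : nat) (A1 : 'M[int]_(r, t)) (A2 : 'M[int]_(s, t)).
Variables (C : nat) (T : finType) (pat : T -> 'I_C -> 'cV[int]_t).
Hypothesis patK : forall tau n (b : 'I_C -> 'I_n), in_kernel A1 A2 (move (pat tau) b).

Notation K := (narrays t).
Notation sc a := (loc K a 0).

(** The step lengths are the powers of 2 up to [vL]. *)
Definition lambda_body : seq (expr * expr) :=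
  try_all pat ++ [:: assign t vl (Binop Add (rd t vl) (rd t vl))].

Definition lambda_guard : expr :=
  Binop Defs.Sub (Binop Add (rd t vL) (Const 1)) (rd t vl).

Definition lambda_start : seq (expr * expr) := [:: assign t vl (Const 1)].

Definition incr (a : nat) : seq (expr * expr) :=
  [:: assign t a (Binop Add (rd t a) (Const 1))].

Definition sweep_guard : expr := Binop Defs.Sub (epow eN C) (rd t vZ).

Definition sweep_start : seq (expr * expr) :=
  [:: assign t vZ (Const 0); assign t vS (Const 0)].

Definition sweep : program :=
  Defs.Seq (writes sweep_start)
    (While sweep_guard
       (Defs.Seq (Defs.Seq (writes lambda_start) (While lambda_guard (writes lambda_body)))
            (writes (incr vZ)))).

Definition lambda_cost (B : nat) : nat :=
  (writes_cost lambda_start * B +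
   loop_cost B B lambda_guard (writes_cost lambda_body * B))%N.

Definition sweep_cost (n B : nat) : nat :=
  (writes_cost sweep_start * B +
   loop_cost B (n ^ C) sweep_guard (lambda_cost B + writes_cost (incr vZ) * B))%N.

Lemma bounded_update (B : nat) m p v : bounded B m -> (bits v <= B)%N -> bounded B (update m p v).
Proof. by move=> bm bv q; rewrite /update; case: ifP. Qed.

Lemma arr_update n a m v : (a < vX)%N ->
  arr t n vX (update m (sc a) v) = arr t n vX m.
Proof. by move=> aX; apply: arr_scalar => //; rewrite leq_add2l leq_pmull. Qed.

Definition lambda_steps (L : nat) : nat := (trunc_log 2 L).+1.

Lemma lambda_stepsP L i : (0 < L)%N -> (2 ^ i <= L)%N = (i < lambda_steps L)%N.
Proof.
move=> L_gt0; rewrite ltnS; apply/idP/idP => [|le]; first exact: trunc_log_max.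
exact: leq_trans (leq_pexp2l (isT : (0 < 2)%N) le) (trunc_logP (isT : (1 < 2)%N) L_gt0).
Qed.

Lemma lambda_steps_le B L : (0 < L)%N -> (bits (2 * L)%N <= B)%N ->
  (lambda_steps L <= B)%N.
Proof.
move=> L_gt0 BL; apply: leq_trans BL; rewrite /lambda_steps /bits ltnS.
have := trunc_logP (isT : (1 < 2)%N) L_gt0; set k := trunc_log 2 L => kL.
apply: leq_trans (_ : up_log 2 (2 ^ k) <= _)%N; first by rewrite up_expnK.
by apply: leq_up_log; lia.
Qed.

Variable n : nat.
Hypothesis n_gt0 : (0 < n)%N.

Notation arr := (arr t n).
Notation point := 'M[int]_(t, n).

(** What is known during a sweep that starts at [x0], [D] being the set of
    moves already tried. A success makes the objective drop by [d]; without any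
    success the point has not changed, so the failures are failures at [x0]. *)
Definition progress (lo hi c x0 : point) (d : int)
    (D : T -> {ffun 'I_C -> 'I_n} -> nat -> Prop) (x : point) (sc : int) : Prop :=
  [/\ in_box lo hi x, in_kernel A1 A2 (x - x0) &
      [/\ sc = 0, x = x0 & forall tau b k, D tau b k ->
            ~~ acceptable lo hi c x0 d (2 ^ k)%N%:Z (move (pat tau) b)] \/
      sc = 1 /\ dot c x <= dot c x0 - d].

Lemma in_kernelZ (h : point) (a : int) : in_kernel A1 A2 h -> in_kernel A1 A2 (a *: h).
Proof.
move=> [h2 h1]; split; first by rewrite -scalemxAr h2 scaler0.
by rewrite -scalemxAl -scalemxAr h1 scaler0.
Qed.

Lemma progress_sub lo hi c x0 d (D D' : T -> {ffun 'I_C -> 'I_n} -> nat -> Prop) x sc :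
  (forall tau b k, D' tau b k -> D tau b k) ->
  progress lo hi c x0 d D x sc -> progress lo hi c x0 d D' x sc.
Proof.
move=> sub [bx kx [[s0 xx no]|succ]]; split=> //; last by right.
by left; split=> // tau b k /sub/no.
Qed.

Lemma progress_try lo hi c x0 (d : int) D x sc tau (b : {ffun 'I_C -> 'I_n}) k : 0 < d ->
  progress lo hi c x0 d D x sc ->
  let g := move (pat tau) b in
  let a := acceptable lo hi c x d (2 ^ k)%N%:Z g in
  progress lo hi c x0 d
    (fun tau' b' k' => D tau' b' k' \/ [/\ tau' = tau, b' = b & k' = k])
    (if a then x + (2 ^ k)%N%:Z *: g else x) (if a then 1 else sc).
Proof.
move=> d0 [bx kx st] g a.
case aE: a; last first.
  split=> //; case: st => [[s0 xx no]|succ]; [left|by right].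
  by split=> // tau' b' k' [/no//|[-> -> ->]]; rewrite -xx -/g -/a aE.
have /andP[gain bx'] : a by rewrite aE.
split=> //; first by rewrite addrAC; apply: in_kernelD => //; exact/in_kernelZ/patK.
right; split=> //; rewrite dotD; case: st => [[_ <- _]|[_ le]]; move: gain.
  by move: (dot c x) (dot c _) => u v; lia.
by move: le; move: (dot c x) (dot c x0) (dot c _) => u v w; lia.
Qed.

(** The array entries that a sweep may modify; similarly for the other phases below. *)
Definition selS (a q : nat) : bool :=
  selX t n a q || ((a \in [:: vZ; vl; vF; vS; vG]) && (q == 0%N)).

Lemma narrays_gt0 : (0 < K)%N. Proof. by []. Qed.

Lemma bits_between (B : nat) (a b x : int) : (bits a <= B)%N -> (bits b <= B)%N ->
  a <= x <= b -> (bits x <= B)%N.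
Proof.
move=> aB bB /andP[ax xb]; have [x0|x0] := lerP 0 x.
  by apply: leq_trans bB; apply: bits_mono; lia.
by apply: leq_trans aB; apply: bits_mono; lia.
Qed.

(** The only arrays that change hold the current point, whose entries are between bounds that
    are in memory themselves. *)
Lemma bounded_box (B : nat) m m' (f : nat -> nat -> bool) :
  keeps K f m m' -> bounded B m ->
  in_box (arr (vLO t) m) (arr (vHI t) m) (arr vX m') ->
  (forall a q, (a < K)%N -> f a q -> selX t n a q \/
     (q = 0%N /\ (bits (m' (sc a)) <= B)%N)) ->
  bounded B m'.
Proof.
move=> kp bm /in_boxP bx fP; apply: (keeps_bounded kp narrays_gt0 bm) => a q aK.
case/(fP _ _ aK) => [/andP[/andP[Xa aX] qn]|[->//]].
have jt : (a - vX < t)%N by rewrite ltn_subLR.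
have := bx (Ordinal jt) (Ordinal qn); rewrite !mxE /= subnKC //.
exact: bits_between.
Qed.

Section Run.
Variables (m0 : memory) (B L : nat) (d : int).
Hypotheses (m0n : m0 0 = n%:Z) (m0L : m0 (sc vL) = L%:Z) (m0d : m0 (sc vd) = d).
Hypotheses (d_gt0 : 0 < d) (L_gt0 : (0 < L)%N).
Hypotheses (m0B : bounded B m0) (B2 : (2 <= B)%N).
Hypotheses (BL : (bits (2 * L)%N <= B)%N) (BC : (bits (n ^ C)%N <= B)%N).

Let lo := arr (vLO t) m0.
Let hi := arr (vHI t) m0.
Let c := arr (vC t) m0.
Let x0 := arr vX m0.
Hypothesis x0B : in_box lo hi x0.

Notation progress := (progress lo hi c x0 d).

Lemma selS_arrays m : keeps K selS m0 m ->
  [/\ arr (vLO t) m = lo, arr (vHI t) m = hi & arr (vC t) m = c].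
Proof.
move=> kp; split; apply: (arr_keeps kp) => //;
  rewrite /vLO /vHI /vC /narrays ?leq_addr //; try lia;
  by move=> a q ha hq; rewrite /selS /selX /vX !inE; lia.
Qed.

Lemma selS_scalar m a : keeps K selS m0 m -> (a < vX)%N ->
  a \notin [:: vZ; vl; vF; vS; vG] -> m (sc a) = m0 (sc a).
Proof.
move=> kp aX na; rewrite (keeps_loc kp (scalar_lt_K _ aX)) // /selS negb_or.
by rewrite selX_scalar //= andbT.
Qed.

Definition sweep_inv z k D m :=
  [/\ keeps K selS m0 m, bounded B m, m (sc vZ) = z%:Z, m (sc vl) = (2 ^ k)%N%:Z &
      progress D (arr vX m) (m (sc vS))].

Lemma selT_selS a q : selT t n a q -> selS a q.
Proof. by rewrite /selT /selS !inE => /orP[->//|]; lia. Qed.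

Lemma sweep_inv_try z k D m tau : sweep_inv z k D m ->
  sweep_inv z k (fun tau' b' k' => D tau' b' k' \/
     [/\ tau' = tau, b' = digits C n_gt0 z & k' = k]) (run (try_move pat tau) m).
Proof.
move=> [kp bm mz ml prog].
have [loE hiE cE] := selS_arrays kp.
have mn : m 0 = n%:Z by rewrite (keeps_Posz 0 kp).
have md : m (sc vd) = d by rewrite selS_scalar.
have := @run_try_move t C T pat n n_gt0 m z tau mn mz.
rewrite loE hiE cE md ml => /(_ (match prog with And3 bx _ _ => bx end)).
set m' := run _ m => -[kp' xE sE fE gE].
have kpS : keeps K selS m m' by apply: keeps_sub selT_selS kp'.
have kp0 : keeps K selS m0 m' by apply: keeps_trans kp kpS.
have prog' := @progress_try lo hi c x0 d D (arr vX m) (m (sc vS)) tau (digits C n_gt0 z) k d_gt0 prog.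
rewrite /= -xE -sE in prog'.
have scT a : (a < vX)%N -> a \notin [:: vF; vS; vG] -> m' (sc a) = m (sc a).
  move=> aX na; rewrite (keeps_loc kp' (scalar_lt_K _ aX)) // /selT negb_or.
  by rewrite selX_scalar //= andbT.
split=> //; rewrite ?scT //.
apply: (bounded_box kp' bm); first by rewrite loE hiE; case: prog'.
move=> a q aK /orP[->|/andP[ain /eqP->]]; [by left|right; split=> //].
have bb (b : bool) : (bits b%:Z <= B)%N by apply: leq_trans B2; case: b.
move: ain; rewrite !inE => /or3P[]/eqP->.
- by rewrite fE.
- by rewrite sE; case: ifP => _; [exact: (bb true)|exact: bm].
- rewrite gE; case: acceptable; first by rewrite subrr mulr0; exact: (bb false).
  apply: leq_trans (bm (sc vl)); rewrite ml; apply: bits_mono.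
  by rewrite sub0r mulrN1 abszN.
Qed.

Lemma sweep_inv_try_all z k D m : sweep_inv z k D m ->
  sweep_inv z k (fun tau' b' k' => D tau' b' k' \/ (b' = digits C n_gt0 z /\ k' = k))
    (run (try_all pat) m).
Proof.
move=> inv.
suff main (l : seq T) D' m' : sweep_inv z k D' m' ->
    sweep_inv z k (fun tau' b' k' => D' tau' b' k' \/
      [/\ tau' \in l, b' = digits C n_gt0 z & k' = k])
      (run (flatten [seq try_move pat tau | tau <- l]) m').
  have [kp bm mz ml prog] := main (enum T) _ _ inv; split=> //.
  apply: progress_sub prog => tau b k' [?|[? ?]]; [by left|right].
  by rewrite mem_enum.
elim: l D' m' => [|tau l IH] D' m' inv'.
  case: inv' => kp bm mz ml prog; split=> //.
  by apply: progress_sub prog => tau b k' [//|[]].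
rewrite /= run_cat.
have [kp bm mz ml prog] := IH _ _ (sweep_inv_try tau inv'); split=> //.
apply: progress_sub prog => tau' b k' [?|[]]; first by left; left.
by rewrite inE => /predU1P[->|tl] -> ->; [left; right|right].
Qed.

Lemma selS_update m a v : a \in [:: vZ; vl; vF; vS; vG] ->
  keeps K selS m (update m (sc a) v).
Proof.
move=> ain; apply: keeps_update; last by rewrite /selS ain orbT.
by apply: scalar_lt_K; move: ain; rewrite !inE /vX; lia.
Qed.

Lemma hoare_lambda z D :
  hoare (fun m => [/\ keeps K selS m0 m, bounded B m, m (sc vZ) = z%:Z &
            progress D (arr vX m) (m (sc vS))])
    (Defs.Seq (writes lambda_start) (While lambda_guard (writes lambda_body)))
    (lambda_cost B)
    (fun m => [/\ keeps K selS m0 m, bounded B m, m (sc vZ) = z%:Z &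
       progress (fun tau b k => D tau b k \/ (b = digits C n_gt0 z /\ (2 ^ k <= L)%N))
         (arr vX m) (m (sc vS))]).
Proof.
pose J i := sweep_inv z i (fun tau b k => D tau b k \/ (b = digits C n_gt0 z /\ (k < i)%N)).
apply: hoare_seq (_ : hoare _ _ _ (J 0%N)) _.
  apply: hoare_writes => m [kp bm mz prog]; split=> //.
  rewrite -[run _ _]/(update m (sc vl) 1); split.
  - by apply: keeps_trans kp _; exact: selS_update.
  - exact: bounded_update.
  - by rewrite sc_update.
  - by rewrite sc_update.
  - rewrite arr_update // sc_update //=.
    by apply: progress_sub prog => tau b k [//|[]].
apply: hoare_weaken (hoare_while (B := B) (N := lambda_steps L) (J := J)
  (k := (writes_cost lambda_body * B)%N) _ _ _).
- by [].
- move=> m [kp bm mz ml prog]; split=> //.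
  apply: progress_sub prog => tau b k [?|[? ?]]; [by left|right; split=> //].
  by rewrite -lambda_stepsP.
- rewrite /loop_cost leq_add2r leq_mul2r.
  by rewrite lambda_steps_le ?orbT.
- by move=> i m [].
- move=> i m _ [kp bm mz ml _].
  rewrite -[eval m lambda_guard]/(m (sc vL) + 1 - m (sc vl)) ml.
  by rewrite (selS_scalar kp) // m0L -lambda_stepsP //; lia.
- move=> i iN; apply: hoare_writes => m inv; split; first by case: inv.
  rewrite /lambda_body run_cat.
  have [kp bm mz ml prog] := sweep_inv_try_all inv; set m' := run _ m in kp bm mz ml prog *.
  rewrite -[run _ _]/(update m' (sc vl) (m' (sc vl) + m' (sc vl))).
  have dbl : m' (sc vl) + m' (sc vl) = (2 ^ i.+1)%N%:Z.
    by rewrite ml expnS mul2n -addnn PoszD.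
  rewrite dbl; split.
  - by apply: keeps_trans kp _; exact: selS_update.
  - apply: bounded_update => //; apply: leq_trans BL; apply: bits_mono => /=.
    by rewrite expnS leq_mul2l lambda_stepsP // iN.
  - by rewrite sc_update.
  - by rewrite sc_update.
  - rewrite arr_update // sc_update //=.
    apply: progress_sub prog => tau b k [?|[-> ]]; first by left; left.
    rewrite ltnS leq_eqVlt => /predU1P[->|?]; first by right.
    by left; right.
Qed.

Lemma hoare_sweep :
  hoare (fun m => m = m0) sweep (sweep_cost n B)
    (fun m => [/\ keeps K selS m0 m, bounded B m &
       progress (fun _ _ k => (2 ^ k <= L)%N) (arr vX m) (m (sc vS))]).
Proof.
pose J z m := [/\ keeps K selS m0 m, bounded B m, m (sc vZ) = z%:Z &
   progress (fun _ b k => exists2 z', (z' < z)%N & b = digits C n_gt0 z' /\ (2 ^ k <= L)%N)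
     (arr vX m) (m (sc vS))].
apply: hoare_seq (_ : hoare _ _ _ (J 0%N)) _.
  apply: hoare_writes => m ->; split=> //.
  rewrite -[run _ _]/(update (update m0 (sc vZ) 0) (sc vS) 0); split.
  - by apply: keeps_trans (selS_update _ _ _) (selS_update _ _ _).
  - have b0 : (bits 0 <= B)%N by apply: leq_trans B2.
    by apply: bounded_update => //; exact: bounded_update.
  - by rewrite !sc_update.
  - rewrite !arr_update // !sc_update //=; split=> //; first by rewrite subrr; exact: in_kernel0.
    by left; split=> // tau b k [].
apply: hoare_weaken (hoare_while (B := B) (N := (n ^ C)%N) (J := J)
  (k := (lambda_cost B + writes_cost (incr vZ) * B)%N) _ _ _).
- by [].
- move=> m [kp bm mz prog]; split=> //; apply: progress_sub prog => tau b k kL.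
  by have [z zC zb] := digits_onto n_gt0 b; exists z.
- exact: leqnn.
- by move=> i m [].
- move=> z m _ [kp bm mz _].
  rewrite -[eval m sweep_guard]/(eval m (epow eN C) - m (sc vZ)) eval_epow /=.
  by rewrite (keeps_Posz 0 kp) m0n Posz_exp mz; lia.
- move=> z zC; apply: (hoare_seq (@hoare_lambda z (fun _ b k =>
    exists2 z', (z' < z)%N & b = digits C n_gt0 z' /\ (2 ^ k <= L)%N))).
  apply: hoare_writes => m [kp bm mz prog]; split=> //.
  rewrite -[run _ _]/(update m (sc vZ) (m (sc vZ) + 1)); split.
  - by apply: keeps_trans kp _; exact: selS_update.
  - apply: bounded_update => //; apply: leq_trans BC; apply: bits_mono; rewrite mz /=; lia.
  - by rewrite sc_update //= mz; lia.
  - rewrite arr_update // sc_update //=.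
    apply: progress_sub prog => tau b k [z']; rewrite ltnS leq_eqVlt => /predU1P[->|z'z] [bE kL].
      by right.
    by left; exists z'.
Qed.

End Run.
End Sweep.

(** * Optimization over a box by scaling *)

Section Optimize.
Local Open Scope ring_scope.

Variables (r s t : nat) (A1 : 'M[int]_(r, t)) (A2 : 'M[int]_(s, t)).
Variables (C : nat) (T : finType) (pat : T -> 'I_C -> 'cV[int]_t).
Hypothesis patK : forall tau n (b : 'I_C -> 'I_n), in_kernel A1 A2 (move (pat tau) b).
Hypothesis pat_small : forall n (h : 'M[int]_(t, n)), in_kernel A1 A2 h -> h != 0 ->
  exists tau (b : {ffun 'I_C -> 'I_n}),
    move (pat tau) b != 0 /\ conformal (move (pat tau) b) h.

Notation K := (narrays t).
Notation sc a := (loc K a 0).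

(** Each sweep closes the gap by [d] until it is at most [2 P d], where [P] bounds the number
    of moves. From a gap of [6 P d], a number [6 P] of sweeps is enough, and since
    [2 d <= 6 (d %/ 2)] for [d > 1], the next level starts with the same ratio. *)
Definition erounds : expr := Binop Mul (Const (6 * #|T|.+1)%N%:Z) (epow eN C).

Definition rounds_guard : expr := Binop Defs.Sub erounds (rd t vT).
Definition rounds_start : seq (expr * expr) := [:: assign t vT (Const 0)].
Definition delta_start : seq (expr * expr) := [:: assign t vd (rd t vL)].
Definition delta_halve : seq (expr * expr) := [:: assign t vd (Binop Div (rd t vd) (Const 2))].

Definition optimize : program :=
  Defs.Seq (writes delta_start)
    (While (rd t vd)
       (Defs.Seq
          (Defs.Seq (writes rounds_start)
             (While rounds_guard (Defs.Seq (sweep pat) (writes (incr t vT)))))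
          (writes delta_halve))).

Definition rounds_cost (n B : nat) : nat :=
  (writes_cost rounds_start * B +
   loop_cost B (6 * #|T|.+1 * n ^ C) rounds_guard
     (sweep_cost pat n B + writes_cost (incr t vT) * B))%N.

Definition optimize_cost (n B : nat) : nat :=
  (writes_cost delta_start * B +
   loop_cost B B (rd t vd) (rounds_cost n B + writes_cost delta_halve * B))%N.

Variable n : nat.
Hypothesis n_gt0 : (0 < n)%N.

Notation arr := (arr t n).
Notation point := 'M[int]_(t, n).
Let P : nat := (#|T|.+1 * n ^ C)%N.

Lemma moves_card : (#|{: T * {ffun 'I_C -> 'I_n}}| <= P)%N.
Proof. by rewrite card_prod card_ffun !card_ord /P leq_mul2r leqnSn orbT. Qed.

Lemma P_gt0 : (0 < P)%N. Proof. by rewrite muln_gt0 /= expn_gt0 n_gt0. Qed.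

Definition selO (a q : nat) : bool :=
  selS t n a q || ((a \in [:: vd; vT]) && (q == 0%N)).

Lemma progress_gap (lo hi c x0 : point) (d : int) (L : nat) (x : point) (sc : int) : 0 < d ->
  (forall j q, hi j q - lo j q <= L%:Z) -> in_box lo hi x0 ->
  progress A1 A2 pat lo hi c x0 d (fun _ _ k => (2 ^ k <= L)%N) x sc ->
  forall y : point, in_box lo hi y -> in_kernel A1 A2 (y - x0) ->
  (dot c x - dot c y <= dot c x0 - dot c y - d) \/
  (dot c x = dot c x0 /\ dot c x - dot c y <= (2 * P)%N%:Z * d /\
   (d = 1 -> dot c x <= dot c y)).
Proof.
move=> d0 hL bx0 [bx kx [[_ xx stuck]|[_ le]]] y byy ky; last first.
  by left; move: le; move: (dot c x) (dot c x0) (dot c y) => u v w; lia.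
right; rewrite xx; split=> //.
have [|gap gap1] := optimality_gap (c := c) patK pat_small ky bx0 byy hL d0.
  move=> i k kL bi; have := stuck i.1 i.2 k kL.
  rewrite /acceptable -natz scaler_nat -/(mv pat i) bi andbT -ltNge.
  by move=> h; exact: h.
split; last exact: gap1.
apply: le_trans gap _; apply: ler_wpM2r; first exact: ltW.
by rewrite lez_nat leq_mul2l moves_card.
Qed.

Variables (m0 : memory) (B L : nat).
Hypotheses (m0n : m0 0 = n%:Z) (m0L : m0 (sc vL) = L%:Z).
Hypotheses (L_gt0 : (0 < L)%N) (m0B : bounded B m0) (B2 : (2 <= B)%N).
Hypotheses (BL : (bits (2 * L)%N <= B)%N) (BP : (bits (6 * P)%N <= B)%N).

Let lo := arr (vLO t) m0.
Let hi := arr (vHI t) m0.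
Let c := arr (vC t) m0.
Let x0 := arr vX m0.
Hypothesis x0B : in_box lo hi x0.
Hypothesis hL : forall j q, hi j q - lo j q <= L%:Z.
Hypothesis gapL : forall y, in_box lo hi y -> in_kernel A1 A2 (y - x0) ->
  dot c x0 - dot c y <= L%:Z.

Lemma BC : (bits (n ^ C)%N <= B)%N.
Proof.
by apply: leq_trans BP; apply: bits_mono => /=; rewrite /P mulnA leq_pmull.
Qed.

Lemma selO_arrays m : keeps K selO m0 m ->
  [/\ arr (vLO t) m = lo, arr (vHI t) m = hi & arr (vC t) m = c].
Proof.
move=> kp; split; apply: (arr_keeps kp) => //;
  rewrite /vLO /vHI /vC /narrays ?leq_addr //; try lia;
  by move=> a q ha hq; rewrite /selO /selS /selX /vX !inE; lia.
Qed.

Lemma selO_scalar m a : keeps K selO m0 m -> (a < vX)%N ->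
  a \notin [:: vZ; vl; vF; vS; vG; vd; vT] -> m (sc a) = m0 (sc a).
Proof.
move=> kp aX na; rewrite (keeps_loc kp (scalar_lt_K _ aX)) // /selO /selS.
by move: na; rewrite !inE /selX; lia.
Qed.

Lemma selO_update m a v : a \in [:: vd; vT] -> keeps K selO m (update m (sc a) v).
Proof.
move=> ain; apply: keeps_update; last by rewrite /selO ain orbT.
by apply: scalar_lt_K; move: ain; rewrite !inE /vX; lia.
Qed.

Lemma selS_selO a q : selS t n a q -> selO a q.
Proof. by rewrite /selO => ->. Qed.

Definition opt_inv (gap : int) m :=
  [/\ keeps K selO m0 m, bounded B m, in_box lo hi (arr vX m),
      in_kernel A1 A2 (arr vX m - x0) &
      forall y, in_box lo hi y -> in_kernel A1 A2 (y - x0) ->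
        dot c (arr vX m) - dot c y <= gap].

Lemma opt_inv_update gap m a v : a \in [:: vd; vT] -> (bits v <= B)%N ->
  opt_inv gap m -> opt_inv gap (update m (sc a) v).
Proof.
move=> ain vB [kp bm bx kx gapP].
have aX : (a < vX)%N by move: ain; rewrite !inE /vX; lia.
split; rewrite ?arr_update //.
  by apply: keeps_trans kp _; exact: selO_update.
exact: bounded_update.
Qed.

Lemma opt_inv_le gap gap' m : gap <= gap' -> opt_inv gap m -> opt_inv gap' m.
Proof.
move=> le [kp bm bx kx gapP]; split=> // y byy ky; exact: le_trans (gapP y byy ky) le.
Qed.

(** The gap to the optimum after [j] sweeps at level [d], for an initial gap of
    at most [6 P d]. *)
Definition level_gap (d j : nat) : int :=
  if d == 1%N then Num.max 0 ((6 * P)%N%:Z - j%:Z)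
  else Num.max ((2 * P)%N%:Z * d%:Z) ((6 * P)%N%:Z * d%:Z - j%:Z * d%:Z).

Lemma level_gap_step d j (u v w : int) : (0 < d)%N -> v - w <= level_gap d j ->
  u - w <= v - w - d%:Z \/
    (u = v /\ u - w <= (2 * P)%N%:Z * d%:Z /\ (d%:Z = 1 -> u <= w)) ->
  u - w <= level_gap d j.+1.
Proof.
rewrite /level_gap; case: eqP => [->|d1] d0.
  by move=> h [|[_ [_ /(_ erefl)]]]; lia.
move=> h [le|[_ [le _]]]; rewrite le_max; last by rewrite le.
move: h; rewrite le_max => /orP[h|h]; first by apply/orP; left; lia.
by apply/orP; right; rewrite -addn1 PoszD mulrDl; lia.
Qed.

Lemma hoare_rounds d : (0 < d)%N ->
  hoare (fun m => opt_inv ((6 * P)%N%:Z * d%:Z) m /\ m (sc vd) = d%:Z)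
    (Defs.Seq (writes rounds_start)
       (While rounds_guard (Defs.Seq (sweep pat) (writes (incr t vT)))))
    (rounds_cost n B)
    (fun m => opt_inv (level_gap d (6 * P)) m /\ m (sc vd) = d%:Z).
Proof.
move=> d0.
pose J j m := [/\ opt_inv (level_gap d j) m, m (sc vd) = d%:Z & m (sc vT) = j%:Z].
have b0 : (bits 0 <= B)%N by exact: leq_trans B2.
apply: hoare_seq (_ : hoare _ _ _ (J 0%N)) _.
  apply: hoare_writes => m [inv md]; split; first by case: inv.
  rewrite -[run _ _]/(update m (sc vT) 0); split; last by rewrite sc_update.
    apply: opt_inv_update => //; apply: opt_inv_le inv.
    by rewrite /level_gap; case: eqP => [->|_]; rewrite le_max; apply/orP; right; lia.
  by rewrite sc_update.
apply: hoare_weaken (hoare_while (B := B) (N := (6 * P)%N) (J := J)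
  (k := (sweep_cost pat n B + writes_cost (incr t vT) * B)%N) _ _ _).
- by [].
- by move=> m [inv md _].
- by rewrite /P mulnA.
- by move=> i m [[]].
- move=> j m _ [[kp bm _ _ _] _ mT].
  rewrite -[eval m rounds_guard]/((6 * #|T|.+1)%N%:Z * eval m (epow eN C) - m (sc vT)).
  rewrite eval_epow /= (keeps_Posz 0 kp) m0n Posz_exp mT -PoszM -mulnA -/P; lia.
- move=> j jP; apply: (hoare_seq (Q := fun m =>
    [/\ opt_inv (level_gap d j.+1) m, m (sc vd) = d%:Z & m (sc vT) = j%:Z])).
    move=> m [[kp bm bx kx gapP] md mT].
    have [loE hiE cE] := selO_arrays kp.
    have mn : m 0 = n%:Z by rewrite (keeps_Posz 0 kp).
    have mL : m (sc vL) = L%:Z by rewrite selO_scalar.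
    have bx' : in_box (arr (vLO t) m) (arr (vHI t) m) (arr vX m) by rewrite loE hiE.
    have [m' [k [ex kle [kp' bm' prog]]]] :=
      hoare_sweep patK n_gt0 mn mL md (d0 : 0 < d%:Z) L_gt0 bm B2 BL BC bx' erefl.
    rewrite loE hiE cE in prog.
    have [bx1 kx1 _] := prog.
    have kx2 : in_kernel A1 A2 (arr vX m' - x0).
      by rewrite -(subrK (arr vX m) (arr vX m')) -addrA; apply: in_kernelD.
    have scO a : (a < vX)%N -> a \in [:: vd; vT] -> m' (sc a) = m (sc a).
      move=> aX ain; rewrite (keeps_loc kp' (scalar_lt_K _ aX)) // /selS /selX.
      by move: ain; rewrite !inE /vX; lia.
    exists m', k; split=> //; split; rewrite ?scO //; split=> //.
      by apply: keeps_trans kp (keeps_sub selS_selO kp').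
    move=> y byy ky; apply: level_gap_step (gapP y byy ky) _ => //.
    apply: progress_gap prog _ byy _ => //.
    by rewrite -(subrK x0 y) -addrA -[x0 - _]opprB; apply: in_kernelB.
  apply: hoare_writes => m [inv md mT]; split; first by case: inv.
  rewrite -[run _ _]/(update m (sc vT) (m (sc vT) + 1)); split; last by rewrite sc_update // mT -natz natr1 natz.
    apply: opt_inv_update => //; apply: leq_trans BP; apply: bits_mono; rewrite mT /=; lia.
  by rewrite sc_update.
Qed.

Lemma hoare_optimize :
  hoare (fun m => m = m0) optimize (optimize_cost n B) (opt_inv 0).
Proof.
pose J i m := opt_inv ((6 * P)%N%:Z * (L %/ 2 ^ i)%N%:Z) m /\ m (sc vd) = (L %/ 2 ^ i)%N%:Z.
have bitsL i : (bits (L %/ 2 ^ i)%N <= B)%N.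
  apply: leq_trans BL; apply: bits_mono => /=.
  by apply: leq_trans (leq_div _ _) _; rewrite leq_pmull.
have stepsP i : (0 < L %/ 2 ^ i)%N = (i < lambda_steps L)%N.
  by rewrite divn_gt0 ?expn_gt0 // lambda_stepsP.
apply: hoare_seq (_ : hoare _ _ _ (J 0%N)) _.
  apply: hoare_writes => m ->; split=> //.
  rewrite -[run _ _]/(update m0 (sc vd) (m0 (sc vL))) m0L; split.
    apply: opt_inv_update => //; first by have := bitsL 0%N; rewrite expn0 divn1.
    split=> //; first by rewrite subrr; exact: in_kernel0.
    move=> y byy ky; apply: le_trans (gapL byy ky) _.
    by rewrite expn0 divn1 -PoszM lez_nat leq_pmull // muln_gt0 P_gt0.
  by rewrite sc_update // expn0 divn1.
apply: hoare_weaken (hoare_while (B := B) (N := lambda_steps L) (J := J)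
  (k := (rounds_cost n B + writes_cost delta_halve * B)%N) _ _ _).
- by [].
- move=> m [inv _]; apply: opt_inv_le inv.
  have : ~~ (0 < L %/ 2 ^ lambda_steps L)%N by rewrite stepsP ltnn.
  by rewrite lt0n negbK => /eqP->; rewrite mulr0.
- by rewrite /loop_cost leq_add2r leq_mul2r lambda_steps_le ?orbT.
- by move=> i m [[]].
- by move=> i m _ [_ md]; rewrite -[eval m _]/(m (sc vd)) md ltz_nat stepsP.
- move=> i; rewrite -stepsP => d0; apply: hoare_seq (hoare_rounds d0) _.
  apply: hoare_writes => m [inv md]; split; first by case: inv.
  rewrite -[run _ _]/(update m (sc vd) (m (sc vd) %/ 2)%Z) md divz_nat -divnMA -expnSr.
  split; last by rewrite sc_update.
  apply: opt_inv_update => //; apply: opt_inv_le inv.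
  rewrite expnSr divnMA; move: (L %/ 2 ^ i)%N d0 => d d0; rewrite /level_gap.
  have := divn_eq d 2; have := ltn_pmod d (isT : (0 < 2)%N).
  move: (d %/ 2)%N (d %% 2)%N => q e; move: P => P' e2 dE.
  case: eqP => d1; first by rewrite subrr maxxx mulr_ge0.
  rewrite subrr ge_max mulr_ge0 // andbT -!PoszM lez_nat.
  have -> : (6 * P' * q = 2 * P' * (3 * q))%N by lia.
  by rewrite leq_mul2l; apply/orP; right; lia.
Qed.

End Optimize.

(** * Loops over arrays *)

Section Loops.
Local Open Scope ring_scope.

(** Simultaneous assignment to distinct cells: an expression may read the cell that it is
    assigned to, but none of the others. *)
Lemma run_scatter (I : eqType) (l : seq I) (ea ev : I -> expr) (addr val : I -> int) m :
  uniq l -> {in l &, injective addr} ->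
  (forall i m', i \in l ->
     (forall p, (forall i', i' \in l -> i' != i -> p <> addr i') -> m' p = m p) ->
     eval m' (ea i) = addr i /\ eval m' (ev i) = val i) ->
  (forall i, i \in l -> run [seq (ea i, ev i) | i <- l] m (addr i) = val i) /\
  (forall p, (forall i, i \in l -> p <> addr i) ->
     run [seq (ea i, ev i) | i <- l] m p = m p).
Proof.
elim: l m => [|i l IH] m //= /andP[il ul] inj evP.
have [eaE evE] : eval m (ea i) = addr i /\ eval m (ev i) = val i.
  by apply: evP; rewrite ?mem_head.
have m1E : write1 m (ea i, ev i) = update m (addr i) (val i) by rewrite /write1 /= eaE evE.
rewrite m1E; set m1 := update m _ _.
have neq i' : i' \in l -> addr i' <> addr i.
  move=> i'l e; have := inj i' i; rewrite !inE i'l eqxx orbT => /(_ isT isT e) ii.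
  by rewrite -ii i'l in il.
have [||vals frame] := IH m1 ul.
- by move=> a b al bl; apply: inj; rewrite inE ?al ?bl orbT.
- move=> i' m' i'l agree; apply: evP; first by rewrite inE i'l orbT.
  move=> p pP; rewrite agree => [|i'' i''l ii]; last by apply: pP; rewrite ?inE ?i''l ?orbT.
  have pi : p <> addr i.
    by apply: pP; rewrite ?mem_head //; apply: contraNneq il => ->.
  by rewrite /m1 /update; case: eqP.
split=> [i'|p pP].
  rewrite inE => /predU1P[->|/vals//].
  by rewrite frame ?/m1 ?/update ?eqxx // => i'' /neq ne e; apply: ne.
rewrite frame => [|i' i'l]; last by apply: pP; rewrite inE i'l orbT.
by rewrite /m1 /update; case: eqP => // pi; case: (pP i); rewrite ?mem_head.
Qed.

Variable t : nat.
Notation K := (narrays t).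
Notation sc a := (loc K a 0).

Definition for_guard (e : expr) : expr := Binop Defs.Sub e (rd t vQ).
Definition for_start : seq (expr * expr) := [:: assign t vQ (Const 0)].

Definition for_loop (e : expr) (body : seq (expr * expr)) : program :=
  Defs.Seq (writes for_start) (While (for_guard e) (writes (body ++ incr t vQ))).

Definition for_cost (B N : nat) (e : expr) (body : seq (expr * expr)) : nat :=
  (writes_cost for_start * B +
   loop_cost B N (for_guard e) (writes_cost (body ++ incr t vQ) * B))%N.

Lemma hoare_for B N e body m1 (J : nat -> memory -> Prop) :
  bounded B m1 ->
  (forall k m, J k m -> [/\ bounded B m, m (sc vQ) = k%:Z & eval m e = N%:Z]) ->
  J 0%N (update m1 (sc vQ) 0) ->
  (forall k m, (k < N)%N -> J k m -> run body m (sc vQ) = k%:Z /\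
     J k.+1 (update (run body m) (sc vQ) k.+1%:Z)) ->
  hoare (fun m => m = m1) (for_loop e body) (for_cost B N e body) (J N).
Proof.
move=> b1 JP J0 Jstep.
apply: hoare_seq (_ : hoare _ _ _ (J 0%N)) _.
  by apply: hoare_writes => m ->; split.
apply: hoare_while.
- by move=> i m /JP[].
- move=> i m _ /JP[_ mQ me]; rewrite -[eval m _]/(eval m e - m (sc vQ)) me mQ; lia.
- move=> i iN; apply: hoare_writes => m Jm; split; first by case: (JP _ _ Jm).
  have [rQ] := Jstep i m iN Jm; rewrite run_cat.
  rewrite -[run (incr _ _) _]/(update (run body m) (sc vQ) (run body m (sc vQ) + 1)) rQ.
  by rewrite -[i.+1]addn1 PoszD.
Qed.

Section RowLoop.
Variables (n w : nat) (ea ev : 'I_w -> expr) (addr val : nat -> 'I_w -> int).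

Definition row_writes : seq (expr * expr) := [seq (ea i, ev i) | i <- enum 'I_w].

Variables (B : nat) (m1 : memory).
Hypotheses (m1n : m1 0 = n%:Z) (m1B : bounded B m1).
Hypothesis nB : (bits n <= B)%N.
Hypothesis addr_inj : forall q q' i i', (q < n)%N -> (q' < n)%N ->
  addr q i = addr q' i' -> q = q' /\ i = i'.
Hypothesis addrQ : forall q i, addr q i <> sc vQ.
Hypothesis addr0 : forall q i, addr q i <> 0.
Hypothesis valB : forall q i, (q < n)%N -> (bits (val q i) <= B)%N.
Hypothesis evP : forall q i m, (q < n)%N -> m (sc vQ) = q%:Z ->
  (forall p, p <> sc vQ -> (forall q' i', (q' < n)%N -> (q', i') <> (q, i) -> p <> addr q' i') ->
     m p = m1 p) ->
  eval m (ea i) = addr q i /\ eval m (ev i) = val q i.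

Lemma hoare_row_loop :
  hoare (fun m => m = m1) (for_loop eN row_writes) (for_cost B n eN row_writes)
    (fun m => [/\ bounded B m, forall q i, (q < n)%N -> m (addr q i) = val q i &
       forall p, p <> sc vQ -> (forall q i, (q < n)%N -> p <> addr q i) -> m p = m1 p]).
Proof.
pose J k m := [/\ bounded B m, m (sc vQ) = k%:Z,
  forall q i, (q < k)%N -> (q < n)%N -> m (addr q i) = val q i &
  forall p, p <> sc vQ -> (forall q i, (q < k)%N -> (q < n)%N -> p <> addr q i) -> m p = m1 p].
have upd (m : memory) v p : p <> sc vQ -> update m (sc vQ) v p = m p.
  by move=> ne; rewrite /update; case: eqP.
have updQ (m : memory) v : update m (sc vQ) v (sc vQ) = v by rewrite /update eqxx.
have b0 : (bits 0 <= B)%N by apply: leq_trans nB.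
apply: hoare_weaken (hoare_for (J := J) m1B _ _ _) => //.
- move=> m [bm _ vals frame]; split=> // [q i qn|p pQ pP]; first exact: vals.
  by apply: frame => // q i _; exact: pP.
- move=> k m [bm mQ _ frame]; split=> //=.
  by rewrite frame //; [by move=> q i _ _; apply: nesym; exact: addr0].
- split=> //; first exact: bounded_update.
  by move=> p pQ _; rewrite upd.
- move=> k m kn [bm mQ vals frame].
  have [||] := @run_scatter _ (enum 'I_w) ea ev (addr k) (val k) m (enum_uniq _).
  + by move=> i i' _ _ /(addr_inj kn kn)[].
  + move=> i m' _ agree; apply: evP => //.
      by rewrite agree // => i' _ _; apply: nesym; exact: addrQ.
    move=> p pQ pP; rewrite agree => [|i' _ ii]; last first.
      by apply: pP => // -[]; apply/eqP.
    apply: frame => // q' i' qk qn; apply: pP => // -[qE _].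
    by rewrite qE ltnn in qk.
  rewrite -/row_writes; set m2 := run _ m => vals2 frame2.
  have vals2' i : m2 (addr k i) = val k i by rewrite vals2 ?mem_enum.
  have frame2' p : (forall i, p <> addr k i) -> m2 p = m p by move=> h; apply: frame2.
  have m2Q : m2 (sc vQ) = k%:Z by rewrite frame2' // => i; apply: nesym; exact: addrQ.
  have m2B : bounded B m2.
    move=> p; have [[i ->]|no] := pselect (exists i, p = addr k i).
      by rewrite vals2' valB.
    by rewrite frame2' // => i pE; apply: no; exists i.
  split=> //; split=> //.
  + apply: bounded_update => //; apply: leq_trans nB; apply: bits_mono => /=; exact: kn.
  + move=> q i; rewrite ltnS leq_eqVlt upd // => /predU1P[->|qk] qn; first exact: vals2'.
    rewrite frame2' ?vals // => i' /(addr_inj qn kn)[qE _].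
    by rewrite qE ltnn in qk.
  + move=> p pQ pP; rewrite upd // frame2' => [|i]; last exact: pP.
    by apply: frame => // q i qk; apply: pP; exact: ltnW.
Qed.

End RowLoop.

Section AddUp.
Variables (N a : nat) (e len : expr) (val : nat -> int) (B : nat) (m1 : memory).

Definition add_up : seq (expr * expr) := [:: assign t a (Binop Add (rd t a) e)].

Hypotheses (aK : (a < K)%N) (aQ : a <> vQ) (m1B : bounded B m1).
Hypothesis NB : (bits N <= B)%N.
Hypothesis sumB : forall k, (k <= N)%N ->
  (bits (m1 (sc a) + \sum_(q < k) val q) <= B)%N.
Hypothesis evP : forall q m, m (sc vQ) = q%:Z ->
  (forall p, p <> sc vQ -> p <> sc a -> m p = m1 p) ->
  eval m len = N%:Z /\ ((q < N)%N -> eval m e = val q).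

Lemma hoare_add_up :
  hoare (fun m => m = m1) (for_loop len add_up) (for_cost B N len add_up)
    (fun m => [/\ bounded B m, m (sc a) = m1 (sc a) + \sum_(q < N) val q &
       forall p, p <> sc vQ -> p <> sc a -> m p = m1 p]).
Proof.
pose J k m := [/\ bounded B m, m (sc vQ) = k%:Z, (k <= N)%N,
  m (sc a) = m1 (sc a) + \sum_(q < k) val q &
  forall p, p <> sc vQ -> p <> sc a -> m p = m1 p].
have QK : (vQ < K)%N by [].
have upd (m : memory) v p : p <> sc vQ -> update m (sc vQ) v p = m p.
  by move=> ne; rewrite /update; case: eqP.
have updQ (m : memory) v : update m (sc vQ) v (sc vQ) = v by rewrite /update eqxx.
have aneQ : sc a <> sc vQ.
  by move=> /eqP; rewrite loc_eq // andbT => /eqP.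
have b0 : (bits 0 <= B)%N by apply: leq_trans NB.
apply: hoare_weaken (hoare_for (J := J) m1B _ _ _) => //.
- by move=> m [].
- by move=> k m [bm mQ kN ma frame]; have [] := evP mQ frame.
- split=> //; first exact: bounded_update.
    by rewrite upd // big_ord0 addr0.
  by move=> p pQ _; rewrite upd.
- move=> k m kN [bm mQ _ ma frame]; have [_ /(_ kN) ee] := evP mQ frame.
  have mE : run add_up m = update m (sc a) (m1 (sc a) + \sum_(q < k.+1) val q).
    by rewrite /run /= /write1 /= ee ma big_ord_recr addrA.
  rewrite mE; have Qv v : update m (sc a) v (sc vQ) = k%:Z.
    by rewrite /update; case: eqP => // /esym.
  split=> //; split=> //.
  + apply: bounded_update; last by apply: leq_trans NB; apply: bits_mono => /=; exact: kN.
    by apply: bounded_update => //; exact: sumB.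
  + by rewrite upd // /update eqxx.
  + by move=> p pQ pa; rewrite upd // /update; case: eqP => // _; exact: frame.
Qed.

End AddUp.

End Loops.

(** * The program with slack variables *)

Section ArrayLoops.
Local Open Scope ring_scope.
Variable t : nat.
Notation K := (narrays t).
Notation sc a := (loc K a 0).

Lemma hoare_eq (P Q : memory -> Prop) p k :
  (forall m1, P m1 -> hoare (fun m => m = m1) p k Q) -> hoare P p k Q.
Proof. by move=> h m Pm; apply: h Pm m erefl. Qed.

Definition row_loop (b w : nat) (ev : 'I_w -> expr) : program :=
  for_loop t eN (row_writes (fun i : 'I_w => cell t b i (rd t vQ)) ev).

Definition row_cost (B n b w : nat) (ev : 'I_w -> expr) : nat :=
  for_cost t B n eN (row_writes (fun i : 'I_w => cell t b i (rd t vQ)) ev).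

Definition selR (n b w a q : nat) : bool :=
  (b <= a < b + w)%N && (q < n)%N || (a == vQ) && (q == 0%N).

Lemma hoare_array_row (n b w : nat) (ev : 'I_w -> expr) (val : nat -> 'I_w -> int) B m1 :
  (vQ < b)%N -> (b + w <= K)%N -> m1 0 = n%:Z -> bounded B m1 -> (bits n <= B)%N ->
  (forall q i, (q < n)%N -> (bits (val q i) <= B)%N) ->
  (forall q (i : 'I_w) m, (q < n)%N -> m (sc vQ) = q%:Z -> keeps K (selR n b w) m1 m ->
     m (loc K (b + i) q) = m1 (loc K (b + i) q) -> eval m (ev i) = val q i) ->
  hoare (fun m => m = m1) (row_loop b ev) (row_cost B n b ev)
    (fun m => [/\ bounded B m, keeps K (selR n b w) m1 m &
       forall q (i : 'I_w), (q < n)%N -> m (loc K (b + i) q) = val q i]).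
Proof.
move=> Qb bwK m1n m1B nB valB evP.
have iK (i : 'I_w) : (b + i < K)%N by apply: leq_trans bwK; rewrite ltn_add2l.
have QK : (vQ < K)%N by [].
have keepsP m : (forall p, p <> sc vQ -> (forall q (i : 'I_w), (q < n)%N -> p <> loc K (b + i) q) ->
    m p = m1 p) -> keeps K (selR n b w) m1 m.
  move=> frame [i|k]; first by move=> _; exact: frame.
  rewrite /selR negb_or => /andP[nX nQ].
  have kE : Negz k = loc K (k %% K) (k %/ K).
    by rewrite /loc {1}(divn_eq k K) addnC mulnC.
  have kK : (k %% K < K)%N by rewrite ltn_pmod.
  apply: frame => [|q i qn]; rewrite kE => /eqP; rewrite loc_eq // => /andP[/eqP e1 /eqP e2].
    by rewrite e1 e2 in nQ.
  by rewrite e1 e2 leq_addr ltn_add2l ltn_ord qn in nX.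
apply: hoare_weaken (hoare_row_loop (n := n) (addr := fun q (i : 'I_w) => loc K (b + i) q)
  m1n m1B nB _ _ _ valB _) => //.
- by move=> m [bm vals frame]; split=> //; exact: keepsP.
- move=> q q' i i' _ _ /eqP; rewrite loc_eq // eqn_add2l => /andP[/eqP ii /eqP qq].
  by split=> //; exact: val_inj.
- move=> q i /eqP; rewrite loc_eq // => /andP[/eqP bi _].
  by have := leq_trans Qb (leq_addr i b); rewrite bi ltnn.
- move=> q i m qn mQ frame; split; first exact: eval_eloc.
  apply: evP => //.
    by apply: keepsP => p pQ pP; apply: frame => // q' i' q'n _; exact: pP.
  apply: frame => [/eqP|q' i' q'n ne /eqP]; rewrite loc_eq //.
    move=> /andP[/eqP bi _].
    by have := leq_trans Qb (leq_addr i b); rewrite bi ltnn.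
  by rewrite eqn_add2l => /andP[/eqP/val_inj ii /eqP qq]; apply: ne; rewrite ii qq.
Qed.

Definition selA (a0 a q : nat) : bool := ((a == a0) || (a == vQ)) && (q == 0%N).

Lemma hoare_array_add_up (N a : nat) (e len : expr) (val : nat -> int) B m1 :
  (a < K)%N -> a <> vQ -> bounded B m1 -> (bits N <= B)%N ->
  (forall k, (k <= N)%N -> (bits (m1 (sc a) + \sum_(q < k) val q) <= B)%N) ->
  (forall q m, m (sc vQ) = q%:Z -> keeps K (selA a) m1 m ->
     eval m len = N%:Z /\ ((q < N)%N -> eval m e = val q)) ->
  hoare (fun m => m = m1) (for_loop t len (add_up t a e))
    (for_cost t B N len (add_up t a e))
    (fun m => [/\ bounded B m, keeps K (selA a) m1 m &
       m (sc a) = m1 (sc a) + \sum_(q < N) val q]).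
Proof.
move=> aK aQ m1B NB sumB evP.
have QK : (vQ < K)%N by [].
have keepsP m : (forall p, p <> sc vQ -> p <> sc a -> m p = m1 p) -> keeps K (selA a) m1 m.
  move=> frame [i|k]; first by move=> _; exact: frame.
  rewrite /selA => nA.
  have kE : Negz k = loc K (k %% K) (k %/ K).
    by rewrite /loc {1}(divn_eq k K) addnC mulnC.
  have kK : (k %% K < K)%N by rewrite ltn_pmod.
  by apply: frame; rewrite kE => /eqP; rewrite loc_eq // => /andP[/eqP e1 /eqP e2];
    rewrite e1 e2 eqxx ?orbT in nA.
apply: hoare_weaken (hoare_add_up (val := val) aK aQ m1B NB sumB _) => //.
  by move=> m [bm ma frame]; split=> //; exact: keepsP.
by move=> q m mQ frame; apply: evP => //; exact: keepsP.
Qed.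

End ArrayLoops.

Section Program.
Local Open Scope ring_scope.

Variables (r s t : nat) (A1 : 'M[int]_(r, t)) (A2 : 'M[int]_(s, t)).
Notation tx := (t + (r + s))%N.
Notation K := (narrays tx).
Notation sc a := (loc K a 0).
Notation rd := (rd tx).
Notation assign := (assign tx).

(** Addresses, in the input, of the tags and values of the bounds, of the right-hand sides and
    of the objective for the brick [q]. *)
Definition ltag_addr (n q j : nat) : nat := (1 + 2 * (q * t + j))%N.
Definition lval_addr (n q j : nat) : nat := (2 + 2 * (q * t + j))%N.
Definition utag_addr (n q j : nat) : nat := (1 + 2 * (n * t) + 2 * (q * t + j))%N.
Definition uval_addr (n q j : nat) : nat := (2 + 2 * (n * t) + 2 * (q * t + j))%N.
Definition b1_addr (n i : nat) : nat := (1 + 4 * (n * t) + i)%N.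
Definition b2_addr (n q i : nat) : nat := (1 + 4 * (n * t) + r + (q * s + i))%N.
Definition w_addr (n q j : nat) : nat := (1 + 4 * (n * t) + r + n * s + (q * t + j))%N.
Definition input_size (n : nat) : nat := (1 + 5 * (n * t) + r + n * s)%N.

Definition eplus (e1 e2 : expr) : expr := Binop Add e1 e2.
Definition eminus (e1 e2 : expr) : expr := Binop Defs.Sub e1 e2.
Definition etimes (e1 e2 : expr) : expr := Binop Mul e1 e2.
Definition enat (k : nat) : expr := Const k%:Z.

Definition eNt : expr := etimes eN (enat t).
Definition eNs : expr := etimes eN (enat s).
Definition eoffset (w j : nat) : expr := eplus (etimes (rd vQ) (enat w)) (enat j).

Definition eltag (j : nat) : expr :=
  Read (eplus (enat 1) (etimes (enat 2) (eoffset t j))).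
Definition elval (j : nat) : expr :=
  Read (eplus (enat 2) (etimes (enat 2) (eoffset t j))).
Definition eutag (j : nat) : expr :=
  Read (eplus (eplus (enat 1) (etimes (enat 2) eNt)) (etimes (enat 2) (eoffset t j))).
Definition euval (j : nat) : expr :=
  Read (eplus (eplus (enat 2) (etimes (enat 2) eNt)) (etimes (enat 2) (eoffset t j))).
Definition eb1 (i : nat) : expr :=
  Read (eplus (eplus (enat 1) (etimes (enat 4) eNt)) (enat i)).
Definition eb2 (i : nat) : expr :=
  Read (eplus (eplus (eplus (enat 1) (etimes (enat 4) eNt)) (enat r)) (eoffset s i)).
Definition ew (j : nat) : expr :=
  Read (eplus (eplus (eplus (eplus (enat 1) (etimes (enat 4) eNt)) (enat r)) eNs)
          (eoffset t j)).
Definition einput_size : expr :=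
  eplus (eplus (eplus (enat 1) (etimes (enat 5) eNt)) (enat r)) eNs.

Section Eval.
Variables (m : memory) (n q : nat).
Hypotheses (mn : m 0 = n%:Z) (mQ : m (sc vQ) = q%:Z).

Lemma eval_eltag j : eval m (eltag j) = m (ltag_addr n q j)%:Z.
Proof. by rewrite /= mQ; congr (m _); rewrite /ltag_addr; lia. Qed.
Lemma eval_elval j : eval m (elval j) = m (lval_addr n q j)%:Z.
Proof. by rewrite /= mQ; congr (m _); rewrite /lval_addr; lia. Qed.
Lemma eval_eutag j : eval m (eutag j) = m (utag_addr n q j)%:Z.
Proof. by rewrite /= mn mQ; congr (m _); rewrite /utag_addr; lia. Qed.
Lemma eval_euval j : eval m (euval j) = m (uval_addr n q j)%:Z.
Proof. by rewrite /= mn mQ; congr (m _); rewrite /uval_addr; lia. Qed.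
Lemma eval_eb2 i : eval m (eb2 i) = m (b2_addr n q i)%:Z.
Proof. by rewrite /= mn mQ; congr (m _); rewrite /b2_addr; lia. Qed.
Lemma eval_ew j : eval m (ew j) = m (w_addr n q j)%:Z.
Proof. by rewrite /= mn mQ; congr (m _); rewrite /w_addr; lia. Qed.
End Eval.

Lemma eval_eb1 m (n i : nat) : m 0 = n%:Z -> eval m (eb1 i) = m (b1_addr n i)%:Z.
Proof. by move=> mn; rewrite /= mn; congr (m _); rewrite /b1_addr; lia. Qed.

Lemma eval_einput_size m (n : nat) : m 0 = n%:Z -> eval m einput_size = (input_size n)%:Z.
Proof. by move=> mn; rewrite /= mn /input_size; lia. Qed.

Variables (cst e1 e2 e3 : nat).

Definition size_square : expr := etimes (Read (rd vQ)) (Read (rd vQ)).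
Definition init_size_start := [:: assign vR (enat cst)].
(** [vR] receives the base [R]: a constant plus the squares of all the cells of the input. *)
Definition init_size : program :=
  Defs.Seq (writes init_size_start) (for_loop tx einput_size (add_up tx vR size_square)).

Definition init_scalars : seq (expr * expr) :=
  [:: assign vO (epow (rd vR) e1); assign vW (epow (rd vR) e2); assign vL (epow (rd vR) e3)].

(** With a tag 0, 1 or -1 and the value [v], the lower bound is [v], [O + 2] or [- O], and the
    upper bound is [v], [O] or [- O - 2]. A lower bound [+oo] or an upper bound [-oo] makes the
    box empty. *)
Definition elo (j : 'I_t) : expr :=
  eplus (eplus (elval j) (etimes (eltag j) (rd vO)))
        (eplus (etimes (eltag j) (eltag j)) (eltag j)).
Definition ehi (j : 'I_t) : expr :=
  eminus (eplus (euval j) (etimes (eutag j) (rd vO)))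
         (eminus (etimes (eutag j) (eutag j)) (eutag j)).
Definition ecell (b j : nat) : expr := Read (cell tx b j (rd vQ)).
Definition ebad : expr :=
  esum [seq eminus (enat 1) (enonneg (eminus (ecell (vHI tx) j) (ecell (vLO tx) j)))
       | j : 'I_t <- enum 'I_t].
Definition erow (k : nat) (A : 'M[int]_(k, t)) (i : 'I_k) : expr :=
  esum [seq etimes (Const (A i j)) (ecell vX j) | j : 'I_t <- enum 'I_t].
Definition esigma (i : 'I_s) : expr := eminus (eb2 i) (erow A2 i).
(** Minus the indicator of negativity. *)
Definition eneg (e : expr) : expr := eminus (enonneg e) (enat 1).
Definition eslack (i : 'I_(r + s)) : expr := ecell (vX + t) i.
Definition eslack_lo (i : 'I_(r + s)) : expr := eminus (enat 0) (etimes (eslack i) (eneg (eslack i))).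
Definition eslack_hi (i : 'I_(r + s)) : expr := eplus (eslack i) (etimes (eslack i) (eneg (eslack i))).
Definition eslack_cost (i : 'I_(r + s)) : expr := etimes (rd vW) (eslack i).

Definition init_rho_start (i : 'I_r) := [:: assign (vX + t + i) (eb1 i)].
(** The residue of a row of the first block involves all bricks, and is added up in a loop.
    One slack, in the brick 0, is enough for such a row. *)
Definition init_rho (i : 'I_r) : program :=
  Defs.Seq (writes (init_rho_start i))
      (for_loop tx eN (add_up tx (vX + t + i) (eminus (enat 0) (erow A1 i)))).

Definition seqs (l : seq program) : program := foldr Defs.Seq Skip l.

Definition init : program :=
  seqs [:: init_size; writes init_scalars;
    row_loop tx (vLO tx) elo; row_loop tx (vHI tx) ehi;
    row_loop tx vX (fun j : 'I_t => ecell (vLO tx) j);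
    row_loop tx (vC tx) (fun j : 'I_t => ew j);
    for_loop tx eN (add_up tx vB ebad);
    row_loop tx (vX + t + r) esigma;
    seqs [seq init_rho i | i <- enum 'I_r];
    row_loop tx (vLO tx + t) eslack_lo; row_loop tx (vHI tx + t) eslack_hi;
    row_loop tx (vC tx + t) eslack_cost].

Section InitSpec.
Variables (mi : memory) (n B : nat).
Hypotheses (min_ : mi 0 = n%:Z) (mineg : forall k, mi (Negz k) = 0) (miB : bounded B mi).

(** [Ov] replaces the infinite bounds, [Wv] is the factor of the costs of the slacks and [Lv]
    bounds the widths of the box and the initial gap. *)
Definition Rv : int := cst%:Z + \sum_(p < input_size n) mi p%:Z * mi p%:Z.
Definition Ov : int := Rv ^+ e1.
Definition Wv : int := Rv ^+ e2.
Definition Lv : int := Rv ^+ e3.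

Definition lo_val (q : nat) (j : 'I_t) : int :=
  let tag := mi (ltag_addr n q j) in mi (lval_addr n q j) + tag * Ov + (tag * tag + tag).
Definition hi_val (q : nat) (j : 'I_t) : int :=
  let tag := mi (utag_addr n q j) in mi (uval_addr n q j) + tag * Ov - (tag * tag - tag).
Definition w_val (q : nat) (j : 'I_t) : int := mi (w_addr n q j).
(** The number of empty intervals in a brick. *)
Definition bad_val (q : nat) : int := \sum_j (1 - (0 <= hi_val q j - lo_val q j)%R%:Z).
Definition rho_val (k : nat) (i : 'I_r) : int :=
  mi (b1_addr n i) - \sum_(q < k) \sum_j A1 i j * lo_val q j.
Definition sigma_val (q : nat) (i : 'I_s) : int :=
  mi (b2_addr n q i) - \sum_j A2 i j * lo_val q j.
Definition slack_val (q : nat) (i : 'I_(r + s)) : int :=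
  match split i with
  | inl i => if q == 0%N then rho_val n i else 0
  | inr i => sigma_val q i
  end.

Hypotheses (nB : (bits n <= B)%N) (sizeB : (bits (input_size n) <= B)%N) (B2 : (2 <= B)%N).
Hypothesis RB : forall k, (k <= input_size n)%N ->
  (bits (cst%:Z + \sum_(p < k) mi p%:Z * mi p%:Z) <= B)%N.
Hypotheses (OB : (bits Ov <= B)%N) (WB : (bits Wv <= B)%N) (LB : (bits Lv <= B)%N).
Hypothesis loB : forall q j, (q < n)%N -> (bits (lo_val q j) <= B)%N.
Hypothesis hiB : forall q j, (q < n)%N -> (bits (hi_val q j) <= B)%N.
Hypothesis badB : forall k, (k <= n)%N -> (bits (\sum_(q < k) bad_val q) <= B)%N.
Hypothesis rhoB : forall k i, (k <= n)%N -> (bits (rho_val k i) <= B)%N.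
Hypothesis sigmaB : forall q i, (q < n)%N -> (bits (sigma_val q i) <= B)%N.
Hypothesis costB : forall q i, (q < n)%N -> (bits (Wv * slack_val q i) <= B)%N.

Definition inputs_kept (m : memory) : Prop := forall p : nat, m p%:Z = mi p%:Z.

Definition row_is (b w : nat) (val : nat -> 'I_w -> int) (m : memory) : Prop :=
  forall q (i : 'I_w), (q < n)%N -> m (loc K (b + i) q) = val q i.

Lemma row_is_keeps f b w val m m' : keeps K f m m' -> (b + w <= K)%N ->
  (forall a q, (b <= a < b + w)%N -> ~~ f a q) -> @row_is b w val m -> row_is b val m'.
Proof.
move=> kp bwK nf h q i qn; rewrite (keeps_loc kp) ?h //.
  by apply: leq_trans bwK; rewrite ltn_add2l.
by apply: nf; rewrite leq_addr ltn_add2l ltn_ord.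
Qed.

Definition scalars_are (bad : int) (m : memory) : Prop :=
  [/\ m (sc vO) = Ov, m (sc vW) = Wv, m (sc vL) = Lv, m (sc vU) = 0 & m (sc vB) = bad].

Lemma scalars_keeps f bad m m' : keeps K f m m' ->
  (forall a, a \in [:: vO; vW; vL; vU; vB] -> ~~ f a 0%N) ->
  scalars_are bad m -> scalars_are bad m'.
Proof.
move=> kp nf [mO mW mL mU mB].
by split; rewrite (keeps_loc kp) ?nf.
Qed.

Lemma inputs_keeps f m m' : keeps K f m m' -> inputs_kept m -> inputs_kept m'.
Proof. by move=> kp h p; rewrite (keeps_Posz _ kp). Qed.

Definition size_cost : nat :=
  (writes_cost init_size_start * B +
   for_cost tx B (input_size n) einput_size (add_up tx vR size_square))%N.

Lemma hoare_init_size : hoare (fun m => m = mi) init_size size_cost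
  (fun m => [/\ bounded B m, keeps K (selA vR) mi m & m (sc vR) = Rv]).
Proof.
have cstB : (bits cst%:Z <= B)%N by have := RB (leq0n _); rewrite big_ord0 addr0.
apply: hoare_seq (_ : hoare _ _ _ (fun m => m = update mi (sc vR) cst%:Z)) _.
  by apply: hoare_writes => m ->; split.
set m1 := update _ _ _.
have k1 : keeps K (selA vR) mi m1 by apply: keeps_update.
have m1B : bounded B m1 by apply: bounded_update.
have m1R : m1 (sc vR) = cst%:Z by rewrite /m1 /update eqxx.
apply: hoare_weaken (@hoare_array_add_up tx (input_size n) vR size_square einput_size
  (fun p => mi p%:Z * mi p%:Z) B m1 _ _ m1B sizeB _ _) => //.
- move=> m [bm kp mR]; split=> //; first exact: keeps_trans k1 kp.
  by rewrite mR m1R.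
- by move=> k kle; rewrite m1R; exact: RB.
- move=> q m mQ kp.
  have inp : inputs_kept m by move=> p; rewrite (keeps_Posz _ kp).
  rewrite (@eval_einput_size m n); last by rewrite (inp 0%N).
  split=> // _; rewrite -[LHS]/(m (m (sc vQ)) * m (m (sc vQ))) mQ.
  by rewrite inp.
Qed.

Lemma hoare_init_scalars :
  hoare (fun m => [/\ bounded B m, keeps K (selA vR) mi m & m (sc vR) = Rv])
    (writes init_scalars) (writes_cost init_scalars * B)
    (fun m => [/\ bounded B m, inputs_kept m, scalars_are 0 m &
       row_is (vX + t) (fun _ (_ : 'I_r) => 0) m]).
Proof.
apply: hoare_writes => m [bm kp mR]; split=> //.
have -> : run init_scalars m =
    update (update (update m (sc vO) Ov) (sc vW) Wv) (sc vL) Lv.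
  rewrite /run /= /write1.
  rewrite ![(assign _ _).1]/= ![(assign _ _).2]/=.
  rewrite !eval_epow ![eval _ (rd vR)]/= !sc_update // mR //.
split.
- by do 3![apply: bounded_update => //].
- by move=> p; rewrite !update_Posz (keeps_Posz _ kp).
- have z a : (a < vX)%N -> ~~ selA vR a 0%N -> m (sc a) = 0.
    by move=> aX na; rewrite (keeps_loc kp (scalar_lt_K _ aX)) // /loc mineg.
  by split; rewrite !sc_update //= z.
- move=> q i qn; rewrite !update_loc //; try by rewrite /narrays /vX; have := ltn_ord i; lia.
  have ne a : (a < vX)%N -> (vX + t + i == a)%N = false.
    by move=> aX; apply/eqP; rewrite /vX in aX *; lia.
  rewrite !ne //= (keeps_loc kp); first by rewrite /loc mineg.
    by rewrite /narrays /vX; have := ltn_ord i; lia.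
  by rewrite /selA !ne.
Qed.

Lemma hoare_init_row (P : memory -> Prop) (b w : nat) (ev : 'I_w -> expr)
    (val : nat -> 'I_w -> int) (Q : memory -> Prop) :
  (vQ < b)%N -> (b + w <= K)%N ->
  (forall m, P m -> bounded B m /\ inputs_kept m) ->
  (forall q i, (q < n)%N -> (bits (val q i) <= B)%N) ->
  (forall m1 m q (i : 'I_w), P m1 -> (q < n)%N -> m (sc vQ) = q%:Z ->
     inputs_kept m -> keeps K (selR n b w) m1 m -> eval m (ev i) = val q i) ->
  (forall m1 m, P m1 -> bounded B m -> inputs_kept m -> keeps K (selR n b w) m1 m ->
     row_is b val m -> Q m) ->
  hoare P (row_loop tx b ev) (row_cost tx B n b ev) Q.
Proof.
move=> Qb bwK PP valB evP QP; apply: hoare_eq => m1 Pm1.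
have [bm1 in1] := PP m1 Pm1.
have m1n : m1 0 = n%:Z by rewrite (in1 0%N).
apply: hoare_weaken (hoare_array_row (val := val) Qb bwK m1n bm1 nB valB _) => //.
  by move=> m [bm kp vals]; apply: QP Pm1 bm (inputs_keeps kp in1) kp vals.
by move=> q i m qn mQ kp _; apply: evP Pm1 qn mQ (inputs_keeps kp in1) kp.
Qed.

Definition ready (bad : int) (m : memory) :=
  [/\ bounded B m, inputs_kept m & scalars_are bad m].

Lemma ready_keeps f bad m m' : keeps K f m m' -> bounded B m' ->
  (forall a, a \in [:: vO; vW; vL; vU; vB] -> ~~ f a 0%N) ->
  ready bad m -> ready bad m'.
Proof.
move=> kp bm nf [_ inp scal]; split=> //; first exact: inputs_keeps kp inp.
exact: scalars_keeps kp nf scal.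
Qed.

Ltac sel := rewrite /selR /selA ?inE /vLO /vHI /vC /vX /narrays; lia.

Definition rho_zero : memory -> Prop := row_is (vX + t) (fun _ (_ : 'I_r) => 0).
Definition bad_total : int := \sum_(q < n) bad_val q.

Lemma row_cell m b w (val : nat -> 'I_w -> int) q (i : 'I_w) :
  row_is b val m -> (q < n)%N -> m (sc vQ) = q%:Z -> eval m (ecell b i) = val q i.
Proof.
move=> h qn mQ; by rewrite -h // -(@eval_eloc K m (b + i) (rd vQ) q).
Qed.

Lemma hoare_init_lo :
  hoare (fun m => ready 0 m /\ rho_zero m) (row_loop tx (vLO tx) elo)
    (row_cost tx B n (vLO tx) elo)
    (fun m => [/\ ready 0 m, rho_zero m & row_is (vLO tx) lo_val m]).
Proof.
apply: (hoare_init_row (val := lo_val)) => //; first by sel.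
- by move=> m [[]].
- move=> m1 m q i [[_ in1 [mO _ _ _ _]] _] qn mQ inp kp.
  have mn : m 0 = n%:Z by rewrite (inp 0%N).
  rewrite -[LHS]/(eval m (elval i) + eval m (eltag i) * m (sc vO) +
     (eval m (eltag i) * eval m (eltag i) + eval m (eltag i))).
  rewrite (eval_eltag n mQ) (eval_elval n mQ) !inp.
  by rewrite (keeps_loc kp) ?mO //; sel.
- move=> m1 m [St1 z1] bm inp kp row; split=> //.
    by apply: (ready_keeps kp) St1 => // a; sel.
  by apply: (row_is_keeps kp) z1; [sel|move=> a q; sel].
Qed.

Lemma hoare_init_hi :
  hoare (fun m => [/\ ready 0 m, rho_zero m & row_is (vLO tx) lo_val m])
    (row_loop tx (vHI tx) ehi) (row_cost tx B n (vHI tx) ehi)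
    (fun m => [/\ ready 0 m, rho_zero m, row_is (vLO tx) lo_val m & row_is (vHI tx) hi_val m]).
Proof.
apply: (hoare_init_row (val := hi_val)) => //; first by sel.
- by move=> m [[]].
- move=> m1 m q i [[_ in1 [mO _ _ _ _]] _ _] qn mQ inp kp.
  have mn : m 0 = n%:Z by rewrite (inp 0%N).
  rewrite -[LHS]/(eval m (euval i) + eval m (eutag i) * m (sc vO) -
     (eval m (eutag i) * eval m (eutag i) - eval m (eutag i))).
  rewrite (eval_eutag mn mQ) (eval_euval mn mQ) !inp.
  by rewrite (keeps_loc kp) ?mO //; sel.
- move=> m1 m [St1 z1 l1] bm inp kp row; split=> //.
  + by apply: (ready_keeps kp) St1 => // a; sel.
  + by apply: (row_is_keeps kp) z1; [sel|move=> a q; sel].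
  + by apply: (row_is_keeps kp) l1; [sel|move=> a q; sel].
Qed.

Definition boxes (m : memory) : Prop :=
  [/\ row_is (vLO tx) lo_val m, row_is (vHI tx) hi_val m, row_is vX lo_val m &
      row_is (vC tx) w_val m].

Lemma boxes_keeps f m m' : keeps K f m m' ->
  (forall a q, [|| (vLO tx <= a < vLO tx + t)%N, (vHI tx <= a < vHI tx + t)%N,
     (vX <= a < vX + t)%N | (vC tx <= a < vC tx + t)%N] -> ~~ f a q) ->
  boxes m -> boxes m'.
Proof.
move=> kp nf [l1 h1 x1 c1]; split.
- by apply: (row_is_keeps kp) l1; [sel|move=> a q ab; apply: nf; rewrite ab].
- by apply: (row_is_keeps kp) h1; [sel|move=> a q ab; apply: nf; rewrite ab ?orbT].
- by apply: (row_is_keeps kp) x1; [sel|move=> a q ab; apply: nf; rewrite ab ?orbT].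
- by apply: (row_is_keeps kp) c1; [sel|move=> a q ab; apply: nf; rewrite ab ?orbT].
Qed.

Lemma hoare_init_x :
  hoare (fun m => [/\ ready 0 m, rho_zero m, row_is (vLO tx) lo_val m & row_is (vHI tx) hi_val m])
    (row_loop tx vX (fun j : 'I_t => ecell (vLO tx) j))
    (row_cost tx B n vX (fun j : 'I_t => ecell (vLO tx) j))
    (fun m => [/\ ready 0 m, rho_zero m, row_is (vLO tx) lo_val m, row_is (vHI tx) hi_val m
        & row_is vX lo_val m]).
Proof.
apply: (hoare_init_row (val := lo_val)) => //; first by sel.
- by move=> m [[]].
- move=> m1 m q i [_ _ l1 _] qn mQ inp kp; apply: row_cell => //.
  by apply: (row_is_keeps kp) l1; [sel|move=> a q'; sel].
- move=> m1 m [St1 z1 l1 h1] bm inp kp row; split=> //.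
  + by apply: (ready_keeps kp) St1 => // a; sel.
  + by apply: (row_is_keeps kp) z1; [sel|move=> a q; sel].
  + by apply: (row_is_keeps kp) l1; [sel|move=> a q; sel].
  + by apply: (row_is_keeps kp) h1; [sel|move=> a q; sel].
Qed.

Lemma hoare_init_c :
  hoare (fun m => [/\ ready 0 m, rho_zero m, row_is (vLO tx) lo_val m, row_is (vHI tx) hi_val m
        & row_is vX lo_val m])
    (row_loop tx (vC tx) (fun j : 'I_t => ew j)) (row_cost tx B n (vC tx) (fun j : 'I_t => ew j))
    (fun m => [/\ ready 0 m, rho_zero m & boxes m]).
Proof.
apply: (hoare_init_row (val := w_val)) => //; first by sel.
- by move=> m [[]].
- by move=> q i _; exact: miB.
- move=> m1 m q i _ qn mQ inp kp.
  have mn : m 0 = n%:Z by rewrite (inp 0%N).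
  by rewrite (eval_ew mn mQ) inp.
- move=> m1 m [St1 z1 l1 h1 x1] bm inp kp row; split=> //.
  + by apply: (ready_keeps kp) St1 => // a; sel.
  + by apply: (row_is_keeps kp) z1; [sel|move=> a q; sel].
  + split=> //.
    * by apply: (row_is_keeps kp) l1; [sel|move=> a q; sel].
    * by apply: (row_is_keeps kp) h1; [sel|move=> a q; sel].
    * by apply: (row_is_keeps kp) x1; [sel|move=> a q; sel].
Qed.

Lemma hoare_init_bad :
  hoare (fun m => [/\ ready 0 m, rho_zero m & boxes m])
    (for_loop tx eN (add_up tx vB ebad)) (for_cost tx B n eN (add_up tx vB ebad))
    (fun m => [/\ ready bad_total m, rho_zero m & boxes m]).
Proof.
apply: hoare_eq => m1 [[bm1 in1 [mO mW mL mU mB]] z1 box1].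
apply: hoare_weaken (@hoare_array_add_up tx n vB ebad eN bad_val B m1 _ _ bm1 nB _ _) => //.
- move=> m [bm kp mb]; split.
  + split=> //; first exact: inputs_keeps kp in1.
    split; first by rewrite (keeps_loc kp).
    * by rewrite (keeps_loc kp).
    * by rewrite (keeps_loc kp).
    * by rewrite (keeps_loc kp).
    * by rewrite mb mB add0r.
  + by apply: (row_is_keeps kp) z1; [sel|move=> a q; sel].
  + by apply: boxes_keeps kp _ box1 => a q; sel.
- by move=> k kn; rewrite mB add0r badB.
- move=> q m mQ kp; split; first by rewrite -[eval m eN]/(m 0) (keeps_Posz 0 kp) (in1 0%N).
  move=> qn; have [l1 h1 _ _] : boxes m by apply: boxes_keeps kp _ box1 => a q'; sel.
  rewrite eval_esum big_map big_enum /=; apply: eq_bigr => j _.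
  rewrite -[LHS]/(1 - eval m (enonneg (eminus (ecell (vHI tx) j) (ecell (vLO tx) j)))).
  rewrite eval_enonneg.
  rewrite -[eval m (eminus _ _)]/(eval m (ecell (vHI tx) j) - eval m (ecell (vLO tx) j)).
  by rewrite (row_cell _ h1 qn mQ) // (row_cell _ l1 qn mQ).
Qed.

Lemma eval_erow m q (k : nat) (A : 'M[int]_(k, t)) i :
  row_is vX lo_val m -> (q < n)%N -> m (sc vQ) = q%:Z ->
  eval m (erow A i) = \sum_j A i j * lo_val q j.
Proof.
move=> x1 qn mQ; rewrite eval_esum big_map big_enum /=; apply: eq_bigr => j _.
by rewrite -[LHS]/(A i j * eval m (ecell vX j)) (row_cell _ x1 qn mQ).
Qed.

Lemma hoare_init_sigma :
  hoare (fun m => [/\ ready bad_total m, rho_zero m & boxes m])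
    (row_loop tx (vX + t + r) esigma) (row_cost tx B n (vX + t + r) esigma)
    (fun m => [/\ ready bad_total m, rho_zero m, boxes m & row_is (vX + t + r) sigma_val m]).
Proof.
apply: (hoare_init_row (val := sigma_val)) => //; first by sel.
- by move=> m [[]].
- move=> m1 m q i [_ _ box1] qn mQ inp kp.
  have mn : m 0 = n%:Z by rewrite (inp 0%N).
  have [_ _ x1 _] : boxes m by apply: boxes_keeps kp _ box1 => a q'; sel.
  rewrite -[LHS]/(eval m (eb2 i) - eval m (erow A2 i)).
  by rewrite (eval_eb2 mn mQ) inp (eval_erow _ _ x1 qn mQ).
- move=> m1 m [St1 z1 box1] bm inp kp row; split=> //.
  + by apply: (ready_keeps kp) St1 => // a; sel.
  + by apply: (row_is_keeps kp) z1; [sel|move=> a q; sel].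
  + by apply: boxes_keeps kp _ box1 => a q; sel.
Qed.

(** The residues of the rows in [l] have been computed. *)
Definition rho_target (l : seq 'I_r) (q : nat) (i : 'I_r) : int :=
  if (i \in l) && (q == 0%N) then rho_val n i else 0.

Definition rho_cost1 (i : 'I_r) : nat :=
  (writes_cost (init_rho_start i) * B +
   for_cost tx B n eN (add_up tx (vX + t + i) (eminus (enat 0) (erow A1 i))))%N.

Definition rho_done l m := [/\ ready bad_total m, row_is (vX + t) (rho_target l) m, boxes m &
  row_is (vX + t + r) sigma_val m].

Lemma hoare_init_rho1 l i : i \notin l ->
  hoare (rho_done l) (init_rho i) (rho_cost1 i) (rho_done (i :: l)).
Proof.
move=> il; apply: hoare_eq => m0 [St0 z0 box0 sig0].
have [bm0 in0 _] := St0.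
have iK : (vX + t + i < K)%N by have := ltn_ord i; sel.
have m0n : m0 0 = n%:Z by rewrite (in0 0%N).
apply: hoare_seq (_ : hoare _ _ _ (fun m => m = update m0 (loc K (vX + t + i) 0) (rho_val 0 i))) _.
  apply: hoare_writes => m ->; split=> //.
  rewrite -[run _ _]/(update m0 (loc K (vX + t + i) 0) (eval m0 (eb1 i))) (eval_eb1 _ m0n).
  by rewrite in0 /rho_val big_ord0 subr0.
set m1 := update _ _ _.
have kp1 : keeps K (selA (vX + t + i)) m0 m1 by apply: keeps_update; rewrite // /selA !eqxx.
have bm1 : bounded B m1 by apply: bounded_update => //; exact: rhoB.
have m1i : m1 (loc K (vX + t + i) 0) = rho_val 0 i by rewrite /m1 /update eqxx.
have bel (f : memory) : keeps K (selA (vX + t + i)) m0 f -> boxes f.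
  by move=> kp; apply: boxes_keeps kp _ box0 => a q; have := ltn_ord i; sel.
have sumE k : m1 (loc K (vX + t + i) 0) +
    \sum_(q < k) (0 - \sum_j A1 i j * lo_val q j) = rho_val k i.
  rewrite m1i /rho_val big_ord0 subr0; congr (_ + _).
  by rewrite -sumrN; apply: eq_bigr => q _; rewrite sub0r.
apply: hoare_weaken (@hoare_array_add_up tx n (vX + t + i) (eminus (enat 0) (erow A1 i)) eN
  (fun q => 0 - \sum_j A1 i j * lo_val q j) B m1 iK _ bm1 nB _ _) => //.
- move=> m [bm kp' mi']; have kp : keeps K (selA (vX + t + i)) m0 m by apply: keeps_trans kp'.
  split=> //.
  + by apply: (ready_keeps kp) St0 => // a; have := ltn_ord i; sel.
  + move=> q i' qn; rewrite /rho_target inE.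
    case: (boolP ((i' == i) && (q == 0%N))) => [/andP[/eqP-> /eqP->]|ne].
      by rewrite eqxx /= mi' sumE.
    have nsel : ~~ selA (vX + t + i) (vX + t + i') q.
      move: ne; rewrite -(inj_eq val_inj) /= /selA /vX.
      by move: (nat_of_ord i') (nat_of_ord i) => a b; lia.
    rewrite (keeps_loc kp _ nsel); last by have := ltn_ord i'; sel.
    rewrite z0 // /rho_target; case: eqVneq ne => //= -> /negPf->.
    by rewrite !andbF.
  + exact: bel.
  + by apply: (row_is_keeps kp) sig0; [sel|move=> a q; have := ltn_ord i; sel].
- by move=> k kn; rewrite sumE rhoB.
- move=> q m mQ kp'; have kp : keeps K (selA (vX + t + i)) m0 m by apply: keeps_trans kp'.
  have [_ _ x1 _] := bel _ kp.
  split; first by rewrite /= (keeps_Posz 0 kp).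
  move=> qn; rewrite -[LHS]/(0 - eval m (erow A1 i)).
  by rewrite (eval_erow _ _ x1 qn mQ).
Qed.

Definition rho_cost : nat := foldr addn 1%N [seq rho_cost1 i | i <- enum 'I_r].

Lemma hoare_init_rho :
  hoare (rho_done [::]) (seqs [seq init_rho i | i <- enum 'I_r]) rho_cost (rho_done (rev (enum 'I_r))).
Proof.
rewrite /rho_cost -[rev _]cats0.
have : uniq (enum 'I_r ++ [::]) by rewrite cats0 enum_uniq.
elim: (enum 'I_r) [::] => [|i l IH] l' /=.
  by move=> _ m Sm; exists m, 1%N; split=> //; constructor.
move=> /andP[]; rewrite mem_cat negb_or => /andP[il il'] ul.
apply: hoare_seq (hoare_init_rho1 il') _.
rewrite rev_cons cat_rcons; apply: IH.
move: ul; rewrite !cat_uniq /= negb_or => /and3P[-> nh ->].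
by rewrite il andbT /= il' andbT.
Qed.

Definition slack_ready m := [/\ ready bad_total m, boxes m & row_is (vX + t) slack_val m].

Lemma rho_done_slack_ready m : rho_done (rev (enum 'I_r)) m -> slack_ready m.
Proof.
move=> [St8 z8 b8 s8]; split=> // q i qn; rewrite /slack_val.
case: splitP => [i' ii'|i' ii'].
  by rewrite ii' z8 // /rho_target mem_rev mem_enum.
by rewrite ii' [(vX + t + (r + _))%N]addnA s8.
Qed.

Lemma slack_ready_keeps f m m' : keeps K f m m' -> bounded B m' ->
  (forall a q, (a \in [:: vO; vW; vL; vU; vB]) && (q == 0%N) ||
   [|| (vLO tx <= a < vLO tx + t)%N, (vHI tx <= a < vHI tx + t)%N,
     (vX <= a < vX + tx)%N | (vC tx <= a < vC tx + t)%N] -> ~~ f a q) ->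
  slack_ready m -> slack_ready m'.
Proof.
move=> kp bm nf [St9 box9 s9]; split.
- by apply: (ready_keeps kp) St9 => // a ain; apply: nf; rewrite ain.
- apply: boxes_keeps kp _ box9 => a q h; apply: nf; apply/orP; right.
  by case/or4P: h => h; apply/or4P; [constructor 1|constructor 2|constructor 3|constructor 4]=> //; move: h; sel.
- apply: (row_is_keeps kp) s9; first by sel.
  by move=> a q h; apply: nf; apply/orP; right; apply/or4P; constructor 3; move: h; sel.
Qed.

Lemma eval_eneg m e : eval m (eneg e) = - (eval m e < 0)%R%:Z.
Proof.
rewrite -[LHS]/(eval m (enonneg e) - 1) eval_enonneg ltNge.
by case: (0 <= _); rewrite ?subrr ?sub0r ?oppr0.
Qed.

(** A slack can only go from its residue towards 0, so that its cost, [Wv] times the residue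
    times the slack, is never negative. *)
Definition slack_lo q i : int := Num.min (slack_val q i) 0.
Definition slack_hi q i : int := Num.max (slack_val q i) 0.
Definition slack_cost q i : int := Wv * slack_val q i.

Lemma slack_valB q i : (q < n)%N -> (bits (slack_val q i) <= B)%N.
Proof.
move=> qn; rewrite /slack_val; case: split => i'; last exact: sigmaB.
by case: ifP => _; [exact: rhoB|exact: leq_trans B2].
Qed.

Lemma hoare_init_slack_lo :
  hoare slack_ready (row_loop tx (vLO tx + t) eslack_lo) (row_cost tx B n (vLO tx + t) eslack_lo)
    (fun m => slack_ready m /\ row_is (vLO tx + t) slack_lo m).
Proof.
apply: (hoare_init_row (val := slack_lo)) => //; first by sel.
- by move=> m [[]].
- move=> q i qn; apply: leq_trans (slack_valB i qn); apply: bits_mono; rewrite /slack_lo.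
  by move: (slack_val q i) => x; lia.
- move=> m1 m q i [_ _ s1] qn mQ inp kp.
  have s1' : row_is (vX + t) slack_val m by apply: (row_is_keeps kp) s1; [sel|move=> a q'; sel].
  rewrite -[LHS]/(0 - eval m (eslack i) * eval m (eneg (eslack i))) eval_eneg (row_cell _ s1' qn mQ) //.
  by rewrite /slack_lo; move: (slack_val q i) => x; case: ltrP; lia.
- move=> m1 m S91 bm inp kp row; split=> //.
  by apply: slack_ready_keeps kp bm _ S91 => a q; sel.
Qed.

Lemma hoare_init_slack_hi :
  hoare (fun m => slack_ready m /\ row_is (vLO tx + t) slack_lo m)
    (row_loop tx (vHI tx + t) eslack_hi) (row_cost tx B n (vHI tx + t) eslack_hi)
    (fun m => [/\ slack_ready m, row_is (vLO tx + t) slack_lo m & row_is (vHI tx + t) slack_hi m]).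
Proof.
apply: (hoare_init_row (val := slack_hi)) => //; first by sel.
- by move=> m [[[]]].
- move=> q i qn; apply: leq_trans (slack_valB i qn); apply: bits_mono; rewrite /slack_hi.
  by move: (slack_val q i) => x; lia.
- move=> m1 m q i [[_ _ s1] _] qn mQ inp kp.
  have s1' : row_is (vX + t) slack_val m by apply: (row_is_keeps kp) s1; [sel|move=> a q'; sel].
  rewrite -[LHS]/(eval m (eslack i) + eval m (eslack i) * eval m (eneg (eslack i))) eval_eneg.
  rewrite (row_cell _ s1' qn mQ) //.
  by rewrite /slack_hi; move: (slack_val q i) => x; case: ltrP; lia.
- move=> m1 m [S91 l1] bm inp kp row; split=> //.
    by apply: slack_ready_keeps kp bm _ S91 => a q; sel.
  by apply: (row_is_keeps kp) l1; [sel|move=> a q; sel].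
Qed.

Lemma hoare_init_slack_cost :
  hoare (fun m => [/\ slack_ready m, row_is (vLO tx + t) slack_lo m & row_is (vHI tx + t) slack_hi m])
    (row_loop tx (vC tx + t) eslack_cost) (row_cost tx B n (vC tx + t) eslack_cost)
    (fun m => [/\ slack_ready m, row_is (vLO tx + t) slack_lo m, row_is (vHI tx + t) slack_hi m &
        row_is (vC tx + t) slack_cost m]).
Proof.
apply: (hoare_init_row (val := slack_cost)) => //.
- by sel.
- by move=> m [[[]]].
- move=> m1 m q i [[[_ _ [_ mW _ _ _]] _ s1] _ _] qn mQ inp kp.
  have s1' : row_is (vX + t) slack_val m by apply: (row_is_keeps kp) s1; [sel|move=> a q'; sel].
  rewrite -[LHS]/(m (sc vW) * eval m (eslack i)) (row_cell _ s1' qn mQ) //.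
  by rewrite (keeps_loc kp) ?mW //; sel.
- move=> m1 m [S91 l1 h1] bm inp kp row; split=> //.
  + by apply: slack_ready_keeps kp bm _ S91 => a q; sel.
  + by apply: (row_is_keeps kp) l1; [sel|move=> a q; sel].
  + by apply: (row_is_keeps kp) h1; [sel|move=> a q; sel].
Qed.

Definition initialized (m : memory) : Prop :=
  [/\ slack_ready m, row_is (vLO tx + t) slack_lo m, row_is (vHI tx + t) slack_hi m &
      row_is (vC tx + t) slack_cost m].

Definition init_cost : nat :=
  (size_cost + (writes_cost init_scalars * B + (row_cost tx B n (vLO tx) elo +
   (row_cost tx B n (vHI tx) ehi +
   (row_cost tx B n vX (fun j : 'I_t => ecell (vLO tx) j) +
   (row_cost tx B n (vC tx) (fun j : 'I_t => ew j) +
   (for_cost tx B n eN (add_up tx vB ebad) +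
   (row_cost tx B n (vX + t + r) esigma + (rho_cost +
   (row_cost tx B n (vLO tx + t) eslack_lo + (row_cost tx B n (vHI tx + t) eslack_hi +
   (row_cost tx B n (vC tx + t) eslack_cost + 1))))))))))))%N.

Lemma hoare_init : hoare (fun m => m = mi) init init_cost initialized.
Proof.
apply: (hoare_seq hoare_init_size).
apply: (hoare_seq hoare_init_scalars).
apply: (hoare_seq (Q := fun m => [/\ ready 0 m, rho_zero m & row_is (vLO tx) lo_val m])).
  apply: hoare_weaken hoare_init_lo => // m [bm inp scal z].
  by split.
apply: (hoare_seq hoare_init_hi).
apply: (hoare_seq hoare_init_x).
apply: (hoare_seq hoare_init_c).
apply: (hoare_seq hoare_init_bad).
apply: (hoare_seq hoare_init_sigma).
apply: (hoare_seq (Q := slack_ready)).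
  by apply: hoare_weaken hoare_init_rho => // m; exact: rho_done_slack_ready.
apply: (hoare_seq hoare_init_slack_lo).
apply: (hoare_seq hoare_init_slack_hi).
apply: (hoare_seq hoare_init_slack_cost).
by move=> m im; exists m, 1%N; split=> //; constructor.
Qed.

End InitSpec.

End Program.

(** * The complete program *)

Section Main.
Local Open Scope ring_scope.

Variables (r s t : nat) (A1 : 'M[int]_(r, t)) (A2 : 'M[int]_(s, t)).
Notation tx := (t + (r + s))%N.
Notation K := (narrays tx).
Notation sc a := (loc K a 0).
Notation rd := (rd tx).
Notation assign := (assign tx).
Notation ecell := (ecell r s t).

Variables (cst e1 e2 e3 D : nat).
Variables (C : nat) (T : finType) (pat : T -> 'I_C -> 'cV[int]_tx).

Definition eslack_squares : expr :=
  esum [seq etimes (ecell (vX + t) i) (ecell (vX + t) i) | i : 'I_(r + s) <- enum 'I_(r + s)].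

(** The square of the tag is 1 for an infinite bound and 0 for a finite one. *)
Definition erelax_lo (j : 'I_t) : expr :=
  eminus (ecell (vLO tx) j) (etimes (enat D) (etimes (eltag r s t j) (eltag r s t j))).
Definition erelax_hi (j : 'I_t) : expr :=
  eplus (ecell (vHI tx) j) (etimes (enat D) (etimes (eutag r s t j) (eutag r s t j))).

Definition eout_addr (j : 'I_t) : expr := eplus (enat 1) (eoffset r s t t j).
Definition eout (j : 'I_t) : expr := ecell vX j.

Definition verdict (e : expr) : seq (expr * expr) := [:: (Const 0, e)].

Definition finish : program :=
  seqs [:: row_loop tx (vLO tx) erelax_lo; row_loop tx (vHI tx) erelax_hi;
    Defs.Seq (writes [:: assign vd (Const 1)]) (sweep pat);
    for_loop tx eN (row_writes eout_addr eout); writes (verdict (rd vS))].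

Definition solve_box : program :=
  Defs.Seq (optimize pat)
    (Defs.Seq (for_loop tx eN (add_up tx vU eslack_squares))
       (If (rd vU) (writes (verdict (Const 2))) finish)).

Definition main : program :=
  Defs.Seq (init A1 A2 cst e1 e2 e3) (If (rd vB) (writes (verdict (Const 2))) solve_box).

Variables (r' s' : nat) (Ax1 : 'M[int]_(r', tx)) (Ax2 : 'M[int]_(s', tx)).
Hypothesis patK : forall tau n (b : 'I_C -> 'I_n), in_kernel Ax1 Ax2 (move (pat tau) b).
Hypothesis pat_small : forall n (h : 'M[int]_(tx, n)), in_kernel Ax1 Ax2 h -> h != 0 ->
  exists tau (b : {ffun 'I_C -> 'I_n}),
    move (pat tau) b != 0 /\ conformal (move (pat tau) b) h.

Variables (mi : memory) (n B : nat).
Hypothesis n_gt0 : (0 < n)%N.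

Definition join_mx (f : nat -> 'I_t -> int) (g : nat -> 'I_(r + s) -> int) : 'M[int]_(tx, n) :=
  \matrix_(j, q) match split j with inl j => f q j | inr i => g q i end.

Notation row_is := (row_is r s t n).
Notation inputs_kept := (inputs_kept mi).
Notation lo_val := (@lo_val r s t cst e1 mi n).
Notation hi_val := (@hi_val r s t cst e1 mi n).
Notation w_val := (@w_val r s t mi n).
Notation slack_val := (slack_val A1 A2 cst e1 mi n).
Notation slack_lo := (slack_lo A1 A2 cst e1 mi n).
Notation slack_hi := (slack_hi A1 A2 cst e1 mi n).
Notation slack_cost := (slack_cost A1 A2 cst e1 e2 mi n).
Notation bad_total := (bad_total r s t cst e1 mi n).
Notation initialized := (initialized A1 A2 cst e1 e2 e3 mi n B).
Notation arr := (arr tx n).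
Notation point := 'M[int]_(tx, n).

Lemma row_is_join b (f : nat -> 'I_t -> int) (g : nat -> 'I_(r + s) -> int) m :
  row_is b f m -> row_is (b + t) g m -> arr b m = join_mx f g.
Proof.
move=> hf hg; apply/matrixP=> j q; rewrite !mxE.
case: splitP => i jE; first by rewrite jE -(hf q i (ltn_ord q)).
by rewrite jE -(hg q i (ltn_ord q)) [(b + t + i)%N]addnAC -addnA [(i + t)%N]addnC.
Qed.

Definition relaxed_lo (q : nat) (j : 'I_t) : int :=
  let tag := mi (ltag_addr t n q j) in lo_val q j - D%:Z * (tag * tag).
Definition relaxed_hi (q : nat) (j : 'I_t) : int :=
  let tag := mi (utag_addr t n q j) in hi_val q j + D%:Z * (tag * tag).

Definition lo_mx : point := join_mx lo_val slack_lo.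
Definition hi_mx : point := join_mx hi_val slack_hi.
Definition c_mx : point := join_mx w_val slack_cost.
Definition x_mx : point := join_mx lo_val slack_val.
Definition lo_mx' : point := join_mx relaxed_lo slack_lo.
Definition hi_mx' : point := join_mx relaxed_hi slack_hi.

(** Each verdict with its certificate: an empty interval or a nonzero slack in the optimum of
    the box for 2, an improvement in the relaxed box for 1, the absence of improving moves
    for 0. *)
Definition outcome (m : memory) : Prop :=
  (m 0 = 2 /\ exists q j, (q < n)%N /\ hi_val q j < lo_val q j) \/
  exists x : point, [/\ in_box lo_mx hi_mx x, in_kernel Ax1 Ax2 (x - x_mx),
    forall y, in_box lo_mx hi_mx y -> in_kernel Ax1 Ax2 (y - x_mx) -> dot c_mx x <= dot c_mx y &
    (m 0 = 2 /\ exists i q, x (rshift t i) q <> 0) \/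
    (forall i q, x (rshift t i) q = 0) /\
    ((m 0 = 1 /\ exists x', [/\ in_box lo_mx' hi_mx' x', in_kernel Ax1 Ax2 (x' - x) &
         dot c_mx x' <= dot c_mx x - 1]) \/
     [/\ m 0 = 0, forall tau (b : {ffun 'I_C -> 'I_n}),
         ~~ acceptable lo_mx' hi_mx' c_mx x 1 1 (move (pat tau) b) &
         forall (q : 'I_n) (j : 'I_t), m (1 + (q * t + j))%N%:Z = x (lshift (r + s) j) q])].

Variable L : nat.
Let P : nat := (#|T|.+1 * n ^ C)%N.
Hypotheses (LE : Lv r s t cst e3 mi n = L%:Z) (L_gt0 : (0 < L)%N).
Hypotheses (B2 : (3 <= B)%N) (nB : (bits n <= B)%N).
Hypotheses (BL : (bits (2 * L)%N <= B)%N) (BP : (bits (6 * P)%N <= B)%N).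
Hypothesis init_ok : hoare (fun m => m = mi) (init A1 A2 cst e1 e2 e3)
  (init_cost A1 A2 cst e1 e2 e3 n B) initialized.
Hypothesis mi0 : mi 0 = n%:Z.
Hypothesis boxL : forall j q, hi_mx j q - lo_mx j q <= L%:Z.
Hypothesis gapL : forall y, in_box lo_mx hi_mx y -> dot c_mx x_mx - dot c_mx y <= L%:Z.
Hypothesis relaxed_loB : forall q j, (q < n)%N -> (bits (relaxed_lo q j) <= B)%N.
Hypothesis relaxed_hiB : forall q j, (q < n)%N -> (bits (relaxed_hi q j) <= B)%N.
Hypothesis slackB : forall f : nat -> 'I_(r + s) -> int,
  (forall q i, (q < n)%N -> slack_lo q i <= f q i <= slack_hi q i) ->
  forall k, (k <= n)%N -> (bits (\sum_(q < k) \sum_i f q i * f q i) <= B)%N.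

Lemma bad_val_ge0 q : 0 <= bad_val r s t cst e1 mi n q.
Proof. by apply: sumr_ge0 => j _; case: (0 <= hi_val q j - _). Qed.

Lemma bad_total_le0 : bad_total <= 0 -> forall q j, (q < n)%N -> lo_val q j <= hi_val q j.
Proof.
move=> le q j qn; rewrite -subr_ge0; apply/negPn/negP => neg.
move: le; rewrite leNgt /bad_total (bigD1 (Ordinal qn)) //= => /negP[].
apply: ltr_pwDl; last by apply: sumr_ge0 => q' _; exact: bad_val_ge0.
rewrite /bad_val (bigD1 j) //= (negPf neg) subr0.
by apply: ltr_pwDl => //; apply: sumr_ge0 => j' _; case: (0 <= hi_val q j' - _).
Qed.

Lemma bad_total_gt0 : 0 < bad_total -> exists q j, (q < n)%N /\ hi_val q j < lo_val q j.
Proof.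
move=> gt0; apply: contrapT => no; move: gt0; rewrite /bad_total big1 ?ltxx // => q _.
rewrite /bad_val big1 // => j _; rewrite subr_ge0.
case: lerP => [_|lt]; first by rewrite subrr.
by case: no; exists (nat_of_ord q), j.
Qed.

Lemma in_boxE f g f' g' (x : point) :
  in_box (join_mx f g) (join_mx f' g') x <->
  (forall (j : 'I_t) (q : 'I_n), f q j <= x (lshift (r + s) j) q <= f' q j) /\
  (forall (i : 'I_(r + s)) (q : 'I_n), g q i <= x (rshift t i) q <= g' q i).
Proof.
split=> [/in_boxP h|[h1 h2]].
  split=> [j q|i q].
    have := h (lshift (r + s) j) q; rewrite !mxE.
    by have -> : split (lshift (r + s) j) = inl j by exact: (unsplitK (inl j)).
  have := h (rshift t i) q; rewrite !mxE.
  by have -> : split (rshift t i) = inr i by exact: (unsplitK (inr i)).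
apply/in_boxP=> j q; rewrite !mxE -[j in x j q]splitK.
by case: (split j) => i /=; [exact: h1|exact: h2].
Qed.

Definition prepared (m : memory) : Prop :=
  [/\ bounded B m, inputs_kept m, m (sc vL) = L%:Z &
     [/\ row_is (vLO tx) lo_val m, row_is (vLO tx + t) slack_lo m,
         row_is (vHI tx) hi_val m, row_is (vHI tx + t) slack_hi m & arr (vC tx) m = c_mx]].

Lemma initialized_prepared m : initialized m ->
  [/\ prepared m, arr vX m = x_mx, m (sc vB) = bad_total & m (sc vU) = 0].
Proof.
move=> [[[bm inp [mO mW mL mU mB]] [l1 h1 x1 w1] s1] sl sh scost]; split=> //.
  by split=> //; [rewrite mL|split=> //; exact: row_is_join].
exact: row_is_join.
Qed.

Lemma prepared_arr m : prepared m -> arr (vLO tx) m = lo_mx /\ arr (vHI tx) m = hi_mx.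
Proof. by move=> [_ _ _ [l1 l2 h1 h2 _]]; split; exact: row_is_join. Qed.

Ltac sel := rewrite /selO /selS /selX /selR /selA ?inE /vLO /vHI /vC /vX /narrays; lia.

Lemma prepared_keeps f m m' : keeps K f m m' -> bounded B m' ->
  ~~ f vL 0%N ->
  (forall a q, [|| (vLO tx <= a < vLO tx + tx)%N, (vHI tx <= a < vHI tx + tx)%N |
     (vC tx <= a < vC tx + tx)%N] -> ~~ f a q) ->
  prepared m -> prepared m'.
Proof.
move=> kp bm fL nf [_ inp mL [l1 l2 h1 h2 c1]]; split=> //.
- exact: inputs_keeps kp inp.
- by rewrite (keeps_loc kp).
split.
- by apply: (row_is_keeps kp) l1; [sel|move=> a q h; apply: nf; move: h; sel].
- by apply: (row_is_keeps kp) l2; [sel|move=> a q h; apply: nf; move: h; sel].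
- by apply: (row_is_keeps kp) h1; [sel|move=> a q h; apply: nf; move: h; sel].
- by apply: (row_is_keeps kp) h2; [sel|move=> a q h; apply: nf; move: h; sel].
- by rewrite -c1; apply: (arr_keeps kp) => // [|a q h _]; [sel|apply: nf; move: h; sel].
Qed.

Definition optimal (x : point) : Prop :=
  [/\ in_box lo_mx hi_mx x, in_kernel Ax1 Ax2 (x - x_mx) &
    forall y, in_box lo_mx hi_mx y -> in_kernel Ax1 Ax2 (y - x_mx) -> dot c_mx x <= dot c_mx y].

Lemma x_mx_in_box : (forall q j, (q < n)%N -> lo_val q j <= hi_val q j) ->
  in_box lo_mx hi_mx x_mx.
Proof.
move=> ok; apply/in_boxP => j q; rewrite !mxE; case: (split j) => i.
  by rewrite lexx ok.
by rewrite /slack_lo /slack_hi; move: (slack_val q i) => x; lia.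
Qed.

Lemma hoare_solve_optimize : hoare (fun m => initialized m /\ bad_total <= 0) (optimize pat)
  (optimize_cost pat n B) (fun m => [/\ prepared m, m (sc vU) = 0 & optimal (arr vX m)]).
Proof.
apply: hoare_eq => m [/initialized_prepared[prep xE _ mU] /bad_total_le0 ok].
have [loE hiE] := prepared_arr prep.
have [bm inp mL [_ _ _ _ cE]] := prep.
have mn : m 0 = n%:Z by rewrite (inp 0%N) mi0.
have xb := x_mx_in_box ok.
apply: hoare_weaken (hoare_optimize patK pat_small n_gt0 mn mL L_gt0 bm _ BL BP _ _ _) => //.
- move=> m' [kp bm']; rewrite loE hiE cE xE => bx kx opt; split.
  * by apply: (prepared_keeps kp) prep => // a q; sel.
  * by rewrite (keeps_loc kp).
  * by split=> // y byy ky; rewrite -subr_le0 opt.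
- exact: ltnW.
- by rewrite loE hiE xE.
- by rewrite loE hiE.
- by rewrite loE hiE cE xE => y byy _; exact: gapL.
Qed.

Definition slack_sum (x : point) : int := \sum_(q < n) \sum_i x (rshift t i) q * x (rshift t i) q.

Lemma slack_sum0 x : slack_sum x <= 0 -> forall i q, x (rshift t i) q = 0.
Proof.
move=> le i q; have sq (a : int) : 0 <= a * a by nia.
have : x (rshift t i) q * x (rshift t i) q <= 0.
  apply: le_trans le; rewrite /slack_sum (bigD1 q) //= (bigD1 i) //= -addrA lerDl addr_ge0 //.
    by apply: sumr_ge0.
  by apply: sumr_ge0 => q' _; apply: sumr_ge0.
by move: (x _ _) => a; nia.
Qed.

Lemma slack_sum_gt0 x : 0 < slack_sum x -> exists i q, x (rshift t i) q <> 0.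
Proof.
move=> gt0; apply: contrapT => no; move: gt0; rewrite /slack_sum big1 ?ltxx // => q _.
rewrite big1 // => i _; have -> : x (rshift t i) q = 0; last by rewrite mulr0.
by apply: contrapT => nz; apply: no; exists i, q.
Qed.

(** The sum of squares of the slacks tells whether they all vanish. *)
Definition measured (m : memory) : Prop :=
  exists m', [/\ prepared m', optimal (arr vX m'), bounded B m, keeps K (selA vU) m' m &
     m (sc vU) = slack_sum (arr vX m')].

Lemma arr_slack m (i : 'I_(r + s)) (q : 'I_n) :
  arr vX m (rshift t i) q = m (loc K (vX + t + i) q).
Proof. by rewrite mxE /= addnA. Qed.

Lemma hoare_solve_measure :
  hoare (fun m => [/\ prepared m, m (sc vU) = 0 & optimal (arr vX m)])
    (for_loop tx eN (add_up tx vU eslack_squares))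
    (for_cost tx B n eN (add_up tx vU eslack_squares)) measured.
Proof.
apply: hoare_eq => m1 [prep mU opt].
have [bm inp mL _] := prep; have [/in_boxE[_ bs] _ _] := opt.
pose f q (i : 'I_(r + s)) := m1 (loc K (vX + t + i) q).
have fP q i : (q < n)%N -> slack_lo q i <= f q i <= slack_hi q i.
  by move=> qn; have := bs i (Ordinal qn); rewrite arr_slack.
apply: hoare_weaken (@hoare_array_add_up tx n vU eslack_squares eN
  (fun q => \sum_i f q i * f q i) B m1 _ _ bm nB _ _) => //.
- move=> m [bm' kp mU']; exists m1; split=> //; rewrite mU' mU add0r /slack_sum.
  by apply: eq_bigr => q _; apply: eq_bigr => i _; rewrite arr_slack.
- by move=> k kn; rewrite mU add0r slackB.
- move=> q m mQ kp; split.
    by rewrite -[eval m eN]/(m 0) (keeps_Posz 0 kp) (inp 0%N) mi0.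
  move=> qn; rewrite eval_esum big_map big_enum /=; apply: eq_bigr => i _.
  rewrite -[LHS]/(eval m (ecell (vX + t) i) * eval m (ecell (vX + t) i)).
  have -> : eval m (ecell (vX + t) i) = f q i; last by [].
  rewrite -[LHS]/(m (eval m (eloc K (vX + t + i) (rd vQ)))) (@eval_eloc K m _ _ q) //.
  by rewrite (keeps_loc kp) //; have := ltn_ord i; sel.
Qed.

Definition relaxed (m : memory) (x : point) : Prop :=
  [/\ bounded B m, inputs_kept m, m (sc vL) = L%:Z, arr vX m = x & arr (vC tx) m = c_mx] /\
  [/\ row_is (vLO tx + t) slack_lo m, row_is (vHI tx + t) slack_hi m,
      row_is (vLO tx) relaxed_lo m & row_is (vHI tx) relaxed_hi m].

Definition settled (x : point) (m : memory) : Prop :=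
  exists S, [/\ bounded B m, m 0 = n%:Z, m (sc vS) = S &
    progress Ax1 Ax2 pat lo_mx' hi_mx' c_mx x 1 (fun _ _ k => (2 ^ k <= L)%N) (arr vX m) S].

Lemma hoare_relax_lo x :
  hoare (fun m => prepared m /\ arr vX m = x)
    (row_loop tx (vLO tx) erelax_lo) (row_cost tx B n (vLO tx) erelax_lo)
    (fun m => [/\ bounded B m, inputs_kept m, m (sc vL) = L%:Z, arr vX m = x & arr (vC tx) m = c_mx]
      /\ [/\ row_is (vLO tx + t) slack_lo m, row_is (vHI tx + t) slack_hi m,
             row_is (vLO tx) relaxed_lo m & row_is (vHI tx) hi_val m]).
Proof.
apply: hoare_eq => m1 [[bm inp mL [l1 l2 h1 h2 c1]] xE].
have m1n : m1 0 = n%:Z by rewrite (inp 0%N) mi0.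
apply: hoare_weaken (hoare_array_row (val := relaxed_lo) _ _ m1n bm nB _ _) => //.
- move=> m [bm' kp vals]; split; split=> //.
  + exact: inputs_keeps kp inp.
  + by rewrite (keeps_loc kp).
  + by rewrite -xE; apply: (arr_keeps kp) => // [|a q h _]; [sel|move: h; sel].
  + by rewrite -c1; apply: (arr_keeps kp) => // [|a q h _]; [sel|move: h; sel].
  + by apply: (row_is_keeps kp) l2; [sel|move=> a q h; move: h; sel].
  + by apply: (row_is_keeps kp) h2; [sel|move=> a q h; move: h; sel].
  + by apply: (row_is_keeps kp) h1; [sel|move=> a q h; move: h; sel].
- by sel.
- move=> q i m qn mQ kp own.
  rewrite -[LHS]/(m (eval m (eloc K (vLO tx + i) (rd vQ))) -
    D%:Z * (eval m (eltag r s t i) * eval m (eltag r s t i))).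
  rewrite (@eval_eloc K m _ _ q) // own l1 // (eval_eltag n mQ) (keeps_Posz _ kp) inp.
  by [].
Qed.

Lemma hoare_relax_hi x :
  hoare (fun m => [/\ bounded B m, inputs_kept m, m (sc vL) = L%:Z, arr vX m = x & arr (vC tx) m = c_mx]
      /\ [/\ row_is (vLO tx + t) slack_lo m, row_is (vHI tx + t) slack_hi m,
             row_is (vLO tx) relaxed_lo m & row_is (vHI tx) hi_val m])
    (row_loop tx (vHI tx) erelax_hi) (row_cost tx B n (vHI tx) erelax_hi)
    (fun m => relaxed m x).
Proof.
apply: hoare_eq => m1 [[bm inp mL xE c1] [l2 h2 l1 h1]].
have m1n : m1 0 = n%:Z by rewrite (inp 0%N) mi0.
apply: hoare_weaken (hoare_array_row (val := relaxed_hi) _ _ m1n bm nB _ _) => //.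
- move=> m [bm' kp vals]; split; split=> //.
  + exact: inputs_keeps kp inp.
  + by rewrite (keeps_loc kp).
  + by rewrite -xE; apply: (arr_keeps kp) => // [|a q h _]; [sel|move: h; sel].
  + by rewrite -c1; apply: (arr_keeps kp) => // [|a q h _]; [sel|move: h; sel].
  + by apply: (row_is_keeps kp) l2; [sel|move=> a q h; move: h; sel].
  + by apply: (row_is_keeps kp) h2; [sel|move=> a q h; move: h; sel].
  + by apply: (row_is_keeps kp) l1; [sel|move=> a q h; move: h; sel].
- by sel.
- move=> q i m qn mQ kp own.
  have mn : m 0 = n%:Z by rewrite (keeps_Posz 0 kp).
  rewrite -[LHS]/(m (eval m (eloc K (vHI tx + i) (rd vQ))) +
    D%:Z * (eval m (eutag r s t i) * eval m (eutag r s t i))).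
  rewrite (@eval_eloc K m _ _ q) // own h1 // (eval_eutag mn mQ) (keeps_Posz _ kp) inp.
  by [].
Qed.

Lemma hoare_final_sweep x : optimal x ->
  hoare (fun m => relaxed m x)
    (Defs.Seq (writes [:: assign vd (Const 1)]) (sweep pat))
    (writes_cost [:: assign vd (Const 1)] * B + sweep_cost pat n B) (settled x).
Proof.
move=> [bx _ _].
apply: hoare_seq (_ : hoare _ _ _ (fun m => relaxed m x /\ m (sc vd) = 1)) _.
  apply: hoare_writes => m rel; split; first by case: rel => -[].
  rewrite -[run _ _]/(update m (sc vd) 1); split; last by rewrite sc_update.
  have kp : keeps K (fun a q => (a == vd) && (q == 0%N)) m (update m (sc vd) 1).
    exact: keeps_update.
  case: rel => [[bm inp mL xE c1] [l2 h2 l1 h1]]; split; split.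
  + by apply: bounded_update => //; exact: ltnW.
  + exact: inputs_keeps kp inp.
  + by rewrite (keeps_loc kp).
  + by rewrite -xE; apply: (arr_keeps kp) => // [|a q h _]; [sel|move: h; sel].
  + by rewrite -c1; apply: (arr_keeps kp) => // [|a q h _]; [sel|move: h; sel].
  + by apply: (row_is_keeps kp) l2; [sel|move=> a q h; move: h; sel].
  + by apply: (row_is_keeps kp) h2; [sel|move=> a q h; move: h; sel].
  + by apply: (row_is_keeps kp) l1; [sel|move=> a q h; move: h; sel].
  + by apply: (row_is_keeps kp) h1; [sel|move=> a q h; move: h; sel].
apply: hoare_eq => m [[[bm inp mL xE c1] [l2 h2 l1 h1]] md].
have mn : m 0 = n%:Z by rewrite (inp 0%N) mi0.
have loE : arr (vLO tx) m = lo_mx' by exact: row_is_join.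
have hiE : arr (vHI tx) m = hi_mx' by exact: row_is_join.
have bx' : in_box lo_mx' hi_mx' x.
  have [h3 h4] := (in_boxE _ _ _ _ _).1 bx; apply/in_boxE; split=> // j q.
  have := h3 j q; rewrite /relaxed_lo /relaxed_hi.
  move: (x _ _) (lo_val q j) (hi_val q j) (mi _) (mi _) => a b c d e.
  have := mulr_ge0 (isT : 0 <= D%:Z) (sqr_ge0 d); have := mulr_ge0 (isT : 0 <= D%:Z) (sqr_ge0 e).
  by rewrite !expr2; lia.
have B2' : (2 <= B)%N by exact: ltnW.
have BC' : (bits (n ^ C)%N <= B)%N by exact: BC BP.
apply: hoare_weaken (hoare_sweep patK n_gt0 mn mL md (ltr01 : 0 < 1 :> int) L_gt0 bm B2' BL BC' _) => //.
  rewrite loE hiE c1 xE => m' [kp bm' prog]; exists (m' (sc vS)); split=> //.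
  by rewrite (keeps_Posz 0 kp).
by rewrite loE hiE xE.
Qed.

Lemma hoare_output x : hoare (settled x)
  (for_loop tx eN (row_writes eout_addr eout)) (for_cost tx B n eN (row_writes eout_addr eout))
  (fun m => exists y S, [/\ bounded B m, m (sc vS) = S,
    progress Ax1 Ax2 pat lo_mx' hi_mx' c_mx x 1 (fun _ _ k => (2 ^ k <= L)%N) y S &
    forall (q : 'I_n) (j : 'I_t), m (1 + (q * t + j))%N%:Z = y (lshift (r + s) j) q]).
Proof.
apply: hoare_eq => m1 [S [bm m1n mS prog]].
pose addr q (j : 'I_t) : int := (1 + (q * t + j))%N%:Z.
pose val q (j : 'I_t) := m1 (loc K (vX + j) q).
apply: hoare_weaken (hoare_row_loop (t := tx) (n := n) (addr := addr) (val := val)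
  m1n bm nB _ _ _ _ _) => //.
- move=> m [bm' vals frame]; exists (arr vX m1), S; split=> //.
    by rewrite frame // => /eqP; rewrite loc_eq.
  by move=> q j; rewrite -[LHS]/(m (addr q j)) vals // mxE.
- move=> q q' i i' _ _ [e]; have i_lt := ltn_ord i; have i'_lt := ltn_ord i'.
  have t0 : (0 < t)%N by apply: leq_ltn_trans i_lt.
  have qE : q = q'.
    by have := congr1 (fun a => a %/ t)%N e; rewrite !divnMDl // !divn_small // !addn0.
  by split=> //; apply: val_inj; move: e; rewrite qE => /addnI/addnI.
- by move=> q i _; exact: bm.
- move=> q i m qn mQ frame; split.
    by rewrite -[LHS]/(1 + (m (sc vQ) * t%:Z + i%:Z)) mQ /addr; lia.
  rewrite -[LHS]/(m (eval m (eloc K (vX + i) (rd vQ)))) (@eval_eloc K m _ _ q) // frame //.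
  by move/eqP; rewrite loc_eq //; have := ltn_ord i; sel.
Qed.

Definition finish_cost : nat :=
  (row_cost tx B n (vLO tx) erelax_lo + (row_cost tx B n (vHI tx) erelax_hi +
   (writes_cost [:: assign vd (Const 1)] * B + sweep_cost pat n B +
   (for_cost tx B n eN (row_writes eout_addr eout) + (writes_cost (verdict (rd vS)) * B + 1)))))%N.

Lemma hoare_finish x : optimal x -> (forall i q, x (rshift t i) q = 0) ->
  hoare (fun m => prepared m /\ arr vX m = x) finish finish_cost outcome.
Proof.
move=> opt slack0.
apply: (hoare_seq (@hoare_relax_lo x)).
apply: (hoare_seq (@hoare_relax_hi x)).
apply: (hoare_seq (hoare_final_sweep opt)).
apply: (hoare_seq (@hoare_output x)).
apply: (@hoare_seq _ outcome).
  apply: hoare_writes => m [y [S [bm mS prog out]]]; split=> //.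
  rewrite -[run _ _]/(update m 0 (m (sc vS))) mS.
  right; exists x; case: opt => bx kx opt; split=> //; right; split=> //.
  rewrite /update eqxx; case: prog => [by_ ky [[S0 yx no]|[S1 le]]]; last first.
    by left; split=> //; exists y.
  right; split=> // [tau b|q j]; last by rewrite out yx.
  by have := no tau b 0%N; rewrite expn0; apply.
by move=> m om; exists m, 1%N; split=> //; constructor.
Qed.

Definition solve_cost : nat :=
  (optimize_cost pat n B + (for_cost tx B n eN (add_up tx vU eslack_squares) +
   (guard_cost (rd vU) * B + (writes_cost (verdict (Const 2)) * B + finish_cost))))%N.

Definition main_cost : nat :=
  (init_cost A1 A2 cst e1 e2 e3 n B +
    (guard_cost (rd vB) * B + (writes_cost (verdict (Const 2)) * B + solve_cost)))%N.

Lemma hoare_verdict2 (Q : memory -> Prop) :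
  (forall m, Q m -> bounded B m) ->
  (forall m, Q m -> outcome (update m 0 2)) ->
  hoare Q (writes (verdict (Const 2))) (writes_cost (verdict (Const 2)) * B) outcome.
Proof. by move=> bQ oQ; apply: hoare_writes => m Qm; split; [exact: bQ|exact: oQ]. Qed.

Lemma hoare_solve_box : hoare (fun m => initialized m /\ bad_total <= 0) solve_box solve_cost outcome.
Proof.
apply: (hoare_seq hoare_solve_optimize).
apply: (hoare_seq hoare_solve_measure).
apply: hoare_if.
- by move=> m [m' []].
- apply: hoare_weaken (hoare_verdict2 (Q := fun m => measured m /\ 0 < m (sc vU)) _ _) => //.
  + exact: leq_addr.
  + by move=> m [[m' []]].
  + move=> m [[m' [_ [bx kx opt] _ _ mU]] U0]; right; exists (arr vX m'); split=> //.
    by left; split=> //; apply: slack_sum_gt0; rewrite -mU.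
- move=> m [[m' [prep opt bm kp mU]] U0].
  have slack0 : forall i q, arr vX m' (rshift t i) q = 0 by apply: slack_sum0; rewrite -mU.
  have prep' : prepared m /\ arr vX m = arr vX m'.
    split; last by apply: (arr_keeps kp) => // [|a q h _]; [sel|move: h; sel].
    by apply: (prepared_keeps kp) prep => // a q; sel.
  have [m2 [k2 [ex le out]]] := hoare_finish opt slack0 prep'.
  by exists m2, k2; split=> //; apply: leq_trans le (leq_addl _ _).
Qed.

Lemma hoare_main : hoare (fun m => m = mi) main main_cost outcome.
Proof.
apply: (hoare_seq init_ok).
apply: hoare_if.
- by move=> m /initialized_prepared[[]].
- apply: hoare_weaken (hoare_verdict2 (Q := fun m => initialized m /\ 0 < m (sc vB)) _ _) => //.
  + exact: leq_addr.
  + by move=> m [/initialized_prepared[[]]].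
  + move=> m [/initialized_prepared[_ _ mB _] B0]; left; split=> //.
    by apply: bad_total_gt0; rewrite -mB.
- apply: hoare_weaken hoare_solve_box; last exact: leq_addl.
    by move=> m [im B0]; split=> //; have [_ _ <- _] := initialized_prepared im.
  by [].
Qed.
End Main.

(** * Soundness of the truncated program with slack variables *)

Section Correctness.
Local Open Scope ring_scope.

Variables (r s t : nat) (A1 : 'M[int]_(r, t)) (A2 : 'M[int]_(s, t)).
Notation tx := (t + (r + s))%N.

(** The slacks of all equations are added to every brick as [r + s] new entries. *)
Definition slack_A1 : 'M[int]_(r, tx) := row_mx A1 (row_mx 1%:M 0).
Definition slack_A2 : 'M[int]_(s, tx) := row_mx A2 (row_mx 0 1%:M).

Definition clip_lo (O : int) (z : \bar int) : int :=
  match z with EFin a => a | +oo%E => O + 2 | -oo%E => - O end.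
Definition clip_hi (O : int) (z : \bar int) : int :=
  match z with EFin a => a | +oo%E => O | -oo%E => - O - 2 end.

Definition finite_le (R : int) (z : \bar int) : Prop := forall a, z = a%:E -> `|a| <= R.

Variable n : nat.
Notation point := 'M[int]_(tx, n).
Notation lx := (@lshift t (r + s)).
Notation sx := (@rshift t (r + s)).

Variables (b1 : 'cV[int]_r) (b2 : 'M[int]_(s, n)).

Definition balanced (z : point) : Prop :=
  slack_A2 *m z = b2 /\ slack_A1 *m (z *m const_mx 1) = b1.

Lemma balanced_kernel z z' : balanced z -> balanced z' -> in_kernel slack_A1 slack_A2 (z - z').
Proof.
by move=> [h2 h1] [h2' h1']; split; rewrite ?mulmxBl !mulmxBr ?h2 ?h2' ?h1 ?h1' subrr.
Qed.

Lemma kernel_balanced z z' : balanced z' -> in_kernel slack_A1 slack_A2 (z - z') -> balanced z.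
Proof.
move=> [h2 h1] []; rewrite mulmxBl !mulmxBr h2 h1 => /eqP; rewrite subr_eq0 => /eqP e2.
by move/eqP; rewrite subr_eq0 => /eqP e1; split.
Qed.

Variables (l u : 'I_t -> 'I_n -> \bar int) (w : 'I_t -> 'I_n -> int).

Definition feasible (z : point) : Prop :=
  balanced z /\ (forall i q, z (sx i) q = 0) /\
  (forall j q, (l j q <= (z (lx j) q)%:E <= u j q)%E).

Definition is_slack : pred 'I_tx := fun j => if split j is inr _ then true else false.

Lemma is_slack_lx j : is_slack (lx j) = false.
Proof. by rewrite /is_slack; have -> : split (lx j) = inl j by exact: (unsplitK (inl j)). Qed.

Lemma is_slack_sx i : is_slack (sx i) = true.
Proof. by rewrite /is_slack; have -> : split (sx i) = inr i by exact: (unsplitK (inr i)). Qed.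

Definition on_x (T : Type) (x0 : T) (f : 'I_t -> 'I_n -> T) (j : 'I_tx) (q : 'I_n) : T :=
  if split j is inl j' then f j' q else x0.

Lemma on_x_lx T (x0 : T) f j q : on_x x0 f (lx j) q = f j q.
Proof. by rewrite /on_x; have -> : split (lx j) = inl j by exact: (unsplitK (inl j)). Qed.

Lemma on_x_sx T (x0 : T) f i q : on_x x0 f (sx i) q = x0.
Proof. by rewrite /on_x; have -> : split (sx i) = inr i by exact: (unsplitK (inr i)). Qed.

Definition w_mx : point := \matrix_(j, q) on_x 0 w j q.

Lemma ord_split (P : 'I_tx -> Prop) : (forall j, P (lx j)) -> (forall i, P (sx i)) -> forall j, P j.
Proof. by move=> h1 h2 j; rewrite -[j]splitK; case: (split j) => ? /=. Qed.

Lemma dot_split (c z : point) : dot c z =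
  \sum_j \sum_q c (lx j) q * z (lx j) q + \sum_i \sum_q c (sx i) q * z (sx i) q.
Proof. by rewrite /dot big_split_ord. Qed.

Lemma dot_w z : dot w_mx z = \sum_j \sum_q w j q * z (lx j) q.
Proof.
rewrite dot_split [X in _ + X]big1 ?addr0 => [|i _].
  by apply: eq_bigr => j _; apply: eq_bigr => q _; rewrite mxE on_x_lx.
by apply: big1 => q _; rewrite mxE on_x_sx mul0r.
Qed.

Variables (C : nat) (T : finType) (pat : T -> 'I_C -> 'cV[int]_tx).
Hypothesis patK : forall tau n (b : 'I_C -> 'I_n),
  in_kernel slack_A1 slack_A2 (move (pat tau) b).
Hypothesis pat_small : forall n (h : 'M[int]_(tx, n)), in_kernel slack_A1 slack_A2 h -> h != 0 ->
  exists tau (b : {ffun 'I_C -> 'I_n}),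
    move (pat tau) b != 0 /\ conformal (move (pat tau) b) h.
Notation I := (T * {ffun 'I_C -> 'I_n})%type.

Variables (R O W Wb M D : int).
Hypotheses (R0 : 0 <= R) (M0 : 0 <= M) (RM : 2 * R <= M).
Hypothesis lR : forall j q, finite_le R (l j q).
Hypothesis uR : forall j q, finite_le R (u j q).
Hypothesis mvD : forall (i : I) j q, `|mv pat i j q| <= D.
Hypothesis RO : R + #|{: I}|%:Z * M * D <= O.

Variable z0 : point.
Hypothesis z0_balanced : balanced z0.
Hypothesis z0_slack : forall i q, `|z0 (sx i) q| <= M.
Hypothesis z0_x : forall j q, z0 (lx j) q =
  match l j q, u j q with EFin a, _ => a | _, EFin a => a | _, _ => 0 end.

Definition improving_ray (v : point) : Prop := exists i : I,
  recession is_slack (on_x 0%:E l) (on_x 0%:E u) (mv pat i) /\ dot v (mv pat i) < 0.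

Lemma feasible_near (v y : point) : feasible y -> ~ improving_ray v ->
  exists y', [/\ feasible y', dot v y' <= dot v y & forall j q, `|y' (lx j) q| <= O].
Proof.
move=> [yb [ys yb']] noray.
have [||||y' [yK yle yP yO]] := @proximity _ _ _ _ _ _ _ _ patK pat_small n is_slack (on_x 0%:E l)
  (on_x 0%:E u) v z0 y M D M0 mvD.
- move=> j q; elim/ord_split: j => [j|i]; last by rewrite is_slack_sx.
  rewrite is_slack_lx !on_x_lx z0_x; have := yb' j q; have := @lR j q; have := @uR j q.
  rewrite /finite_le; case: (l j q) => [a||] //=; case: (u j q) => [b||] //= hu hl;
    rewrite ?leey ?leNye ?lee_fin ?andbF ?andbT ?lexx //=.
  + have := hl a erefl; have := hu b erefl => hb ha /andP[ay yb1]; split=> //.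
    * exact: le_trans ay yb1.
    * by move=> c [<-]; lia.
    * by move=> c [<-]; lia.
  + have := hl a erefl => ha _; split=> // c [<-]; lia.
  + have := hu b erefl => hb _; split=> // c [<-]; lia.
- by move=> i rec; rewrite leNgt; apply/negP => lt; apply: noray; exists i.
- exact: balanced_kernel.
- move=> j q; elim/ord_split: j => [j|i]; first by rewrite is_slack_lx !on_x_lx.
  by rewrite is_slack_sx.
exists y'; split=> //.
  split; first exact: kernel_balanced yK.
  split=> [i q|j q]; first by have := yP (sx i) q; rewrite is_slack_sx.
  by have := yP (lx j) q; rewrite is_slack_lx !on_x_lx.
move=> j q; apply: le_trans RO; have := yO (lx j) q.
have : `|z0 (lx j) q| <= R.
  rewrite z0_x; have := @lR j q; have := @uR j q; rewrite /finite_le.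
  case: (l j q) => [a||]; case: (u j q) => [b||] hu hl; rewrite ?normr0 //;
    by [exact: hl|exact: hu].
by move: (z0 _ _) (y' _ _) => a b; lia.
Qed.

Variables (lo hi lo' hi' c x0 : point) (res : 'I_(r + s) -> 'I_n -> int).
Hypothesis lo_x : forall j q, lo (lx j) q = clip_lo O (l j q).
Hypothesis hi_x : forall j q, hi (lx j) q = clip_hi O (u j q).
Hypothesis lo'_x : forall j q, l j q <> +oo%E -> lo' (lx j) q = clip_lo (O + D) (l j q).
Hypothesis hi'_x : forall j q, u j q <> -oo%E -> hi' (lx j) q = clip_hi (O + D) (u j q).
Hypothesis lo_s : forall i q, lo (sx i) q = Num.min (res i q) 0.
Hypothesis hi_s : forall i q, hi (sx i) q = Num.max (res i q) 0.
Hypothesis lo'_s : forall i q, lo' (sx i) q = Num.min (res i q) 0.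
Hypothesis hi'_s : forall i q, hi' (sx i) q = Num.max (res i q) 0.
Hypothesis c_x : forall j q, c (lx j) q = w j q.
Hypothesis c_s : forall i q, c (sx i) q = W * res i q.
Hypothesis x0_balanced : balanced x0.
Hypotheses (D0 : 0 <= D) (O0 : 0 <= O) (RO' : R <= O).
Hypothesis wB : forall z, in_box lo' hi' z -> `|dot w_mx z| <= Wb.
Hypothesis WB : 2 * Wb < W.

Lemma slack_term (a b : int) : Num.min a 0 <= b <= Num.max a 0 -> 0 <= a * b /\ (b <> 0 -> 1 <= a * b).
Proof. by move=> h; split=> [|b0]; nia. Qed.

Section Cost.
Variable z : point.
Hypothesis zs : forall i q, Num.min (res i q) 0 <= z (sx i) q <= Num.max (res i q) 0.

Lemma dot_c_slack0 : (forall i q, z (sx i) q = 0) -> dot c z = dot w_mx z.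
Proof.
move=> s0; rewrite dot_w dot_split [X in _ + X]big1 ?addr0 => [|i _].
  by apply: eq_bigr => j _; apply: eq_bigr => q _; rewrite c_x.
by apply: big1 => q _; rewrite s0 mulr0.
Qed.

(** A slack has the sign of its residue, so the costs of the slacks do not compensate each
    other, and the product of a nonzero slack by its residue is at least 1. *)
Lemma dot_c_slack : 0 <= W -> (exists i q, z (sx i) q <> 0) -> dot w_mx z + W <= dot c z.
Proof.
move=> W0 [i [q nz]]; rewrite dot_w dot_split; apply: lerD.
  by rewrite le_eqVlt; apply/orP; left; apply/eqP; apply: eq_bigr => j _;
    apply: eq_bigr => q' _; rewrite c_x.
have term i' q' : 0 <= c (sx i') q' * z (sx i') q'.
  by rewrite c_s -mulrA mulr_ge0 //; case: (slack_term (zs i' q')).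
rewrite (bigD1 i) //= (bigD1 q) //= -addrA -[leLHS]addr0 lerD //.
  by rewrite c_s -mulrA; have [_ /(_ nz)] := slack_term (zs i q);
    move: (res i q * _) => a; nia.
by apply: addr_ge0; apply: sumr_ge0 => ? _ //; apply: sumr_ge0.
Qed.

End Cost.

Lemma feasible_bounds y j q : feasible y -> l j q <> +oo%E /\ u j q <> -oo%E.
Proof.
move=> [_ [_ /(_ j q)]]; case: (l j q) => [a||]; case: (u j q) => [b||] //=;
  by rewrite ?leye_eq ?leeNy_eq ?andbF.
Qed.

Lemma feasible_in_box y : feasible y -> (forall j q, `|y (lx j) q| <= O) -> in_box lo hi y.
Proof.
move=> fy yO; have [_ [ys yb]] := fy; apply/in_boxP=> j q; elim/ord_split: j => [j|i].
  rewrite lo_x hi_x; have [] := feasible_bounds j q fy; have := yb j q; have := yO j q.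
  case: (l j q) => [a||] //=; case: (u j q) => [b||] //=; rewrite ?lee_fin ?leey ?leNye ?andbT /=;
    by move: (y _ _) => x; lia.
by rewrite lo_s hi_s ys; move: (res i q) => x; lia.
Qed.

Lemma feasible_in_kernel y : feasible y -> in_kernel slack_A1 slack_A2 (y - x0).
Proof. by move=> [yb _]; exact: balanced_kernel. Qed.

Lemma violation_infeasible j q : hi (lx j) q < lo (lx j) q -> forall y, ~ feasible y.
Proof.
move=> lt y fy; move: lt; rewrite hi_x lo_x; have [] := feasible_bounds j q fy.
have [_ [_ /(_ j q)]] := fy; have := @lR j q; have := @uR j q; rewrite /finite_le.
case: (l j q) => [a||] //=; case: (u j q) => [b||] //= hu hl; rewrite ?lee_fin ?leey ?leNye ?andbT /=.
- by move: (y _ _) => x; lia.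
- by have := hl a erefl; lia.
- by have := hu b erefl; lia.
- by lia.
Qed.

Section Consistent.
Variable x : point.
Hypothesis xB : in_box lo hi x.
Hypothesis xK : in_kernel slack_A1 slack_A2 (x - x0).
Hypothesis xopt : forall y, in_box lo hi y -> in_kernel slack_A1 slack_A2 (y - x0) ->
  dot c x <= dot c y.

Lemma box_bounds j q : l j q <> +oo%E /\ u j q <> -oo%E.
Proof.
have /in_boxP/(_ (lx j) q) := xB; rewrite lo_x hi_x; have := @lR j q; have := @uR j q.
rewrite /finite_le; case: (l j q) => [a||]; case: (u j q) => [b||] //= hu hl.
- by have := hl a erefl; lia.
- by have := hu b erefl; lia.
- by lia.
- by lia.
- by lia.
Qed.

Lemma relaxed_bounds y j q : in_box lo' hi' y -> (l j q <= (y (lx j) q)%:E <= u j q)%E.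
Proof.
move=> /in_boxP/(_ (lx j) q); have [lf uf] := box_bounds j q; rewrite lo'_x // hi'_x //.
case: (l j q) lf => [a||] //= _; case: (u j q) uf => [b||] //= _;
  by rewrite ?lee_fin ?leey ?leNye ?andbT //= => /andP[].
Qed.

Lemma box_relaxed y : in_box lo hi y -> in_box lo' hi' y.
Proof.
move=> /in_boxP yB; apply/in_boxP=> j q; have := yB j q; elim/ord_split: j => [j|i].
  have [lf uf] := box_bounds j q; rewrite lo_x hi_x lo'_x // hi'_x //.
  case: (l j q) lf => [a||] //= _; case: (u j q) uf => [b||] //= _;
    by move: (y _ _) => x'; lia.
by rewrite lo_s hi_s lo'_s hi'_s.
Qed.

Lemma relaxed_slack y : in_box lo' hi' y ->
  forall i q, Num.min (res i q) 0 <= y (sx i) q <= Num.max (res i q) 0.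
Proof. by move=> /in_boxP yB i q; have := yB (sx i) q; rewrite lo'_s hi'_s. Qed.

Lemma relaxed_feasible y : in_box lo' hi' y -> in_kernel slack_A1 slack_A2 (y - x0) ->
  (forall i q, y (sx i) q = 0) -> feasible y.
Proof.
move=> yB yK ys; split; first exact: kernel_balanced yK.
by split=> // j q; exact: relaxed_bounds.
Qed.

Lemma W0 : 0 <= W.
Proof. by have := wB (box_relaxed xB); move: WB; lia. Qed.

(** A point that is no more expensive than points without slack has no slack, since a slack
    costs more than the variation of the objective over the box. *)
Lemma relaxed_cheap y : in_box lo' hi' y -> dot c y <= Wb -> forall i q, y (sx i) q = 0.
Proof.
move=> yB le i q; apply: contrapT => nz.
have := dot_c_slack (relaxed_slack yB) W0 (ex_intro _ i (ex_intro _ q nz)).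
by have := wB yB; move: le WB; move: (dot c y) (dot w_mx y) => a b; lia.
Qed.

(** A feasible point would have, near the reference point, a feasible point in the box, for
    the objective 0 that has no improving ray. *)
Lemma slack_infeasible : (exists i q, x (sx i) q <> 0) -> forall y, ~ feasible y.
Proof.
move=> [i [q nz]] y fy; have [|y' [fy' _ y'O]] := feasible_near (v := 0) fy.
  by move=> [k [_]]; rewrite /dot big1 ?ltxx // => j _; rewrite big1 // => p _; rewrite mxE mul0r.
have yB := feasible_in_box fy' y'O; have [_ [ys _]] := fy'.
apply: nz; apply: relaxed_cheap; first exact: box_relaxed.
apply: le_trans (xopt yB (feasible_in_kernel fy')) _.
rewrite (dot_c_slack0 ys); apply: le_trans (ler_norm _) _; apply: wB; exact: box_relaxed.
Qed.

Hypothesis xs : forall i q, x (sx i) q = 0.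

Lemma x_feasible : feasible x.
Proof. by apply: relaxed_feasible => //; exact: box_relaxed. Qed.

Lemma dot_c_x : dot c x <= Wb.
Proof.
by rewrite dot_c_slack0 //; apply: le_trans (ler_norm _) _; apply/wB/box_relaxed.
Qed.

Lemma ray_feasible (i : I) y k :
  recession is_slack (on_x 0%:E l) (on_x 0%:E u) (mv pat i) -> feasible y ->
  feasible (y + mv pat i *+ k).
Proof.
move=> rec fy; have [yb [ys yb']] := fy; split.
  apply: kernel_balanced yb _; rewrite addrAC subrr add0r.
  by apply: in_kernelMn; exact: patK.
split=> [i' q|j q]; rewrite !mxE mulrn_mxE.
  by have := rec (sx i') q; rewrite is_slack_sx ys => ->; rewrite mul0rn addr0.
have := rec (lx j) q; rewrite is_slack_lx !on_x_lx mulrn_intE => -[hu hl].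
have := yb' j q; have [lf uf] := feasible_bounds j q fy.
have [g0|g0|g0] := ltrgt0P (mv pat i (lx j) q).
- rewrite (hu g0) !leey !andbT; case: (l j q) lf => [a||] // _; rewrite ?leNye //.
  by rewrite !lee_fin; move: (y _ _) (mv _ _ _ _) g0 => a' b; nia.
- rewrite (hl g0) !leNye /=; case: (u j q) uf => [a||] // _; rewrite ?leey //.
  by rewrite !lee_fin; move: (y _ _) (mv _ _ _ _) g0 => a' b; nia.
- by rewrite ?g0 ?mul0r ?addr0.
Qed.

(** Without an improving ray, [x'] would have a feasible point of the box that is as good,
    against the optimality of [x]. *)
Lemma improvement_unbounded x' : in_box lo' hi' x' -> in_kernel slack_A1 slack_A2 (x' - x) ->
  dot c x' <= dot c x - 1 ->
  exists2 g : point, dot w_mx g < 0 & forall k, feasible (x + g *+ k).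
Proof.
move=> x'B x'K lt.
have x's : forall i q, x' (sx i) q = 0.
  by apply: relaxed_cheap => //; move: lt dot_c_x; move: (dot c x') (dot c x) => a b; lia.
have x'K0 : in_kernel slack_A1 slack_A2 (x' - x0).
  by rewrite -(subrK x x') -addrA; apply: in_kernelD.
have fx' := relaxed_feasible x'B x'K0 x's.
have [[i [rec neg]]|noray] := pselect (improving_ray w_mx).
  by exists (mv pat i) => // k; apply: ray_feasible => //; exact: x_feasible.
have [y' [fy' le y'O]] := feasible_near fx' noray.
have := xopt (feasible_in_box fy' y'O) (feasible_in_kernel fy').
have [_ [y's _]] := fy'; rewrite (dot_c_slack0 y's).
move: lt le; rewrite (dot_c_slack0 x's).
by move: (dot w_mx x') (dot w_mx y') (dot c x) => a b d; lia.
Qed.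

(** An improving ray would be an acceptable move, because the relaxed box leaves room for one
    step from [x] on every side that is infinite. *)
Lemma no_improvement_optimal :
  (forall tau (b : {ffun 'I_C -> 'I_n}), ~~ acceptable lo' hi' c x 1 1 (move (pat tau) b)) ->
  forall y, feasible y -> dot w_mx x <= dot w_mx y.
Proof.
move=> no y fy.
have noray : ~ improving_ray w_mx.
  move=> [i [rec neg]]; have := no i.1 i.2; rewrite -/(mv pat i) /acceptable scale1r.
  have gs i' q : mv pat i (sx i') q = 0 by have := rec (sx i') q; rewrite is_slack_sx.
  rewrite (dot_c_slack0 gs) => /negP; apply; apply/andP; split; first by lia.
  apply/in_boxP=> j q; have /in_boxP/(_ j q) := box_relaxed xB; elim/ord_split: j => [j|i'].
    have [lf uf] := box_bounds j q; have /in_boxP/(_ (lx j) q) := xB.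
    rewrite lo_x hi_x lo'_x // hi'_x // mxE.
    have := rec (lx j) q; rewrite is_slack_lx !on_x_lx => -[hu hl].
    have := mvD i (lx j) q; move: hu hl lf uf.
    move: (mv pat i (lx j) q) (x (lx j) q) => g a.
    have gu (e : int) : (0 < g -> e%:E = +oo%E) -> g <= 0.
      by move=> h; rewrite leNgt; apply/negP => /h.
    have gl (e : int) : (g < 0 -> e%:E = -oo%E) -> 0 <= g.
      by move=> h; rewrite leNgt; apply/negP => /h.
    case: (l j q) => [b||] //=; case: (u j q) => [d||] //= hu hl _ _ gD.
    + by have := gu _ hu; have := gl _ hl; lia.
    + by have := gl _ hl; lia.
    + by have := gu _ hu; lia.
    + by lia.
  by rewrite mxE gs addr0.
have [y' [fy' le y'O]] := feasible_near fy noray.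
have := xopt (feasible_in_box fy' y'O) (feasible_in_kernel fy').
have [_ [y's _]] := fy'; rewrite (dot_c_slack0 y's) (dot_c_slack0 xs) => h.
exact: le_trans h le.
Qed.

End Consistent.

Lemma box_sound :
  ((exists j q, hi (lx j) q < lo (lx j) q) -> forall y, ~ feasible y) /\
  (forall x, in_box lo hi x -> in_kernel slack_A1 slack_A2 (x - x0) ->
     (forall y, in_box lo hi y -> in_kernel slack_A1 slack_A2 (y - x0) -> dot c x <= dot c y) ->
     ((exists i q, x (sx i) q <> 0) -> forall y, ~ feasible y) /\
     ((forall i q, x (sx i) q = 0) ->
        [/\ feasible x,
            forall x', in_box lo' hi' x' -> in_kernel slack_A1 slack_A2 (x' - x) ->
              dot c x' <= dot c x - 1 ->
              exists2 g : point, dot w_mx g < 0 & forall k, feasible (x + g *+ k) &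
            (forall tau (b : {ffun 'I_C -> 'I_n}),
               ~~ acceptable lo' hi' c x 1 1 (move (pat tau) b)) ->
            forall y, feasible y -> dot w_mx x <= dot w_mx y])).
Proof.
split=> [[j [q lt]] y|x xB xK xopt]; first exact: (violation_infeasible lt).
split=> [nz y|xs]; first by apply: (@slack_infeasible x).
split; first by apply: (@x_feasible x).
  by move=> x' x'B x'K le; apply: (@improvement_unbounded x) le.
by move=> no y fy; apply: (@no_improvement_optimal x).
Qed.

End Correctness.

(** * Bricks and the encoding of the input *)

Section NFold.
Local Open Scope ring_scope.

Variables (r s t : nat) (A : 'M[int]_(r + s, t)) (n : nat).
Notation tx := (t + (r + s))%N.
Notation A1 := (usubmx A).
Notation A2 := (dsubmx A).

Definition bricks (N : Type) (k : nat) (x : 'cV[N]_(n * k)) : 'M[N]_(k, n) :=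
  \matrix_(j, q) x (mxtens_index (q, j)) ord0.

Definition unbricks (k : nat) (X : 'M[int]_(k, n)) : 'cV[int]_(n * k) :=
  \col_i X (mxtens_unindex i).2 (mxtens_unindex i).1.

Lemma unbricksK k (X : 'M[int]_(k, n)) : bricks (unbricks X) = X.
Proof. by apply/matrixP=> j q; rewrite !mxE mxtens_indexK. Qed.

Lemma bricksK k (x : 'cV[int]_(n * k)) : unbricks (bricks x) = x.
Proof. by apply/colP=> i; rewrite !mxE -surjective_pairing mxtens_unindexK. Qed.

Lemma sum_bricks k (F : 'I_(n * k) -> int) :
  \sum_i F i = \sum_(q < n) \sum_(j < k) F (mxtens_index (q, j)).
Proof.
rewrite pair_big /= (reindex (@mxtens_index n k)) /=.
  by apply: eq_bigr => -[q j] _.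
by exists (@mxtens_unindex n k) => i _; rewrite (mxtens_indexK, mxtens_unindexK).
Qed.

Lemma nfold_eq (x : 'cV[int]_(n * t)) (b : 'cV[int]_(r + n * s)) :
  nfold A n *m x = b <->
  A2 *m bricks x = bricks (dsubmx b) /\ A1 *m (bricks x *m const_mx 1) = usubmx b.
Proof.
have -> : nfold A n *m x = b <->
    (\matrix_(i < r, j < n * t) A1 i (mxtens_unindex j).2) *m x = usubmx b /\
    tensmx (1%:M : 'M[int]_n) A2 *m x = dsubmx b.
  rewrite /nfold mul_col_mx -{1}[b]vsubmxK; split=> [/eq_col_mx[]//|[-> ->]//].
have top : (\matrix_(i < r, j < n * t) A1 i (mxtens_unindex j).2) *m x =
    A1 *m (bricks x *m const_mx 1).
  apply/matrixP=> i k; rewrite !mxE sum_bricks exchange_big; apply: eq_bigr => j _.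
  rewrite [(bricks x *m _) j k]mxE mulr_sumr; apply: eq_bigr => q _.
  by rewrite !mxE mxtens_indexK mulr1 (ord1 k).
have bot : bricks (tensmx (1%:M : 'M[int]_n) A2 *m x) = A2 *m bricks x.
  apply/matrixP=> i q; rewrite !mxE sum_bricks (bigD1 q) //= [X in _ + X]big1 ?addr0.
    by apply: eq_bigr => j _; rewrite !mxE !mxtens_indexK /= eqxx mul1r.
  move=> q' qq; rewrite big1 // => j _.
  by rewrite !mxE !mxtens_indexK /= eq_sym (negPf qq) !mul0r.
rewrite top -bot; split=> [[-> ->]//|[e1 ->]]; split=> //.
by rewrite -[LHS]bricksK e1 bricksK.
Qed.

(** The point with the entries [X] for the variables and the residues as slacks; those of the
    first block are put into the brick [q0]. *)
Definition completion (q0 : 'I_n) (b1 : 'cV[int]_r) (b2 : 'M[int]_(s, n))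
    (X : 'M[int]_(t, n)) : 'M[int]_(tx, n) :=
  col_mx X (col_mx (in_brick (b1 - A1 *m (X *m const_mx 1)) q0) (b2 - A2 *m X)).

Lemma balanced_col (b1 : 'cV[int]_r) b2 (X : 'M[int]_(t, n)) Y1 Y2 :
  balanced A1 A2 b1 b2 (col_mx X (col_mx Y1 Y2)) <->
  A2 *m X + Y2 = b2 /\ A1 *m (X *m const_mx 1) + Y1 *m const_mx 1 = b1.
Proof.
rewrite /balanced /slack_A1 /slack_A2 !mul_col_mx !mul_row_col.
by rewrite !mul1mx !mul0mx add0r addr0.
Qed.

Lemma completion_balanced q0 b1 b2 X : balanced A1 A2 b1 b2 (completion q0 b1 b2 X).
Proof.
apply/balanced_col; split; first by rewrite addrC subrK.
by rewrite brick_sum addrC subrK.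
Qed.

Definition embed (x : 'cV[int]_(n * t)) : 'M[int]_(tx, n) := col_mx (bricks x) 0.

Lemma embed_feasible (b : 'cV[int]_(r + n * s)) (l u : 'cV[\bar int]_(n * t)) x :
  feasible_set (nfold A n) b l u x <->
  feasible A1 A2 (usubmx b) (bricks (dsubmx b)) (bricks l) (bricks u) (embed x).
Proof.
have bal : balanced A1 A2 (usubmx b) (bricks (dsubmx b)) (embed x) <-> nfold A n *m x = b.
  have -> : embed x = col_mx (bricks x) (col_mx 0 0) by rewrite col_mx0.
  by rewrite balanced_col nfold_eq mul0mx !addr0.
rewrite /feasible_set /feasible /= bal; split=> [[eqs bd]|[eqs [_ bd]]]; split=> //.
  split=> [i q|j q]; first by rewrite col_mxEd mxE.
  by rewrite col_mxEu !mxE.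
move=> i; have := bd (mxtens_unindex i).2 (mxtens_unindex i).1.
by rewrite col_mxEu !mxE -surjective_pairing mxtens_unindexK.
Qed.

Lemma embed_unbricks (z : 'M[int]_(tx, n)) : (forall i q, z (rshift t i) q = 0) ->
  embed (unbricks (usubmx z)) = z.
Proof.
move=> z0; rewrite /embed unbricksK -[RHS]vsubmxK; congr col_mx.
by apply/matrixP=> i q; rewrite !mxE z0.
Qed.

Lemma dot_embed (w x : 'cV[int]_(n * t)) :
  dot (w_mx r s (bricks w)) (embed x) = inner w x.
Proof.
rewrite dot_w /inner sum_bricks exchange_big /=; apply: eq_bigr => q _; apply: eq_bigr => j _.
by rewrite col_mxEu !mxE.
Qed.

End NFold.

Section Encoding.
Local Open Scope ring_scope.

Definition ext_tag (z : \bar int) : int :=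
  match z with EFin _ => 0 | +oo%E => 1 | -oo%E => -1 end.
Definition ext_val (z : \bar int) : int := if z is EFin a then a else 0.

Lemma encode_extE z : encode_ext z = [:: ext_tag z; ext_val z].
Proof. by case: z. Qed.

Lemma size_encode (l : seq (\bar int)) : size (flatten (map encode_ext l)) = (2 * size l)%N.
Proof. by elim: l => //= z l IH; rewrite size_cat IH encode_extE /= mulnS. Qed.

Lemma nth_encode (l : seq (\bar int)) z0 i : (i < size l)%N ->
  (flatten (map encode_ext l))`_(2 * i) = ext_tag (nth z0 l i) /\
  (flatten (map encode_ext l))`_(2 * i).+1 = ext_val (nth z0 l i).
Proof.
elim: l i => //= z l IH [|i] il; first by rewrite encode_extE.
by rewrite encode_extE mulnS /=; exact: IH.
Qed.

Lemma size_col_seq T N (v : 'cV[T]_N) : size (col_seq v) = N.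
Proof. by rewrite size_map size_enum_ord. Qed.

Lemma nth_col_seq T x0 N (v : 'cV[T]_N) (i : 'I_N) : nth x0 (col_seq v) i = v i ord0.
Proof. by rewrite (nth_map i) ?size_enum_ord // nth_ord_enum. Qed.

Variables (r s t n : nat).
Variables (l u : 'cV[\bar int]_(n * t)) (b : 'cV[int]_(r + n * s)) (w : 'cV[int]_(n * t)).
Notation mi := (init_memory (encode_input n l u b w)).

Lemma size_encode_input : size (encode_input n l u b w) = input_size r s t n.
Proof.
by rewrite /encode_input /= !size_cat !size_encode !size_col_seq /input_size; lia.
Qed.

Lemma read_n : mi 0 = n%:Z. Proof. by []. Qed.

Lemma read_lower (q : 'I_n) (j : 'I_t) :
  mi (ltag_addr t n q j) = ext_tag (bricks l j q) /\
  mi (lval_addr t n q j) = ext_val (bricks l j q).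
Proof.
have il : (q * t + j < size (col_seq l))%N.
  by rewrite size_col_seq; exact: ltn_ord (mxtens_index (q, j)).
have [e1 e2] := nth_encode 0%:E il.
rewrite mxE -(nth_col_seq 0%:E) -e1 -e2 /ltag_addr /lval_addr /init_memory /encode_input.
rewrite add1n add2n /= !nth_cat size_encode.
by rewrite !ifT //; lia.
Qed.

Lemma read_upper (q : 'I_n) (j : 'I_t) :
  mi (utag_addr t n q j) = ext_tag (bricks u j q) /\
  mi (uval_addr t n q j) = ext_val (bricks u j q).
Proof.
have il : (q * t + j < size (col_seq u))%N.
  by rewrite size_col_seq; exact: ltn_ord (mxtens_index (q, j)).
have [e1 e2] := nth_encode 0%:E il.
have key k : (k < 2 * (n * t))%N ->
    mi (1 + 2 * (n * t) + k)%N%:Z = (flatten (map encode_ext (col_seq u)))`_k.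
  move=> kN; rewrite /init_memory /encode_input -addnA add1n /=.
  rewrite nth_cat size_encode size_col_seq ltnNge leq_addr /= addKn.
  by rewrite nth_cat size_encode size_col_seq kN.
rewrite size_col_seq in il.
rewrite mxE -(nth_col_seq 0%:E) -e1 -e2 /utag_addr key; last by lia.
split=> //; rewrite -key; last by lia.
by congr mi; rewrite /uval_addr; lia.
Qed.

Lemma read_tail (i : nat) : mi (1 + 4 * (n * t) + i)%N%:Z = (col_seq b ++ col_seq w)`_i.
Proof.
rewrite /init_memory /encode_input -addnA add1n /=.
rewrite nth_cat size_encode size_col_seq ifF; last by lia.
rewrite nth_cat size_encode size_col_seq ifF; last by lia.
by congr nth; lia.
Qed.

Lemma read_b1 (i : 'I_r) : mi (b1_addr t n i) = usubmx b i 0.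
Proof.
rewrite /b1_addr read_tail nth_cat size_col_seq ltn_addr //.
by rewrite -[X in _`_X]/(val (lshift (n * s) i)) nth_col_seq mxE.
Qed.

Lemma read_b2 (q : 'I_n) (i : 'I_s) : mi (b2_addr r s t n q i) = bricks (dsubmx b) i q.
Proof.
rewrite /b2_addr -addnA read_tail nth_cat size_col_seq.
have -> : (r + (q * s + i) = rshift r (mxtens_index (q, i)))%N by [].
by rewrite ltn_ord nth_col_seq !mxE.
Qed.

Lemma read_w (q : 'I_n) (j : 'I_t) : mi (w_addr r s t n q j) = bricks w j q.
Proof.
have -> : w_addr r s t n q j = (1 + 4 * (n * t) + (r + n * s + (q * t + j)))%N.
  by rewrite /w_addr; lia.
rewrite read_tail nth_cat size_col_seq.
rewrite ltnNge leq_addr /= addKn.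
have -> : (q * t + j = mxtens_index (q, j))%N by [].
by rewrite nth_col_seq mxE.
Qed.

Lemma bits_ext z : (bits (ext_tag z) + bits (ext_val z) <= 3 * ebits z)%N.
Proof.
case: z => [a||] //; rewrite -[ext_tag _]/0 -[ext_val _]/a -[ebits _]/(bits a).
have -> : bits 0 = 1%N by [].
by have := bits_gt0 a; lia.
Qed.

Lemma bits_nat_le k : (bits k%:Z <= k.+1)%N.
Proof. by rewrite /bits add1n ltnS; apply: up_log_min => //; exact: ltn_expl. Qed.

Lemma sum_bits_encode (v : 'cV[\bar int]_(n * t)) :
  (\sum_(x <- flatten (map encode_ext (col_seq v))) bits x <= 3 * \sum_i ebits (v i ord0))%N.
Proof.
rewrite big_flatten big_map big_map big_enum /= big_distrr /=; apply: leq_sum => i _.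
by rewrite encode_extE !big_cons big_nil addn0 bits_ext.
Qed.

Lemma sum_bits_input :
  (\sum_(x <- encode_input n l u b w) bits x <= 3 * (n + input_length l u b w) + 1)%N.
Proof.
have sum_col N (v : 'cV[int]_N) : (\sum_(x <- col_seq v) bits x = \sum_i bits (v i ord0))%N.
  by rewrite big_map big_enum.
rewrite /encode_input big_cons !big_cat /= !sum_col.
have := bits_nat_le n; have := sum_bits_encode l; have := sum_bits_encode u.
rewrite /input_length.
move: (bits n) (\sum_(x <- flatten (map encode_ext (col_seq u))) bits x)%N
  (\sum_(x <- flatten (map encode_ext (col_seq l))) bits x)%N
  (\sum_i ebits (l i ord0))%N (\sum_i ebits (u i ord0))%N
  (\sum_i bits (b i ord0))%N (\sum_i bits (w i ord0))%N => a1 a2 a3 a4 a5 a6 a7; lia.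
Qed.

End Encoding.

(** * Magnitude of the numbers *)

Section Magnitude.
Local Open Scope ring_scope.
Variable R : int.
Hypothesis R2 : 2 <= R.

(** A calculus of orders of magnitude: all estimates are by powers of the same base [R]. The
    lemmas leave the arithmetic of exponents as side conditions. *)
Definition small (k : nat) (x : int) : Prop := `|x| <= R ^+ k.

Let R1 : 1 <= R. Proof. by apply: le_trans R2. Qed.
Let R0 : 0 <= R. Proof. by apply: le_trans R2. Qed.

Lemma pow_ge0 k : 0 <= R ^+ k. Proof. exact: exprn_ge0. Qed.

Lemma pow_ge1 k : 1 <= R ^+ k. Proof. exact: exprn_ege1. Qed.

Lemma pow_mono i k : (i <= k)%N -> R ^+ i <= R ^+ k.
Proof. by move=> ik; apply: ler_weXn2l. Qed.

Lemma small_mono i k x : (i <= k)%N -> small i x -> small k x.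
Proof. by move=> ik h; apply: le_trans h (pow_mono ik). Qed.

Lemma smallD i j k x y : small i x -> small j y -> (i < k)%N -> (j < k)%N -> small k (x + y).
Proof.
case: k => // k hx hy ik jk; apply: le_trans (ler_normD _ _) _.
have := small_mono (ltnSE ik) hx; have := small_mono (ltnSE jk) hy; rewrite /small exprS => h1 h2.
have : 2 * R ^+ k <= R * R ^+ k by rewrite ler_wpM2r ?pow_ge0.
by move: (R ^+ k) (R * _) h1 h2 => a b h1 h2 h3; lia.
Qed.

Lemma smallN k x : small k x -> small k (- x).
Proof. by rewrite /small normrN. Qed.

Lemma smallB i j k x y : small i x -> small j y -> (i < k)%N -> (j < k)%N -> small k (x - y).
Proof. by move=> hx hy; apply: smallD hx (smallN hy). Qed.

Lemma smallM i j k x y : small i x -> small j y -> (i + j <= k)%N -> small k (x * y).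
Proof.
move=> hx hy ijk; apply: (small_mono ijk); rewrite /small normrM exprD.
exact: ler_pM.
Qed.

Lemma small_sum (I : finType) i j k (F : I -> int) :
  #|I|%:Z <= R ^+ i -> (forall a, small j (F a)) -> (i + j <= k)%N -> small k (\sum_a F a).
Proof.
move=> hI hF ijk; apply: (small_mono ijk); apply: le_trans (ler_norm_sum _ _ _) _.
apply: le_trans (ler_sum _ (fun a _ => hF a)) _.
rewrite sumr_const mulrn_intE mulrC exprD; apply: ler_wpM2r => //; exact: pow_ge0.
Qed.

Lemma small_le1 x : `|x| <= R -> small 1 x.
Proof. by rewrite /small expr1. Qed.

Lemma small0 k : small k 0. Proof. by rewrite /small normr0 pow_ge0. Qed.

Lemma small1 x : `|x| <= 1 -> small 0 x. Proof. by []. Qed.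

Lemma small_pow k : small k (R ^+ k).
Proof. by rewrite /small ger0_norm ?pow_ge0. Qed.

Lemma small_bits k x : small k x -> (bits x <= bits (R ^+ k))%N.
Proof. by move=> h; apply: bits_mono; have := pow_ge0 k; rewrite /small in h; lia. Qed.

Lemma small_between k a b x : small k a -> small k b -> a <= x <= b -> small k x.
Proof. by rewrite /small; move: (R ^+ k) => c; lia. Qed.

Lemma small_pos k x : 0 <= x -> x <= R ^+ k -> small k x.
Proof. by move=> x0; rewrite /small ger0_norm. Qed.

End Magnitude.

Section Instance.
Local Open Scope ring_scope.

Lemma subr_mxE (p q : nat) (X Y : 'M[int]_(p, q)) i j : (X - Y) i j = X i j - Y i j.
Proof. by rewrite !mxE. Qed.

Variables (r s t : nat) (A : 'M[int]_(r + s, t)).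
Notation tx := (t + (r + s))%N.
Notation A1 := (usubmx A).
Notation A2 := (dsubmx A).

Variables (C : nat) (T : finType) (pat : T -> 'I_C -> 'cV[int]_tx).
Hypothesis patK : forall tau n (b : 'I_C -> 'I_n),
  in_kernel (slack_A1 s A1) (slack_A2 r A2) (move (pat tau) b).
Hypothesis pat_small : forall n (h : 'M[int]_(tx, n)),
  in_kernel (slack_A1 s A1) (slack_A2 r A2) h -> h != 0 ->
  exists tau (b : {ffun 'I_C -> 'I_n}),
    move (pat tau) b != 0 /\ conformal (move (pat tau) b) h.

Definition move_bound : nat := 
  (\sum_(tau : T) \sum_(k < C) \sum_(j < tx) absz (pat tau k j ord0))%N.

(** Being at most the base [R], these constants count as one more power of it. *)
Definition base_const : nat :=
  (10 + tx + #|T| + move_bound + \sum_i \sum_j absz (A i j))%N.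

(** The exponents of [R] for the successive orders of magnitude. Infinite bounds become
    [O = R^expO], which exceeds the number of moves (up to [R^(C+1)]) times the size of the
    reference point and of the moves; all bounds for the x-variables are then below [R^expX],
    the objective below [R^(expX+3)], less than half of the weight [R^expW] of the slacks, and
    objectives with slacks, as well as all widths, below [R^expL]. [R^expV] bounds all numbers. *)
Definition expX : nat := (C + 11)%N.
Definition expO : nat := (C + 8)%N.
Definition expW : nat := (expX + 5)%N.
Definition expL : nat := (3 * expX + 16)%N.
Definition expV : nat := (3 * expX + 18)%N.

Variables (n : nat).
Hypothesis n_gt0 : (0 < n)%N.
Variables (l u : 'cV[\bar int]_(n * t)) (b : 'cV[int]_(r + n * s)) (w : 'cV[int]_(n * t)).
Notation mi := (init_memory (encode_input n l u b w)).
Notation R := (Rv r s t base_const mi n).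

Lemma move_bounded (i : T * {ffun 'I_C -> 'I_n}) j q : `|mv pat i j q| <= move_bound%:Z.
Proof.
rewrite /mv /move summxE; apply: le_trans (ler_norm_sum _ _ _) _.
rewrite /move_bound -natz natr_sum (bigD1 i.1) //= -[leLHS]addr0 lerD //; last first.
  by rewrite sumr_ge0.
rewrite natr_sum; apply: ler_sum => k _; rewrite in_brickE natr_sum (bigD1 j) //=.
rewrite -[leLHS]addr0 lerD //; last by rewrite sumr_ge0.
by rewrite natz abszE; case: (_ == _); rewrite ?mulr1n // mulr0n normr0.
Qed.

Lemma sq_ge (x : int) : `|x| <= x * x. Proof. nia. Qed.

Lemma base_le_R : base_const%:Z <= R.
Proof. by rewrite lerDl; apply: sumr_ge0 => p _; rewrite -expr2 sqr_ge0. Qed.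

Lemma R_ge2 : 2 <= R.
Proof. by apply: le_trans base_le_R; rewrite /base_const; lia. Qed.

Lemma const_le_R (k : nat) : (k <= base_const)%N -> k%:Z <= R.
Proof. by move=> h; apply: le_trans base_le_R. Qed.

Lemma mi_le_R p : `|mi p| <= R.
Proof.
have R0 := le_trans (isT : 0 <= 2 :> int) R_ge2.
case: p => [p|p]; last by rewrite normr0.
have [lt|ge] := ltnP p (input_size r s t n).
  apply: le_trans (sq_ge _) _; rewrite /Rv (bigD1 (Ordinal lt)) //= addrCA lerDl addr_ge0 //.
  by apply: sumr_ge0 => p' _; rewrite -expr2 sqr_ge0.
by rewrite /init_memory nth_default ?normr0 // size_encode_input.
Qed.

Notation small := (small R).

Lemma mi_small p : small 1 (mi p). Proof. exact/small_le1/mi_le_R. Qed.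

Lemma n_le_R : n%:Z <= R. Proof. exact: mi_le_R 0. Qed.

Lemma card_small (k : nat) : k%:Z <= R -> #|'I_k|%:Z <= R ^+ 1.
Proof. by rewrite card_ord expr1. Qed.

Lemma tx_le_R : tx%:Z <= R. Proof. by apply: const_le_R; rewrite /base_const; lia. Qed.
Lemma t_le_R : t%:Z <= R. Proof. by apply: const_le_R; rewrite /base_const; lia. Qed.
Lemma rs_le_R : (r + s)%N%:Z <= R. Proof. by apply: const_le_R; rewrite /base_const; lia. Qed.

Lemma A_small i j : small 1 (A i j).
Proof.
apply: small_le1; rewrite -abszE; apply: const_le_R; rewrite /base_const.
apply: leq_trans (leq_addl _ _); rewrite (bigD1 i) //= (bigD1 j) //= -addnA; exact: leq_addr.
Qed.

Notation O := (Ov r s t base_const expO mi n).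
Notation W := (Wv r s t base_const expW mi n).
Notation lo_val := (@lo_val r s t base_const expO mi n).
Notation hi_val := (@hi_val r s t base_const expO mi n).
Notation slack_val := (slack_val A1 A2 base_const expO mi n).
Notation relaxed_lo := (@relaxed_lo r s t base_const expO move_bound mi n).
Notation relaxed_hi := (@relaxed_hi r s t base_const expO move_bound mi n).

Lemma lo_valE (q : 'I_n) j : lo_val q j = clip_lo O (bricks l j q).
Proof.
have [tagE valE] := read_lower l u b w q j; rewrite /lo_val tagE valE.
by case: (bricks l j q) => [a||] /=; lia.
Qed.

Lemma hi_valE (q : 'I_n) j : hi_val q j = clip_hi O (bricks u j q).
Proof.
have [tagE valE] := read_upper l u b w q j; rewrite /hi_val tagE valE.
by case: (bricks u j q) => [a||] /=; lia.
Qed.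

Lemma relaxed_loE (q : 'I_n) j : bricks l j q <> +oo%E ->
  relaxed_lo q j = clip_lo (O + move_bound%:Z) (bricks l j q).
Proof.
have [tagE _] := read_lower l u b w q j; rewrite /relaxed_lo lo_valE tagE.
by case: (bricks l j q) => [a||] //= _; lia.
Qed.

Lemma relaxed_hiE (q : 'I_n) j : bricks u j q <> -oo%E ->
  relaxed_hi q j = clip_hi (O + move_bound%:Z) (bricks u j q).
Proof.
have [tagE _] := read_upper l u b w q j; rewrite /relaxed_hi hi_valE tagE.
by case: (bricks u j q) => [a||] //= _; lia.
Qed.

Lemma tag_small z : small 0 (ext_tag z).
Proof. by case: z => [a||]; rewrite /small expr0. Qed.

Let R2 := R_ge2.

Lemma O_small : small expO O. Proof. exact: small_pow. Qed.

Lemma clip_small (v tag : int) : small 1 v -> small 0 tag ->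
  small (C + 10) (v + tag * O + (tag * tag + tag)) /\
  small (C + 10) (v + tag * O - (tag * tag - tag)).
Proof.
move=> vs ts.
have tO : small (C + 8) (tag * O) by apply: (smallM R2 ts O_small).
have vt : small (C + 9) (v + tag * O) by apply: (smallD R2 vs tO); lia.
have tt : small 0 (tag * tag) by exact: (smallM R2 ts ts).
have tt1 : small 1 (tag * tag + tag) by exact: (smallD R2 tt ts).
have tt2 : small 1 (tag * tag - tag) by exact: (smallB R2 tt ts).
by split; [apply: (smallD R2 vt tt1)|apply: (smallB R2 vt tt2)]; lia.
Qed.

Lemma lo_small q j : (q < n)%N -> small (C + 10) (lo_val q j).
Proof.
move=> qn; have [tagE _] := read_lower l u b w (Ordinal qn) j.
by rewrite /lo_val tagE; apply: (clip_small (mi_small _) (tag_small _)).1.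
Qed.

Lemma hi_small q j : (q < n)%N -> small (C + 10) (hi_val q j).
Proof.
move=> qn; have [tagE _] := read_upper l u b w (Ordinal qn) j.
by rewrite /hi_val tagE; apply: (clip_small (mi_small _) (tag_small _)).2.
Qed.

Lemma relax_small (tag : int) : small 0 tag -> small 1 (move_bound%:Z * (tag * tag)).
Proof.
move=> ts; have tt : small 0 (tag * tag) by exact: (smallM R2 ts ts).
apply: (smallM R2 (i := 1) _ tt) => //; apply: small_le1.
by rewrite ger0_norm //; apply: const_le_R; rewrite /base_const; lia.
Qed.

Lemma relaxed_lo_small q j : (q < n)%N -> small expX (relaxed_lo q j).
Proof.
move=> qn; have [tagE _] := read_lower l u b w (Ordinal qn) j.
rewrite /relaxed_lo tagE.
by apply: (smallB R2 (lo_small j qn) (relax_small (tag_small _))); rewrite /expX; lia.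
Qed.

Lemma relaxed_hi_small q j : (q < n)%N -> small expX (relaxed_hi q j).
Proof.
move=> qn; have [tagE _] := read_upper l u b w (Ordinal qn) j.
rewrite /relaxed_hi tagE.
by apply: (smallD R2 (hi_small j qn) (relax_small (tag_small _))); rewrite /expX; lia.
Qed.

Lemma lo_smallE q j : (q < n)%N -> small expX (lo_val q j).
Proof. by move=> qn; apply: (small_mono R2 _ (lo_small j qn)); rewrite /expX; lia. Qed.

Lemma row_small (k : nat) (a : 'I_k -> int) (f : 'I_k -> int) i : k%:Z <= R ->
  (forall j, small 1 (a j)) -> (forall j, small i (f j)) -> small i.+2 (\sum_j a j * f j).
Proof.
move=> kR aS fS; apply: (small_sum R2 (card_small kR)) (leqnn _) => j.
exact: (smallM R2 (aS j) (fS j)).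
Qed.

Lemma nat_le_n_small k : (k <= n)%N -> k%:Z <= R.
Proof. by move=> kn; apply: le_trans n_le_R. Qed.

Lemma rho_small k i : (k <= n)%N -> small (expX + 4) (rho_val s A1 base_const expO mi n k i).
Proof.
move=> kn; rewrite /rho_val.
apply: (smallB R2 (mi_small _) (j := expX + 3)); try by rewrite /expX; lia.
apply: (small_sum R2 (card_small (nat_le_n_small kn)) (j := expX + 2)); last by rewrite /expX; lia.
move=> q; rewrite addn2; apply: (row_small t_le_R) => j; first by rewrite mxE; exact: A_small.
by apply: lo_smallE; apply: leq_trans kn.
Qed.

Lemma sigma_small q i : (q < n)%N -> small (expX + 4) (sigma_val r A2 base_const expO mi n q i).
Proof.
move=> qn; rewrite /sigma_val.
apply: (smallB R2 (mi_small _) (j := expX + 2)); try by rewrite /expX; lia.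
rewrite addn2; apply: (row_small t_le_R) => j; first by rewrite mxE; exact: A_small.
exact: lo_smallE.
Qed.

Lemma slack_small q i : (q < n)%N -> small (expX + 4) (slack_val q i).
Proof.
move=> qn; rewrite /slack_val; case: split => i'; last exact: sigma_small.
by case: ifP => _; [exact: rho_small|exact: small0].
Qed.

Notation slack_lo := (slack_lo A1 A2 base_const expO mi n).
Notation slack_hi := (slack_hi A1 A2 base_const expO mi n).
Notation slack_cost := (slack_cost A1 A2 base_const expO expW mi n).

Lemma slack_lo_small q i : (q < n)%N -> small (expX + 4) (slack_lo q i).
Proof.
move=> qn; have := slack_small i qn; rewrite /slack_lo /small.
by move: (slack_val q i) (R ^+ _) => x y; lia.
Qed.

Lemma slack_hi_small q i : (q < n)%N -> small (expX + 4) (slack_hi q i).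
Proof.
move=> qn; have := slack_small i qn; rewrite /slack_hi /small.
by move: (slack_val q i) (R ^+ _) => x y; lia.
Qed.

Lemma slack_cost_small q i : (q < n)%N -> small (2 * expX + 9) (slack_cost q i).
Proof.
move=> qn; apply: (smallM R2 (small_pow R2 expW) (slack_small i qn)).
by rewrite /expW; lia.
Qed.

Notation lo_mx := (lo_mx A1 A2 base_const expO mi n).
Notation hi_mx := (hi_mx A1 A2 base_const expO mi n).
Notation c_mx := (c_mx A1 A2 base_const expO expW mi n).
Notation x_mx := (x_mx A1 A2 base_const expO mi n).
Notation lo_mx' := (lo_mx' A1 A2 base_const expO move_bound mi n).
Notation hi_mx' := (hi_mx' A1 A2 base_const expO move_bound mi n).

Lemma lo_mx_small j q : small (expX + 4) (lo_mx j q).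
Proof.
rewrite mxE; case: (split j) => i; last exact: slack_lo_small.
by apply: (small_mono R2 _ (lo_smallE i (ltn_ord q))); lia.
Qed.

Lemma hi_mx_small j q : small (expX + 4) (hi_mx j q).
Proof.
rewrite mxE; case: (split j) => i; last exact: slack_hi_small.
by apply: (small_mono R2 _ (hi_small i (ltn_ord q))); rewrite /expX; lia.
Qed.

Lemma c_mx_small j q : small (2 * expX + 9) (c_mx j q).
Proof.
rewrite mxE; case: (split j) => i; last exact: slack_cost_small.
by apply: (small_mono R2 _ (mi_small _)); lia.
Qed.

Lemma box_small (x : 'M[int]_(tx, n)) : in_box lo_mx hi_mx x -> forall j q, small (expX + 4) (x j q).
Proof.
move=> /in_boxP bx j q; exact: (small_between R2 (lo_mx_small j q) (hi_mx_small j q) (bx j q)).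
Qed.

Lemma dot_small (x : 'M[int]_(tx, n)) : (forall j q, small (expX + 4) (x j q)) ->
  small (3 * expX + 15) (dot c_mx x).
Proof.
move=> xS; apply: (small_sum R2 (card_small tx_le_R) (j := 3 * expX + 14)) => [j|]; last by lia.
apply: (small_sum R2 (card_small n_le_R) (j := 3 * expX + 13)) => [q|]; last by lia.
by apply: (smallM R2 (c_mx_small j q) (xS j q)); lia.
Qed.

Lemma x_mx_small j q : small (expX + 4) (x_mx j q).
Proof.
rewrite mxE; case: (split j) => i; last exact: slack_small.
by apply: (small_mono R2 _ (lo_smallE i (ltn_ord q))); lia.
Qed.

Lemma box_width j q : hi_mx j q - lo_mx j q <= R ^+ expL.
Proof.
apply: le_trans (ler_norm _) _.
by apply: (smallB R2 (hi_mx_small j q) (lo_mx_small j q)); rewrite /expL; lia.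
Qed.

Lemma gap_small y : in_box lo_mx hi_mx y -> dot c_mx x_mx - dot c_mx y <= R ^+ expL.
Proof.
move=> by_; apply: le_trans (ler_norm _) _.
by apply: (smallB R2 (dot_small x_mx_small) (dot_small (box_small by_))); rewrite /expL; lia.
Qed.

Lemma w_dot_small z : in_box lo_mx' hi_mx' z ->
  `|dot (w_mx r s (bricks w)) z| <= R ^+ (expX + 3).
Proof.
move=> /in_boxP bz; rewrite dot_w.
apply: (small_sum R2 (card_small t_le_R) (j := expX + 2)) => [j|]; last by lia.
rewrite addn2; apply: (row_small n_le_R) => q; first by rewrite -(read_w l u b w q j); exact: mi_small.
have := bz (lshift (r + s) j) q; rewrite !mxE.
have -> : split (lshift (r + s) j) = inl j by exact: (unsplitK (inl j)).
exact: (small_between R2 (relaxed_lo_small j (ltn_ord q)) (relaxed_hi_small j (ltn_ord q))).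
Qed.

Lemma W_big : 2 * R ^+ (expX + 3) < W.
Proof.
have -> : W = R * (R * R ^+ (expX + 3)).
  by rewrite /Wv /expW (_ : expX + 5 = (expX + 3).+2)%N ?exprS //; lia.
have := pow_ge1 R2 (expX + 3); have := R_ge2.
move: (R ^+ (expX + 3)) => e; move: (Rv _ _ _ _ _ _) => a a2 e1.
have h1 : 2 * e <= a * e by nia.
have h2 : 2 * (a * e) <= a * (a * e) by move: (a * e) h1 => f h1; nia.
by lia.
Qed.

Definition bit_bound : nat := bits (R ^+ expV).
Notation B := bit_bound.

Lemma small_B k x : small k x -> (k <= expV)%N -> (bits x <= B)%N.
Proof. by move=> h kV; apply: (small_bits R2); exact: (small_mono R2 kV h). Qed.

Lemma nat_small k : (k <= base_const)%N -> small 1 k%:Z.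
Proof. by move=> h; apply: small_le1; rewrite ger0_norm //; exact: const_le_R. Qed.

Lemma two_small : small 1 2.
Proof. by apply: (@nat_small 2); rewrite /base_const; lia. Qed.

Lemma n_small : small 1 n%:Z. Proof. by apply: small_le1; rewrite ger0_norm //; exact: n_le_R. Qed.

Lemma pow_n_small : small C (n ^ C)%N%:Z.
Proof.
rewrite -Posz_exp; apply: small_pos; first exact: exprn_ge0.
by apply: lerXn2r; rewrite ?nnegrE //; [apply: le_trans R2|exact: n_le_R].
Qed.

Lemma size_small : small 7 (input_size r s t n)%:Z.
Proof.
have -> : (input_size r s t n)%:Z = 1 + 5 * (n%:Z * t%:Z) + r%:Z + n%:Z * s%:Z.
  by rewrite /input_size; lia.
have tS : small 1 t%:Z by apply: nat_small; rewrite /base_const; lia.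
have sS : small 1 s%:Z by apply: nat_small; rewrite /base_const; lia.
have rS : small 1 r%:Z by apply: nat_small; rewrite /base_const; lia.
have S5 : small 1 5 by apply: (@nat_small 5); rewrite /base_const; lia.
have nt : small 2 (n%:Z * t%:Z) by exact: (smallM R2 n_small tS).
have ns : small 2 (n%:Z * s%:Z) by exact: (smallM R2 n_small sS).
have S1 : small 1 1 by apply: (@nat_small 1); rewrite /base_const; lia.
have nt5 : small 3 (5 * (n%:Z * t%:Z)) by exact: (smallM R2 S5 nt).
have h1 : small 4 (1 + 5 * (n%:Z * t%:Z)) by exact: (smallD R2 S1 nt5).
have h2 : small 5 (1 + 5 * (n%:Z * t%:Z) + r%:Z) by exact: (smallD R2 h1 rS).
by apply: (smallD R2 h2 ns).
Qed.

Lemma R_small_sum k : (k <= input_size r s t n)%N ->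
  small 1 (base_const%:Z + \sum_(p < k) mi p%:Z * mi p%:Z).
Proof.
move=> kn; have sq p : 0 <= mi p * mi p by rewrite -expr2 sqr_ge0.
apply: small_pos; first by rewrite addr_ge0 // sumr_ge0.
rewrite expr1 /Rv lerD2l -!(big_mkord xpredT (fun p => mi p%:Z * mi p%:Z)).
rewrite [leRHS](big_cat_nat (n := k)) //= lerDl.
by apply: sumr_ge0 => p _; rewrite -expr2 sqr_ge0.
Qed.

Lemma bad_small k : (k <= n)%N -> small 2 (\sum_(q < k) bad_val r s t base_const expO mi n q).
Proof.
move=> kn; apply: (small_sum R2 (card_small (nat_le_n_small kn)) (j := 1)) => // q.
apply: (small_sum R2 (card_small t_le_R) (j := 0)) => // j.
by apply: small1; case: (0 <= hi_val _ _ - _).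
Qed.

Lemma init_hoare : hoare (fun m => m = mi) (init A1 A2 base_const expO expW expL)
  (init_cost A1 A2 base_const expO expW expL n B)
  (initialized A1 A2 base_const expO expW expL mi n B).
Proof.
apply: hoare_init.
- exact: read_n.
- by [].
- by move=> p; apply: small_B (mi_small p) _; rewrite /expV; lia.
- by apply: small_B n_small _; rewrite /expV; lia.
- by apply: small_B size_small _; rewrite /expV /expX; lia.
- have -> : 2%N = bits 1 by [].
  by apply: small_B (small1 _ _) _.
- by move=> k kn; apply: small_B (R_small_sum kn) _; rewrite /expV; lia.
- by apply: small_B O_small _; rewrite /expV /expX /expO; lia.
- by apply: small_B (small_pow R2 _) _; rewrite /expV /expW; lia.
- by apply: small_B (small_pow R2 _) _; rewrite /expV /expL; lia.
- by move=> q j qn; apply: small_B (lo_smallE j qn) _; rewrite /expV; lia.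
- by move=> q j qn; apply: small_B (hi_small j qn) _; rewrite /expV /expX; lia.
- by move=> k kn; apply: small_B (bad_small kn) _; rewrite /expV; lia.
- by move=> k i kn; apply: small_B (rho_small i kn) _; rewrite /expV; lia.
- by move=> q i qn; apply: small_B (sigma_small i qn) _; rewrite /expV; lia.
- by move=> q i qn; apply: small_B (slack_cost_small i qn) _; rewrite /expV; lia.
Qed.

Notation outcome := (outcome A1 A2 base_const expO expW move_bound pat
  (slack_A1 s A1) (slack_A2 r A2) mi n).

Lemma main_hoare : hoare (fun m => m = mi)
  (main A1 A2 base_const expO expW expL move_bound pat)
  (main_cost A1 A2 base_const expO expW expL move_bound pat n B) outcome.
Proof.
have R0 : 0 <= R by apply: le_trans R2.
have LE : Lv r s t base_const expL mi n = `|R ^+ expL|%N%:Z.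
  by rewrite abszE ger0_norm // exprn_ge0.
have L1 : 1 <= `|R ^+ expL|%N%:Z by rewrite -LE; exact: pow_ge1.
apply: (hoare_main patK pat_small n_gt0 LE).
- by move: L1; lia.
- have -> : 3%N = bits 2 by [].
  by apply: small_B two_small _; rewrite /expV; lia.
- by apply: small_B n_small _; rewrite /expV; lia.
- rewrite PoszM -LE; apply: (@small_B (expL + 1)); last by rewrite /expV /expL; lia.
  by apply: (smallM R2 two_small (small_pow R2 expL)); lia.
- rewrite !PoszM; apply: (@small_B (C + 2)); last by rewrite /expV /expX; lia.
  have S6 : small 1 6 by apply: (@nat_small 6); rewrite /base_const; lia.
  have ST : small 1 #|T|.+1%:Z by apply: nat_small; rewrite /base_const; lia.
  apply: (smallM R2 S6 (smallM R2 ST pow_n_small (leqnn _))); lia.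
- exact: init_hoare.
- exact: read_n.
- by move=> j q; rewrite -LE; exact: box_width.
- by move=> y byy; rewrite -LE; exact: gap_small.
- by move=> q j qn; apply: small_B (relaxed_lo_small j qn) _; rewrite /expV; lia.
- by move=> q j qn; apply: small_B (relaxed_hi_small j qn) _; rewrite /expV; lia.
- move=> f fP k kn; apply: (@small_B (2 * expX + 10)); last by rewrite /expV; lia.
  apply: (small_sum R2 (card_small (nat_le_n_small kn)) (j := 2 * expX + 9)) => [q|]; last by lia.
  apply: (small_sum R2 (card_small rs_le_R) (j := 2 * expX + 8)) => [i|]; last by lia.
  have qn : (q < n)%N by apply: leq_trans kn.
  have fS := small_between R2 (slack_lo_small i qn) (slack_hi_small i qn) (fP q i qn).
  by apply: (smallM R2 fS fS); lia.
Qed.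

Let q0 : 'I_n := Ordinal n_gt0.
Notation b1 := (usubmx b).
Notation b2 := (bricks (dsubmx b)).

Lemma x_mxE : x_mx = completion A q0 b1 b2 (\matrix_(j, q) lo_val q j).
Proof.
apply/matrixP=> j q; rewrite mxE -[j in RHS]splitK.
case: (split j) => [i|i] /=; first by rewrite col_mxEu mxE.
rewrite col_mxEd /slack_val -[i in RHS]splitK; case: (split i) => i' /=.
  rewrite col_mxEu in_brickE -val_eqE /=; case: eqP => _; last by rewrite mulr0n.
  rewrite mulr1n subr_mxE -(read_b1 l u b w); congr (_ - _).
  rewrite mxE exchange_big /=; apply: eq_bigr => j' _.
  rewrite [(_ *m const_mx 1) _ _]mxE mulr_sumr; apply: eq_bigr => q' _.
  by rewrite !mxE mulr1.
rewrite col_mxEd subr_mxE -(read_b2 l u b w); congr (_ - _).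
by rewrite mxE; apply: eq_bigr => j' _; rewrite !mxE.
Qed.

(** A reference point that uses finite bounds of the input wherever there are some: its entries
    and its residues are bounded by fixed powers of [R], and this makes the feasible points
    near it bounded too. *)
Definition ref_mx : 'M[int]_(t, n) := \matrix_(j, q)
  match bricks l j q, bricks u j q with EFin a, _ => a | _, EFin a => a | _, _ => 0 end.

Lemma lower_finite j q : finite_le R (bricks l j q).
Proof.
move=> a la; have [_ vE] := read_lower l u b w q j.
by rewrite -[a]/(ext_val a%:E) -la -vE; exact: mi_le_R.
Qed.

Lemma upper_finite j q : finite_le R (bricks u j q).
Proof.
move=> a ua; have [_ vE] := read_upper l u b w q j.
by rewrite -[a]/(ext_val a%:E) -ua -vE; exact: mi_le_R.
Qed.

Lemma ref_small j q : small 1 (ref_mx j q).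
Proof.
apply: small_le1; rewrite mxE; have := @lower_finite j q; have := @upper_finite j q.
have R0 : 0 <= R by apply: le_trans R2.
rewrite /finite_le; case: (bricks l j q) => [a||]; case: (bricks u j q) => [c||] hu hl;
  rewrite ?normr0 //; by [exact: hl|exact: hu].
Qed.

Lemma ref_slack_small i q : small 5 (completion A q0 b1 b2 ref_mx (rshift t i) q).
Proof.
rewrite col_mxEd -[i]splitK; case: (split i) => i' /=.
  rewrite col_mxEu in_brickE; case: (_ == _); last by rewrite mulr0n; exact: small0.
  rewrite mulr1n subr_mxE -(read_b1 l u b w).
  apply: (smallB R2 (mi_small _) (j := 4)) => //.
  rewrite mxE; apply: (row_small t_le_R) => j; first by rewrite mxE; exact: A_small.
  rewrite mxE; apply: (small_sum R2 (card_small n_le_R) (j := 1)) => // q'.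
  by rewrite [const_mx _ _ _]mxE mulr1; exact: ref_small.
rewrite col_mxEd subr_mxE -(read_b2 l u b w).
apply: (smallB R2 (mi_small _) (j := 3)) => //.
rewrite mxE; apply: (row_small t_le_R) => j; first by rewrite mxE; exact: A_small.
exact: ref_small.
Qed.

Notation feasible := (feasible A1 A2 b1 b2 (bricks l) (bricks u)).
Notation lx := (lshift (r + s)).
Notation sx := (rshift t).

Lemma join_lx (f : nat -> 'I_t -> int) (g : nat -> 'I_(r + s) -> int) j q :
  join_mx n f g (lx j) q = f q j.
Proof. by rewrite mxE; have -> : split (lx j) = inl j by exact: (unsplitK (inl j)). Qed.

Lemma join_sx (f : nat -> 'I_t -> int) (g : nat -> 'I_(r + s) -> int) i q :
  join_mx n f g (sx i) q = g q i.
Proof. by rewrite mxE; have -> : split (sx i) = inr i by exact: (unsplitK (inr i)). Qed.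

Lemma box_sound_instance :
  ((exists j q, hi_mx (lx j) q < lo_mx (lx j) q) -> forall y, ~ feasible y) /\
  (forall x, in_box lo_mx hi_mx x -> in_kernel (slack_A1 s A1) (slack_A2 r A2) (x - x_mx) ->
     (forall y, in_box lo_mx hi_mx y -> in_kernel (slack_A1 s A1) (slack_A2 r A2) (y - x_mx) ->
        dot c_mx x <= dot c_mx y) ->
     ((exists i q, x (sx i) q <> 0) -> forall y, ~ feasible y) /\
     ((forall i q, x (sx i) q = 0) ->
        [/\ feasible x,
            forall x', in_box lo_mx' hi_mx' x' ->
              in_kernel (slack_A1 s A1) (slack_A2 r A2) (x' - x) ->
              dot c_mx x' <= dot c_mx x - 1 ->
              exists2 g, dot (w_mx r s (bricks w)) g < 0 & forall k, feasible (x + g *+ k) &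
            (forall tau (c : {ffun 'I_C -> 'I_n}),
               ~~ acceptable lo_mx' hi_mx' c_mx x 1 1 (move (pat tau) c)) ->
            forall y, feasible y ->
              dot (w_mx r s (bricks w)) x <= dot (w_mx r s (bricks w)) y])).
Proof.
have R0 : 0 <= R by apply: le_trans R2.
have D0 : 0 <= move_bound%:Z by [].
have RS : small 1 R by apply: small_le1; rewrite ger0_norm.
have DR : small 1 move_bound%:Z by apply: nat_small; rewrite /base_const; lia.
refine (@box_sound r s t A1 A2 n b1 b2 (bricks l) (bricks u) (bricks w) C T pat patK pat_small
  R O W (R ^+ (expX + 3)) (R ^+ 5) move_bound%:Z R0 _ _ lower_finite upper_finite move_bounded _
  (completion A q0 b1 b2 ref_mx) (completion_balanced _ _ _ _ _) ref_slack_small _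
  lo_mx hi_mx lo_mx' hi_mx' c_mx x_mx (fun i q => slack_val q i)
  _ _ _ _ _ _ _ _ _ _ _ _ _ _ _ _).
- exact: exprn_ge0.
- apply: le_trans (ler_norm _) _; apply: (smallM R2 two_small RS); lia.
- apply: le_trans (ler_norm _) _.
  have cardS : small (C + 1) #|{: T * {ffun 'I_C -> 'I_n}}|%:Z.
    have ST : small 1 #|T|%:Z by apply: nat_small; rewrite /base_const; lia.
    rewrite card_prod card_ffun !card_ord PoszM.
    by apply: (smallM R2 ST pow_n_small); lia.
  have MS := smallM R2 (smallM R2 cardS (small_pow R2 5) (leqnn _)) DR (leqnn _).
  by apply: (smallD R2 RS MS); rewrite /expO; lia.
- by move=> j q; rewrite col_mxEu mxE.
- by move=> j q; rewrite join_lx lo_valE.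
- by move=> j q; rewrite join_lx hi_valE.
- by move=> j q lj; rewrite join_lx relaxed_loE.
- by move=> j q uj; rewrite join_lx relaxed_hiE.
- by move=> i q; rewrite join_sx.
- by move=> i q; rewrite join_sx.
- by move=> i q; rewrite join_sx.
- by move=> i q; rewrite join_sx.
- by move=> j q; rewrite join_lx -(read_w l u b w).
- by move=> i q; rewrite join_sx.
- by rewrite x_mxE; exact: completion_balanced.
- by [].
- exact: exprn_ge0.
- by rewrite -[leLHS]expr1 /Ov; apply: pow_mono; rewrite ?R2 // /expO; lia.
- exact: w_dot_small.
- exact: W_big.
Qed.

Lemma infinite_ray (S : set 'cV[int]_(n * t)) (x g : 'M[int]_(tx, n)) :
  dot (w_mx r s (bricks w)) g < 0 ->
  (forall k, S (unbricks (usubmx (x + g *+ k)))) -> infinite_set S.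
Proof.
move=> g0 xS.
pose f (k : nat) := unbricks (usubmx (x + g *+ k)).
have f_inj : injective f.
  move=> k k' /(congr1 (@bricks n int t)); rewrite !unbricksK => /matrixP e.
  have : dot (w_mx r s (bricks w)) (x + g *+ k) = dot (w_mx r s (bricks w)) (x + g *+ k').
    rewrite !dot_w; apply: eq_bigr => j _; apply: eq_bigr => q _.
    by have := e j q; rewrite !mxE => ->.
  by rewrite !dotD !dotMn !mulrn_intE => /addrI/(mulfI (ltr0_neq0 g0))[].
have sub : (range f `<=` S)%classic by move=> _ [k _ <-]; exact: xS.
apply: sub_infinite_set sub _.
by rewrite (eq_finite_set (inj_card_eq (in2W f_inj))); exact: infinite_nat.
Qed.

Lemma outcome_sound m : outcome m ->
  solves_min w (feasible_set (nfold A n) b l u) (decode_answer (n * t) m).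
Proof.
have [no_box sound] := box_sound_instance.
have empty : (forall y, ~ feasible y) -> feasible_set (nfold A n) b l u = set0.
  move=> no; apply/seteqP; split=> // x /(@embed_feasible r s t A n b l u x).1 /no[].
move=> [[m0 [q [j [qn lt]]]]|[x [xB xK xopt]]].
  rewrite /decode_answer m0 /=; apply: empty; apply: no_box.
  by exists j, (Ordinal qn); rewrite !join_lx.
have [slack_no slack_yes] := sound x xB xK xopt.
case=> [[m0 nz]|[xs fin]]; first by rewrite /decode_answer m0 /=; apply: empty; exact: slack_no.
have [fx ray opt] := slack_yes xs.
case: fin => [[m0 [x' [x'B x'K le]]]|[m0 no out]].
  rewrite /decode_answer m0 /=; have [g g0 gF] := ray x' x'B x'K le.
  apply: (infinite_ray (x := x) g0) => k.
  have fk := gF k; have [_ [ks _]] := fk.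
  by apply/embed_feasible; rewrite embed_unbricks.
rewrite /decode_answer m0 /=.
have xE : \col_i m i.+1 = unbricks (usubmx x).
  apply/colP=> i; rewrite !mxE -out; congr m.
  by rewrite -[i in LHS]mxtens_unindexK /=; lia.
have embE : embed r s (unbricks (usubmx x)) = x by exact: embed_unbricks.
rewrite xE; split; first by apply/embed_feasible; rewrite embE.
move=> y /(@embed_feasible r s t A n b l u y).1 fy.
by have := opt no _ fy; rewrite dot_embed -{1}embE dot_embed.
Qed.

End Instance.

(** * Running time *)

Section PolynomialCost.
Implicit Types (f g : nat -> nat -> nat).

(** The costs are functions of the number of bricks and of the bit bound. Closure properties
    replace any explicit polynomial. *)
Definition polynomial_cost f : Prop :=
  exists c d, forall n B, f n B <= c * (n + B).+1 ^ d.

Lemma polynomial_cost_le f g :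
  (forall n B, f n B <= g n B) -> polynomial_cost g -> polynomial_cost f.
Proof.
by move=> le [c [d h]]; exists c, d => n B; apply: leq_trans (h n B).
Qed.

Lemma polynomial_const k : polynomial_cost (fun _ _ => k).
Proof. by exists k, 0 => n B; rewrite expn0 muln1. Qed.

Lemma polynomial_bricks : polynomial_cost (fun n _ => n).
Proof. by exists 1, 1 => n B; rewrite mul1n expn1; lia. Qed.

Lemma polynomial_bits : polynomial_cost (fun _ B => B).
Proof. by exists 1, 1 => n B; rewrite mul1n expn1; lia. Qed.

Lemma polynomial_add f g : polynomial_cost f -> polynomial_cost g ->
  polynomial_cost (fun n B => f n B + g n B).
Proof.
move=> [c [d hf]] [c' [d' hg]]; exists (c + c'), (d + d') => n B.
rewrite mulnDl; apply: leq_add.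
  by apply: leq_trans (hf n B) _; rewrite leq_mul2l leq_pexp2l ?leq_addr ?orbT.
by apply: leq_trans (hg n B) _; rewrite leq_mul2l leq_pexp2l ?leq_addl ?orbT.
Qed.

Lemma polynomial_mul f g : polynomial_cost f -> polynomial_cost g ->
  polynomial_cost (fun n B => f n B * g n B).
Proof.
move=> [c [d hf]] [c' [d' hg]]; exists (c * c'), (d + d') => n B.
by rewrite expnD mulnACA leq_mul.
Qed.

Lemma polynomial_exp f k : polynomial_cost f -> polynomial_cost (fun n B => f n B ^ k).
Proof.
move=> hf; elim: k => [|k IH]; first exact: (polynomial_const 1).
by apply: polynomial_cost_le (polynomial_mul hf IH) => n B; rewrite expnS.
Qed.

Lemma polynomial_loop f g e : polynomial_cost f -> polynomial_cost g ->
  polynomial_cost (fun n B => loop_cost B (f n B) e (g n B)).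
Proof.
move=> hf hg; have hB := polynomial_mul (polynomial_const (guard_cost e)) polynomial_bits.
exact: polynomial_add (polynomial_mul hf (polynomial_add hB hg)) hB.
Qed.

Lemma polynomial_writes l : polynomial_cost (fun _ B => writes_cost l * B).
Proof. exact: polynomial_mul (polynomial_const _) polynomial_bits. Qed.

Lemma polynomial_for t f e body : polynomial_cost f ->
  polynomial_cost (fun n B => for_cost t B (f n B) e body).
Proof.
move=> hf; apply: polynomial_add (polynomial_writes _) _.
exact: polynomial_loop hf (polynomial_writes _).
Qed.

Lemma polynomial_row t b w (ev : 'I_w -> expr) :
  polynomial_cost (fun n B => row_cost t B n b ev).
Proof. exact: polynomial_for polynomial_bricks. Qed.

Variables (r s t : nat) (A1 : 'M[int]_(r, t)) (A2 : 'M[int]_(s, t)).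
Notation tx := (t + (r + s))%N.
Variables (cst e1 e2 e3 D C : nat) (T : finType) (pat : T -> 'I_C -> 'cV[int]_tx).

Lemma polynomial_sweep : polynomial_cost (sweep_cost pat).
Proof.
apply: polynomial_add (polynomial_writes _) _; apply: polynomial_loop.
  exact: polynomial_exp polynomial_bricks.
apply: polynomial_add (polynomial_writes _); apply: polynomial_add (polynomial_writes _) _.
exact: polynomial_loop polynomial_bits (polynomial_writes _).
Qed.

Lemma polynomial_optimize : polynomial_cost (optimize_cost pat).
Proof.
apply: polynomial_add (polynomial_writes _) _; apply: polynomial_loop polynomial_bits _.
apply: polynomial_add (polynomial_writes _).
apply: polynomial_add (polynomial_writes _) _; apply: polynomial_loop.
  exact: polynomial_mul (polynomial_const _) (polynomial_exp _ polynomial_bricks).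
exact: polynomial_add polynomial_sweep (polynomial_writes _).
Qed.

Lemma polynomial_rho : polynomial_cost (fun n B => rho_cost s A1 n B).
Proof.
rewrite /rho_cost; elim: (enum _) => [|i l IH]; first exact: (polynomial_const 1).
apply: polynomial_add IH; apply: polynomial_add (polynomial_writes _) _.
exact: polynomial_for polynomial_bricks.
Qed.

Lemma polynomial_init : polynomial_cost (fun n B => init_cost A1 A2 cst e1 e2 e3 n B).
Proof.
have row w b (ev : 'I_w -> expr) := polynomial_row tx b ev.
rewrite /init_cost; apply: polynomial_add.
  apply: polynomial_add (polynomial_writes _) _; apply: polynomial_for.
  have nat_mul := polynomial_mul polynomial_bricks (polynomial_const _).
  apply: polynomial_add (nat_mul s); apply: polynomial_add (polynomial_const r).
  apply: polynomial_add (polynomial_const 1) _.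
  exact: polynomial_mul (polynomial_const 5) (nat_mul t).
apply: polynomial_add (polynomial_writes _) _.
do 4![apply: polynomial_add (row _ _ _) _].
apply: polynomial_add (polynomial_for _ _ _ polynomial_bricks) _.
apply: polynomial_add (row _ _ _) _; apply: polynomial_add polynomial_rho _.
do 3![apply: polynomial_add (row _ _ _) _]; exact: polynomial_const.
Qed.

Lemma polynomial_main : polynomial_cost (main_cost A1 A2 cst e1 e2 e3 D pat).
Proof.
have guard e : polynomial_cost (fun _ B => guard_cost e * B).
  exact: polynomial_mul (polynomial_const _) polynomial_bits.
have row w b (ev : 'I_w -> expr) := polynomial_row tx b ev.
apply: polynomial_add polynomial_init _; apply: polynomial_add (guard _) _.
apply: polynomial_add (polynomial_writes _) _; apply: polynomial_add polynomial_optimize _.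
apply: polynomial_add (polynomial_for _ _ _ polynomial_bricks) _.
apply: polynomial_add (guard _) _; apply: polynomial_add (polynomial_writes _) _.
do 2![apply: polynomial_add (row _ _ _) _].
apply: polynomial_add; first exact: polynomial_add (polynomial_writes _) polynomial_sweep.
apply: polynomial_add (polynomial_for _ _ _ polynomial_bricks) _.
exact: polynomial_add (polynomial_writes _) (polynomial_const _).
Qed.

End PolynomialCost.

Section BitBound.
Local Open Scope ring_scope.

Lemma bits_sum_sq (m : memory) k :
  (bits (\sum_(p < k) m p%:Z * m p%:Z)%R <= 1 + 2 * \sum_(p < k) bits (m p%:Z))%N.
Proof.
elim: k => [|k IH]; first by rewrite !big_ord0.
rewrite !big_ord_recr /=; apply: leq_trans (bitsD _ _) _.
apply: leq_trans (leq_add IH (bitsM _ _)) _.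
by move: (\sum_(_ < k) _)%N (bits (m k%:Z)) => a c; lia.
Qed.

Variables (r s t : nat) (A : 'M[int]_(r + s, t)) (C : nat) (T : finType).
Variable pat : T -> 'I_C -> 'cV[int]_(t + (r + s)).

(** The numbers of a run are powers, with a fixed exponent, of a sum of squares of the
    entries of the input, whose length is linear in that of the input. *)
Lemma bit_bound_linear : exists c, forall n l u b w, (0 < n)%N ->
  ((n + bit_bound A pat (n := n) l u b w).+1 <= c * (n + input_length l u b w))%N.
Proof.
exists (2 + expV C * (bits (base_const A pat) + 9) + 2)%N => n l u b w n0.
have := sum_bits_input (r := r) (s := s) l u b w.
set X := (n + _)%N => inputX.
have nX : (n <= X)%N by exact: leq_addr.
have X1 : (1 <= X)%N by exact: leq_trans nX.
have sumX : (\sum_(p < input_size r s t n)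
    bits (init_memory (encode_input n l u b w) p%:Z) <= 3 * X + 1)%N.
  by move: inputX; rewrite (big_nth 0) big_mkord size_encode_input.
have RX : (bits (Rv r s t (base_const A pat) (init_memory (encode_input n l u b w)) n)
    <= (bits (base_const A pat) + 9) * X)%N.
  apply: leq_trans (bitsD _ _) _; apply: leq_trans (leq_add (leqnn _) (bits_sum_sq _ _)) _.
  move: sumX; move: (\sum_(_ < _) _)%N (bits (Posz (base_const A pat))) => a c; nia.
rewrite /bit_bound; move: RX; set x := Rv _ _ _ _ _ _; have := bits_exp x (expV C).
set e := bits (x ^+ _); move: e (bits x) (bits (Posz (base_const A pat))) (expV C) => e f c g h1 h2.
have : (g * f <= g * (c + 9) * X)%N by rewrite -mulnA leq_mul.
by move: (g * f)%N (g * (c + 9))%N h1 => v z h1 h3; nia.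
Qed.

End BitBound.

Theorem theorem1p1 (r s t : nat) (A : 'M[int]_(r + s, t)) :
  exists (alg : program) (c d : nat),
    forall (n : nat) (l u : 'cV[\bar int]_(n * t)) (b : 'cV[int]_(r + n * s))
      (w : 'cV[int]_(n * t)),
      (0 < n)%N ->
      exists (m : memory) (k : nat),
        [/\ exec alg (init_memory (encode_input n l u b w)) m k,
            (k <= c * (n + input_length l u b w) ^ d)%N
          & solves_min w (feasible_set (nfold A n) b l u)
              (decode_answer (n * t) m)].
Proof.
have [C [T [pat [patK pat_small]]]] :=
  small_kernel_element (slack_A1 s (usubmx A)) (slack_A2 r (dsubmx A)).
have [c1 lin] := bit_bound_linear A pat.
have [c [d cost]] := polynomial_main (usubmx A) (dsubmx A) (base_const A pat)
  (expO C) (expW C) (expL C) (move_bound pat) pat.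
exists (main (usubmx A) (dsubmx A) (base_const A pat) (expO C) (expW C) (expL C)
  (move_bound pat) pat), (c * c1 ^ d)%N, d => n l u b w n0.
have [m [k [run kle out]]] := main_hoare patK pat_small n0 (l := l) (u := u) (b := b) (w := w) erefl.
exists m, k; split=> //; last exact: (outcome_sound patK pat_small n0 out).
apply: leq_trans kle _; apply: leq_trans (cost _ _) _.
rewrite -mulnA -expnMn leq_mul2l; apply/orP; right.
by case: (d) => [|d']; rewrite ?expn0 // leq_exp2r // lin.
Qed.
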